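(* For every $\varepsilon\in(0,1)$ there is a randomized algorithm which, given an instance $(A,t)$ of $\mathrm{CVP}_\infty$ in dimension $n$ with binary encoding length $b$, computes a lattice vector $v\in\Lambda(A)$ with $\|v-t\|_\infty\le(1+\varepsilon)\min\{\|w-t\|_\infty : w\in\Lambda(A)\}$, runs in time $2^{O(n)}(\log 1/\varepsilon)^{O(n)}b^{O(1)}$, and succeeds with probability at least $1-2^{-\Omega(n)}$.
   Context: For $A\in\mathbb{Q}^{n\times n}$ the lattice generated by $A$ is $\Lambda(A)=\{Ax : x\in\mathbb{Z}^n\}$. The closest vector problem in the $\ell_\infty$-norm ($\mathrm{CVP}_\infty$): given $A\in\mathbb{Q}^{n\times n}$ and a target vector $t\in\mathbb{Q}^n$, find a lattice vector in $\Lambda(A)$ closest to $t$ with respect to $\|\cdot\|_\infty$. A $(1+\varepsilon)$-approximation is a lattice vector whose $\ell_\infty$-distance to $t$ is at most $(1+\varepsilon)$ times the minimum distance. $b$ denotes the binary encoding length of the input $(A,t)$. Logarithms are base 2. *)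

(* Defs.v *)
From HB Require Import structures.
From mathcomp Require Import all_boot all_order all_algebra.
From mathcomp Require Import boolp classical_sets reals normedtype exp.

Set Implicit Arguments.
Unset Strict Implicit.
Unset Printing Implicit Defensive.
Import Order.TTheory GRing.Theory Num.Theory.
Local Open Scope ring_scope.

Definition in_lattice (n : nat) (A : 'M[rat]_n) (v : 'cV[rat]_n) : Prop :=
  exists x : 'cV[int]_n, v = A *m map_mx intr x.

(* [mx_norm] is the maximum of the absolute values of the entries. *)
Definition dist_inf (n : nat) (v w : 'cV[rat]_n) : rat := mx_norm (v - w).

Definition closest (n : nat) (A : 'M[rat]_n) (t w : 'cV[rat]_n) : Prop :=
  in_lattice A w /\
  forall w', in_lattice A w' -> dist_inf w t <= dist_inf w' t.

Definition approx_closest (R : realType) (eps : R) (n : nat)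
    (A : 'M[rat]_n) (t v : 'cV[rat]_n) : Prop :=
  in_lattice A v /\
  exists2 w, closest A t w &
    ratr (dist_inf v t) <= (1 + eps) * ratr (dist_inf w t).

(* One sign bit, and the binary digits of |z| (one digit for z = 0). *)
Definition bitlen (z : int) : nat := (trunc_log 2 `|z|).+2.

Definition entries (m n : nat) (A : 'M[rat]_(m, n)) : seq rat :=
  [seq A i j | i <- enum 'I_m, j <- enum 'I_n].

(* The dimension, then A row by row, then t, every rational being written as
   its reduced numerator followed by its positive denominator. *)
Definition instance_code (n : nat) (A : 'M[rat]_n) (t : 'cV[rat]_n) : seq int :=
  Posz n :: flatten [seq [:: numq q; denq q] | q <- entries A ++ entries t].

Definition encoding_length (n : nat) (A : 'M[rat]_n) (t : 'cV[rat]_n) : nat :=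
  \sum_(z <- instance_code A t) bitlen z.

(* Randomized algorithms are programs of a random access machine with integer
   cells, under the logarithmic cost criterion: an instruction costs the total
   bit length of the numbers and addresses that it handles. Such a machine and
   a Turing machine simulate each other with polynomial overhead. Registers are
   addressed by the program text only; the heap is addressed through the
   contents of registers. *)
Inductive arith := OpAdd | OpSub | OpMul | OpDiv.

Inductive instr :=
| Const of nat & int                (* r_d := z *)
| Arith of arith & nat & nat & nat  (* r_d := r_x op r_y *)
| Read of nat & nat                 (* r_d := heap[|r_a|] *)
| Write of nat & nat                (* heap[|r_a|] := r_s *)
| Flip of nat                       (* r_d := a fair random bit *)
| Jump of nat & nat.                (* if r_x > 0 then goto l *)

Definition program := seq instr.

Record config := Config {
  pc : nat;
  reg : nat -> int;
  heap : nat -> int;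
  cost : nat
}.

Definition upd (f : nat -> int) (i : nat) (z : int) : nat -> int :=
  fun j => if j == i then z else f j.

(* Floor division for a positive divisor; the quotient by 0 is 0. *)
Definition arith_eval (o : arith) (x y : int) : int :=
  match o with
  | OpAdd => x + y
  | OpSub => x - y
  | OpMul => x * y
  | OpDiv => (x %/ y)%Z
  end.

Definition exec (i : instr) (coin : bool) (c : config) : config :=
  let: Config p r h k := c in
  match i with
  | Const d z => Config p.+1 (upd r d z) h (k + bitlen z)
  | Arith o d x y =>
      Config p.+1 (upd r d (arith_eval o (r x) (r y))) h
        (k + bitlen (r x) + bitlen (r y))
  | Read d a =>
      let z := h `|r a|%N in
      Config p.+1 (upd r d z) h (k + bitlen (r a) + bitlen z)
  | Write a s =>
      Config p.+1 r (upd h `|r a|%N (r s)) (k + bitlen (r a) + bitlen (r s))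
  | Flip d => Config p.+1 (upd r d (Posz coin)) h k.+1
  | Jump x l => Config (if 0 < r x then l else p.+1) r h (k + bitlen (r x))
  end.

Definition halted (P : program) (c : config) : bool := (size P <= pc c)%N.

Definition step (P : program) (c : config) (coin : bool) : config :=
  if halted P c then c else exec (nth (Flip 0) P (pc c)) coin c.

Definition init (s : seq int) : config :=
  Config 0 (fun=> 0) (fun i => nth 0 s i) 0.

(* The j-th step draws the j-th coin, whether or not it is a [Flip]. *)
Definition run (P : program) (s : seq int) (coins : seq bool) : config :=
  foldl (step P) (init s) coins.

(* A step costs at least 1, so a run of cost at most T has at most T steps and
   T coins determine it. *)
Definition runs_in_time (P : program) (s : seq int) (T : nat) : Prop :=
  forall coins : T.-tuple bool,
    halted P (run P s coins) /\ (cost (run P s coins) <= T)%N.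

(* Entry i of the result is the fraction heap[2i] / heap[2i+1]. *)
Definition output (n : nat) (c : config) : 'cV[rat]_n :=
  \col_i ((heap c i.*2)%:~R / (heap c i.*2.+1)%:~R).

Definition coin_prob (R : realType) (T : nat) (E : T.-tuple bool -> Prop) : R :=
  #|[pred coins : T.-tuple bool | `[< E coins >]]|%:R / 2 ^+ T.

Definition log2 (R : realType) (x : R) : R := ln x / ln 2.

(* Main.v *)
(* The algorithm is an Ajtai-Kumar-Sivakumar sieve in the maximum norm. The
   instance is scaled to integers, and a binary search looks for the smallest
   radius at which the sieve finds a lattice vector. At a given radius the box
   of possible differences w - t is covered by (128 (e + 1))^n boxes, where
   2^-e <= eps, which are finer near the boundary: enlarging one of them 16
   times increases the distance by a factor of at most 1 + 2^-e. Each box is rescaled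
   to a cube, so that the target becomes an additional generator of the lattice
   for which a constant factor approximation suffices.

   The sieve perturbs random lattice vectors and sends them through a table
   with 3 m levels of 2 * 4^n cells; at each level a vector is stored in an
   empty cell or reduced by the vector stored there, which halves the norm.
   Replacing the perturbation x by x - (A u - t) and the coefficient tau of the
   target by 1 - tau does not change the visible data; it is possible for a
   fraction 4^-n of the perturbations. Hence a trial sees a vector with nonzero
   target coefficient with probability at least 4^-(n+1), and independent
   repetitions with a union bound over the radii give the success probability.
   All random digits are drawn before the data are looked at, so their
   positions on the coin tape are fixed. Vectors are packed into single
   integers in base Q, so that no linear algebra is needed. *)

Require Import Defs.
From mathcomp Require Import all_boot all_order all_algebra.
From mathcomp Require Import zify ring.
Set Implicit Arguments.
Unset Strict Implicit.
Unset Printing Implicit Defensive.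
Import Order.TTheory GRing.Theory Num.Theory.

(** The matrix is not assumed invertible, so a lattice vector near the target need not come with
    small coefficients; the pigeonhole principle reduces them, in place of Cramer's rule. A packed
    vector has three blocks: a low block of n rescaled coordinates, one digit for the target
    coefficient, and a high block of n unscaled coordinates, which serves to test and to output the
    answer. The sieve looks at the low n+1 digits alone, so an exchange of hidden data has to
    preserve a sample only modulo Q^(n+1). Since step j of the machine draws coin j, the duration of
    the phase that fills the tape must be known exactly and the phase before it must not depend on
    the coins; elsewhere upper bounds suffice. Acceptance need not be monotone in the radius: in the
    lucky case the search ends with neighbours lo and lo+1 such that lo is 0 or failed and lo+1 gave
    a vector, and as scaled distances are multiples of 128 2^e this is enough. Whether a trial hits
    at a radius is defined by its random digits alone, starting from an empty table, so that the
    union bound can range over all radii, visited or not. *)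

(** * A structured language with exact step counts, and its compiler *)

Module WhileLanguage.
Local Open Scope nat_scope.

Inductive expr := Lit of int | Var of nat | Bin of arith & expr & expr | Get of expr.

Inductive cmd :=
| Skip
| Asg of nat & expr
| Put of expr & expr
| Rnd of nat
| Seq of cmd & cmd
| While of expr & cmd
| If of expr & cmd & cmd.

Fixpoint eval (r h : nat -> int) (e : expr) : int :=
  match e with
  | Lit z => z
  | Var x => r x
  | Bin o a b => arith_eval o (eval r h a) (eval r h b)
  | Get a => h `|eval r h a|%N
  end.

(* Variables live in the odd registers and temporaries in the even ones. *)
Fixpoint compile_expr (e : expr) (k : nat) : program :=
  match e with
  | Lit z => [:: Const k.*2 z]
  | Var x => [:: Const k.*2 0%R; Arith OpAdd k.*2 x.*2.+1 k.*2]
  | Bin o a b =>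
      compile_expr a k ++ compile_expr b k.+1 ++ [:: Arith o k.*2 k.*2 k.+1.*2]
  | Get a => compile_expr a k ++ [:: Read k.*2 k.*2]
  end.

Fixpoint esize (e : expr) : nat :=
  match e with
  | Lit _ => 1
  | Var _ => 2
  | Bin _ a b => esize a + esize b + 1
  | Get a => esize a + 1
  end.

(** Jump targets are absolute, hence the start address [p]. Conditions are evaluated into register
    0, and an unconditional jump sets register 0 to 1. *)
Fixpoint compile (c : cmd) (p : nat) : program :=
  match c with
  | Skip => [::]
  | Asg x e => compile_expr e 0 ++ [:: Const 2 0%R; Arith OpAdd x.*2.+1 0 2]
  | Put a b => compile_expr a 0 ++ compile_expr b 1 ++ [:: Write 0 2]
  | Rnd x => [:: Flip x.*2.+1]
  | Seq a b => compile a p ++ compile b (p + size (compile a p))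
  | While e a =>
      let q := p + esize e + 3 in
      compile_expr e 0 ++
      ([:: Jump 0 q; Const 0 1%R; Jump 0 (q + size (compile a q) + 2)] ++
       (compile a q ++ [:: Const 0 1%R; Jump 0 p]))
  | If e a b =>
      let q := p + esize e + 1 in
      let q' := q + size (compile b q) + 2 in
      compile_expr e 0 ++
      ([:: Jump 0 q'] ++
       (compile b q ++
        ([:: Const 0 1%R; Jump 0 (q' + size (compile a q'))] ++ compile a q')))
  end.

Lemma size_compile_expr e k : size (compile_expr e k) = esize e.
Proof.
elim: e k => [z|x|o a IHa b IHb|a IHa] k //=; rewrite ?size_cat ?IHa ?IHb /=; lia.
Qed.

Record state := State { vars : nat -> int; memory : nat -> int; clock : nat }.

Definition bounded (Z : nat) (z : int) : Prop := `|z|%N < 2 ^ Z.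

Definition tick (s : state) (k : nat) : state :=
  State (vars s) (memory s) (clock s + k).

Section Semantics.
Variables (Z : nat) (coin : nat -> bool).

(** The clock advances by the exact number of machine steps of the compiled code, so that [Rnd]
    reads the coin that the machine reads. Only stored values are required to have at most [Z] bits;
    intermediate values are controlled by the size of the expression. *)
Inductive ev : cmd -> state -> state -> Prop :=
| EvSkip s : ev Skip s s
| EvAsg x e r h j : bounded Z (eval r h e) ->
    ev (Asg x e) (State r h j)
       (State (upd r x (eval r h e)) h (j + (esize e + 2)))
| EvPut a b r h j : bounded Z (eval r h b) ->
    ev (Put a b) (State r h j)
       (State r (upd h `|eval r h a|%N (eval r h b)) (j + (esize a + esize b + 1)))
| EvRnd x r h j :
    ev (Rnd x) (State r h j) (State (upd r x (Posz (coin j))) h j.+1)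
| EvSeq a b s1 s2 s3 : ev a s1 s2 -> ev b s2 s3 -> ev (Seq a b) s1 s3
| EvWhileF e a s : ~~ (0 < eval (vars s) (memory s) e)%R ->
    ev (While e a) s (tick s (esize e + 3))
| EvWhileT e a s s1 s2 : (0 < eval (vars s) (memory s) e)%R ->
    ev a (tick s (esize e + 1)) s1 -> ev (While e a) (tick s1 2) s2 ->
    ev (While e a) s s2
| EvIfT e a b s s1 : (0 < eval (vars s) (memory s) e)%R ->
    ev a (tick s (esize e + 1)) s1 -> ev (If e a b) s s1
| EvIfF e a b s s1 : ~~ (0 < eval (vars s) (memory s) e)%R ->
    ev b (tick s (esize e + 1)) s1 -> ev (If e a b) s (tick s1 2).

End Semantics.

Fixpoint writes (c : cmd) : seq nat :=
  match c with
  | Asg x _ | Rnd x => [:: x]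
  | Seq a b | If _ a b => writes a ++ writes b
  | While _ a => writes a
  | _ => [::]
  end.

Fixpoint puts (c : cmd) : bool :=
  match c with
  | Put _ _ => true
  | Seq a b | If _ a b => puts a || puts b
  | While _ a => puts a
  | _ => false
  end.

Lemma ev_vars Z w c s s' x : ev Z w c s s' -> x \notin writes c ->
  vars s' x = vars s x.
Proof.
elim=> //= {s s' c}.
- by move=> y e r h j _; rewrite inE /upd => /negbTE->.
- by move=> y r h j; rewrite inE /upd => /negbTE->.
- by move=> a b s1 s2 s3 _ IH1 _ IH2; rewrite mem_cat negb_or => /andP[? ?]; rewrite IH2 ?IH1.
- by move=> e a s s1 s2 _ _ IH1 _ IH2 xa; rewrite IH2 //= IH1.
- by move=> e a b s s1 _ _ IH; rewrite mem_cat negb_or => /andP[? ?]; rewrite IH.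
- by move=> e a b s s1 _ _ IH; rewrite mem_cat negb_or => /andP[? ?]; rewrite IH.
Qed.

Lemma ev_mem Z w c s s' : ev Z w c s s' -> ~~ puts c -> memory s' = memory s.
Proof.
elim=> //= {s s' c}.
- by move=> a b s1 s2 s3 _ IH1 _ IH2; rewrite negb_or => /andP[? ?]; rewrite IH2 ?IH1.
- by move=> e a s s1 s2 _ _ IH1 _ IH2 xa; rewrite IH2 //= IH1.
- by move=> e a b s s1 _ _ IH; rewrite negb_or => /andP[? ?]; rewrite IH.
- by move=> e a b s s1 _ _ IH; rewrite negb_or => /andP[? ?]; rewrite IH.
Qed.

Lemma ev_clock Z w c s s' : ev Z w c s s' -> clock s <= clock s'.
Proof. by elim=> /=; lia. Qed.

Definition state_bounded Z (s : state) :=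
  (forall x, bounded Z (vars s x)) /\ (forall a, bounded Z (memory s a)).

Lemma ev_bounded Z w c s s' : 0 < Z -> ev Z w c s s' -> state_bounded Z s ->
  state_bounded Z s'.
Proof.
move=> Z0; elim=> //= {s s' c}.
- move=> x e r h j be [br bh]; split=> //= y; rewrite /upd; by case: eqP.
- move=> a b r h j be [br bh]; split=> //= y; rewrite /upd; by case: eqP.
- move=> x r h j [br bh]; split=> //= y; rewrite /upd; case: eqP => // _.
  by rewrite /bounded; case: (w j); rewrite /= ?expn_gt0 // -{1}(expn0 2) ltn_exp2l.
- by move=> a b s1 s2 s3 _ IH1 _ IH2 /IH1/IH2.
- by move=> e a s s1 s2 _ _ IH1 _ IH2 bs; apply: IH2; case: (IH1 bs).
Qed.

Fixpoint econsts (Z : nat) (e : expr) : bool :=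
  match e with
  | Lit z => `|z|%N < 2 ^ Z
  | Var _ => true
  | Bin _ a b => econsts Z a && econsts Z b
  | Get a => econsts Z a
  end.

(* Every constant of the command has less than Z bits. *)
Fixpoint consts (Z : nat) (c : cmd) : bool :=
  match c with
  | Skip | Rnd _ => true
  | Asg _ e => econsts Z e
  | Put a b => econsts Z a && econsts Z b
  | Seq a b => consts Z a && consts Z b
  | While e a => econsts Z e && consts Z a
  | If e a b => [&& econsts Z e, consts Z a & consts Z b]
  end.

Fixpoint max_esize (c : cmd) : nat :=
  match c with
  | Skip | Rnd _ => 0
  | Asg _ e => esize e
  | Put a b => maxn (esize a) (esize b)
  | Seq a b => maxn (max_esize a) (max_esize b)
  | While e a => maxn (esize e) (max_esize a)
  | If e a b => maxn (esize e) (maxn (max_esize a) (max_esize b))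
  end.

Lemma esize_gt0 e : 0 < esize e. Proof. by case: e => //= *; lia. Qed.

End WhileLanguage.
Import WhileLanguage.

(** * Correctness and cost of the compiled code *)

Module Compilation.
Local Open Scope nat_scope.

Lemma absz_divz_le (x y : int) : `|(x %/ y)%Z|%N <= `|x|%N.
Proof.
have [->|y0] := eqVneq y 0%R; first by rewrite divz0.
have := divz_eq x y; have := modz_ge0 x y0; have := ltz_mod x y0.
by move: (x %/ y)%Z (x %% y)%Z => q r; nia.
Qed.

Lemma bounded_le k l z : k <= l -> bounded k z -> bounded l z.
Proof. by move=> kl bz; apply: leq_trans bz _; rewrite leq_exp2l. Qed.

Lemma addn_le_mul3 a b c : 0 < a -> 0 < b -> 1 < c -> a + b <= a * b * c.
Proof.
move=> a0 b0 c1; apply: (@leq_trans (a * b * 2)); last by rewrite leq_mul2l c1 orbT.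
by rewrite muln2 -addnn leq_add // (leq_pmulr, leq_pmull).
Qed.

(** An operator needs at most one bit more than its operands have together, and [Z] is at least
    1. *)
Lemma bounded_eval Z r h e : 0 < Z -> econsts Z e ->
  (forall x, bounded Z (r x)) -> (forall a, bounded Z (h a)) ->
  bounded (Z * esize e) (eval r h e).
Proof.
move=> Z0 + br bh; elim: e => [z|x|o a IHa b IHb|a IHa] /=.
- by rewrite muln1.
- by move=> _; apply: bounded_le (br x); lia.
- case/andP=> /IHa {}IHa /IHb {}IHb; rewrite /bounded in IHa IHb *.
  have Pa : 0 < 2 ^ (Z * esize a) by rewrite expn_gt0.
  have Pb : 0 < 2 ^ (Z * esize b) by rewrite expn_gt0.
  have -> : Z * (esize a + esize b + 1) = Z * esize a + Z * esize b + Z by lia.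
  rewrite !expnD; have PZ : 2 <= 2 ^ Z by rewrite -{1}(expn1 2) leq_exp2l.
  case: o => /=.
  + move: IHa IHb Pa Pb PZ.
    move: (2 ^ (Z * esize a)) (2 ^ (Z * esize b)) (2 ^ Z) (eval r h a) (eval r h b).
    move=> A B C x y *.
    have : `|(x + y)%R|%N < A + B by lia.
    by move=> xy; apply: leq_trans xy _; exact: addn_le_mul3.
  + move: IHa IHb Pa Pb PZ.
    move: (2 ^ (Z * esize a)) (2 ^ (Z * esize b)) (2 ^ Z) (eval r h a) (eval r h b).
    move=> A B C x y *.
    have : `|(x - y)%R|%N < A + B by lia.
    by move=> xy; apply: leq_trans xy _; exact: addn_le_mul3.
  + rewrite abszM; move: IHa IHb Pa Pb PZ.
    move: (2 ^ (Z * esize a)) (2 ^ (Z * esize b)) (2 ^ Z) (absz _) (absz _).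
    move=> A B C x y *; apply: (@leq_trans (A * B)); first exact: ltn_mul.
    by rewrite leq_pmulr //; lia.
  + apply: leq_ltn_trans (absz_divz_le _ _) _; apply: leq_trans IHa _.
    by rewrite -mulnA leq_pmulr // muln_gt0 Pb; lia.
- by move=> _; apply: bounded_le (bh _); nia.
Qed.

Lemma bitlen_bounded k z : bounded k z -> bitlen z <= k + 2.
Proof.
rewrite /bounded /bitlen => zk; have [->|z0] := posnP `|z|%N; first by rewrite trunc_log0; lia.
suff : trunc_log 2 `|z| <= k by lia.
rewrite -(@leq_exp2l 2) //; apply: leq_trans (trunc_logP _ _) _ => //; exact: ltnW.
Qed.

Definition code_at (P : program) (p : nat) (cd : program) :=
  exists pre post, P = pre ++ cd ++ post /\ size pre = p.

Lemma code_at_cat P p a b : code_at P p (a ++ b) ->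
  code_at P p a /\ code_at P (p + size a) b.
Proof.
move=> [pre [post [-> <-]]]; split.
  by exists pre, (b ++ post); rewrite !catA.
by exists (pre ++ a), post; rewrite size_cat !catA.
Qed.

Lemma code_at_cons P p i a : code_at P p (i :: a) ->
  [/\ nth (Flip 0) P p = i, p < size P & code_at P p.+1 a].
Proof.
move=> [pre [post [-> <-]]]; split.
- by rewrite nth_cat ltnn subnn.
- by rewrite !size_cat /=; lia.
- by exists (rcons pre i), post; rewrite size_rcons cat_rcons.
Qed.

Lemma leq_mul_max Z a b W : Z * maxn a b <= W -> Z * a <= W /\ Z * b <= W.
Proof. by rewrite maxnMr geq_max => /andP. Qed.

Section Simulation.
Variables (P : program) (coin : nat -> bool) (W : nat).

(** A step handles at most two numbers of bit length at most [W + 2], which gives the factor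
    [2 * (W + 2)]. The coins used are those with index from [j] to [j'] exclusive. *)
Definition reach j c j' c' :=
  [/\ j <= j', foldl (step P) c [seq coin i | i <- iota j (j' - j)] = c'
    & cost c' <= cost c + (j' - j) * (2 * (W + 2))].

Lemma reach_refl j c : reach j c j c.
Proof. by split; rewrite // subnn //; lia. Qed.

Lemma reach_trans j1 c1 j2 c2 j3 c3 :
  reach j1 c1 j2 c2 -> reach j2 c2 j3 c3 -> reach j1 c1 j3 c3.
Proof.
move=> [l1 e1 k1] [l2 e2 k2]; split; [lia| |nia].
have -> : j3 - j1 = (j2 - j1) + (j3 - j2) by lia.
by rewrite iotaD map_cat foldl_cat e1 subnKC.
Qed.

Lemma reach1 j c i : nth (Flip 0) P (pc c) = i -> pc c < size P ->
  cost (exec i (coin j) c) <= cost c + 2 * (W + 2) ->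
  reach j c j.+1 (exec i (coin j) c).
Proof.
move=> ni hc kc; split; rewrite ?subSnn //=; last lia.
by rewrite /step /halted leqNgt hc /= ni.
Qed.

(** Preserving the even registers below [k.*2] protects the left operand of an operator while the
    right one is evaluated at depth [k.+1]. *)
Lemma reach_expr Z e k j c p r h :
  0 < Z -> econsts Z e -> Z * esize e <= W ->
  (forall x, bounded Z (r x)) -> (forall a, bounded Z (h a)) ->
  code_at P p (compile_expr e k) -> pc c = p ->
  (forall x, reg c x.*2.+1 = r x) -> heap c = h ->
  exists c', [/\ reach j c (j + esize e) c', pc c' = p + esize e,
    reg c' k.*2 = eval r h e,
    (forall y, odd y || (y < k.*2) -> reg c' y = reg c y) & heap c' = h].
Proof.
move=> Z0 + + br bh; elim: e k j c p => [z|x|o a IHa b IHb|a IHa] k j c p /=.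
- move=> bz zW /code_at_cons[ni hp _] ep er eh.
  exists (exec (Const k.*2 z) (coin j) c).
  have bzW : bitlen z <= W + 2 by apply/bitlen_bounded/(bounded_le zW); rewrite muln1.
  rewrite addn1; split.
  + by apply: reach1; rewrite ?ep //; case: (c) => /= *; lia.
  + by case: (c) ep => /= *; lia.
  + by case: (c) => /= *; rewrite /upd eqxx.
  + move=> y oy; case: (c) => /= *; rewrite /upd; case: eqP => // ey.
    by move: oy; rewrite ey odd_double ltnn.
  + by case: (c) eh.
- move=> _ zW /code_at_cons[n1 h1 /code_at_cons[n2 h2 _]] ep er eh.
  set i1 := Const _ _ in n1; set i2 := Arith _ _ _ _ in n2.
  exists (exec i2 (coin j.+1) (exec i1 (coin j) c)).
  have b0 : bitlen 0 <= 2 by [].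
  have bx : bitlen (r x) <= W + 2 by apply/bitlen_bounded/(bounded_le _ (br x)); lia.
  rewrite addn2; split.
  + apply: reach_trans (_ : reach j c j.+1 (exec i1 (coin j) c)) _; apply: reach1.
    * by rewrite ep.
    * by rewrite ep.
    * by case: (c) => /= *; lia.
    * by case: (c) ep => /= *; rewrite -n2; congr nth; lia.
    * by case: (c) ep => /= *; lia.
    * case: (c) er => /= ? ? ? ? er; rewrite /upd eqxx; case: eqP => [|_]; first lia.
      by rewrite er; lia.
  + by case: (c) ep => /= *; lia.
  + case: (c) er => /= ? ? ? ? er; rewrite /upd !eqxx; case: eqP => [|_]; first lia.
    by rewrite addr0 er.
  + move=> y oy; case: (c) => /= *; rewrite /upd; case: eqP => // ey.
    by move: oy; rewrite ey odd_double ltnn.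
  + by case: (c) eh.
- case/andP=> ca cb zW /code_at_cat[cda /code_at_cat[cdb /code_at_cons[ni hp _]]] ep er eh.
  rewrite !size_compile_expr in cdb ni hp.
  have za : Z * esize a <= W by nia.
  have zb : Z * esize b <= W by nia.
  have [c1 [R1 p1 v1 f1 h1]] := IHa k j c p ca za cda ep er eh.
  have [|c2 [R2 p2 v2 f2 h2]] := IHb k.+1 (j + esize a) c1 _ cb zb cdb p1 _ h1.
    by move=> x; rewrite f1 ?er //= odd_double.
  have v1' : reg c2 k.*2 = eval r h a by rewrite f2 ?v1 //; lia.
  set i := Arith _ _ _ _ in ni.
  have ba : bitlen (eval r h a) <= W + 2.
    by apply/bitlen_bounded/(bounded_le za)/bounded_eval.
  have bb : bitlen (eval r h b) <= W + 2.
    by apply/bitlen_bounded/(bounded_le zb)/bounded_eval.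
  exists (exec i (coin (j + esize a + esize b)) c2); split.
  + apply: reach_trans R1 _; apply: reach_trans R2 _.
    rewrite [X in reach _ _ X _](_ : _ = (j + esize a + esize b).+1); last lia.
    apply: reach1; rewrite ?p2 //.
    by case: (c2) v1' v2 => /= ? ? ? ? v1' v2; rewrite v1' v2; lia.
  + by case: (c2) p2 => /= *; lia.
  + by case: (c2) v1' v2 => /= ? ? ? ? v1' v2; rewrite v1' v2 /upd eqxx.
  + move=> y oy; rewrite -f1 // -f2; last by move: oy; lia.
    case: (c2) => /= *; rewrite /upd; case: eqP => // ey.
    by move: oy; rewrite ey odd_double ltnn.
  + by case: (c2) h2.
- move=> ca zW /code_at_cat[cda /code_at_cons[ni hp _]] ep er eh.
  rewrite !size_compile_expr in ni hp.
  have za : Z * esize a <= W by nia.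
  have [c1 [R1 p1 v1 f1 h1]] := IHa k j c p ca za cda ep er eh.
  set i := Read _ _ in ni.
  have ba : bitlen (eval r h a) <= W + 2.
    by apply/bitlen_bounded/(bounded_le za)/bounded_eval.
  have bb : bitlen (h `|eval r h a|%N) <= W + 2.
    by apply/bitlen_bounded/(bounded_le _ (bh _)); have := esize_gt0 a; nia.
  exists (exec i (coin (j + esize a)) c1); split.
  + apply: reach_trans R1 _.
    rewrite [X in reach _ _ X _](_ : _ = (j + esize a).+1); last lia.
    apply: reach1; rewrite ?p1 //.
    by case: (c1) v1 h1 => /= ? ? ? ? v1 h1; rewrite v1 h1; lia.
  + by case: (c1) p1 => /= *; lia.
  + by case: (c1) v1 h1 => /= ? ? ? ? v1 h1; rewrite v1 h1 /upd eqxx.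
  + move=> y oy; rewrite -f1 //.
    case: (c1) => /= *; rewrite /upd; case: eqP => // ey.
    by move: oy; rewrite ey odd_double ltnn.
  + by case: (c1) h1.
Qed.

Definition agree (c : config) (s : state) :=
  (forall x, reg c x.*2.+1 = vars s x) /\ heap c = memory s.

Lemma reach_const j c p z l : code_at P p (Const 0 z :: l) -> pc c = p ->
  bitlen z <= 2 ->
  reach j c j.+1 (Config p.+1 (upd (reg c) 0 z) (heap c) (cost c + bitlen z)).
Proof.
move=> /code_at_cons[ni hp _] ep bz.
case: c ep => q r h k /= ep.
by have := @reach1 j (Config q r h k) (Const 0 z); rewrite /= ep; apply=> //; lia.
Qed.

Lemma reach_jump j c p l cd : code_at P p (Jump 0 l :: cd) -> pc c = p ->
  bitlen (reg c 0) <= W + 2 ->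
  reach j c j.+1 (Config (if (0 < reg c 0)%R then l else p.+1) (reg c) (heap c)
                    (cost c + bitlen (reg c 0))).
Proof.
move=> /code_at_cons[ni hp _] ep bz.
case: c ep bz => q r h k /= ep bz.
by have := @reach1 j (Config q r h k) (Jump 0 l); rewrite /= ep; apply=> //; lia.
Qed.

Lemma reach_goto j c p l cd : code_at P p [:: Const 0 1%R, Jump 0 l & cd] ->
  pc c = p -> exists c', [/\ reach j c (j + 2) c', pc c' = l,
    forall x, reg c' x.*2.+1 = reg c x.*2.+1 & heap c' = heap c].
Proof.
move=> cd0 ep; have /code_at_cons[_ _ cd1] := cd0.
have R1 := reach_const j cd0 ep (isT : bitlen 1 <= 2).
have /= := @reach_jump j.+1 (Config p.+1 (upd (reg c) 0 1%R) (heap c) (cost c + bitlen 1)) _ _ _ cd1 erefl.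
rewrite /upd /= => R2; eexists; split.
- by rewrite addn2; apply: reach_trans R1 (R2 _); exact: leq_trans (isT : bitlen 1 <= 2) (leq_addl _ _).
- by [].
- by [].
- by [].
Qed.

Lemma compile_while e a p : compile (While e a) p =
  compile_expr e 0 ++
  ([:: Jump 0 (p + esize e + 3); Const 0 1%R;
       Jump 0 (p + esize e + 3 + size (compile a (p + esize e + 3)) + 2)] ++
   (compile a (p + esize e + 3) ++ [:: Const 0 1%R; Jump 0 p])).
Proof. by []. Qed.

Lemma compile_if e a b p : compile (If e a b) p =
  let q := p + esize e + 1 in
  let q' := q + size (compile b q) + 2 in
  compile_expr e 0 ++
  ([:: Jump 0 q'] ++
   (compile b q ++
    ([:: Const 0 1%R; Jump 0 (q' + size (compile a q'))] ++ compile a q'))).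
Proof. by []. Qed.

(** The induction is on the evaluation and not on the command: after its body a loop is entered
    again at the same address, as a smaller evaluation. *)
Theorem simulation Z c s s' : 0 < Z -> ev Z coin c s s' ->
  consts Z c -> Z * max_esize c <= W -> state_bounded Z s ->
  forall p cf, code_at P p (compile c p) -> pc cf = p -> agree cf s ->
  exists cf', [/\ reach (clock s) cf (clock s') cf', pc cf' = p + size (compile c p)
    & agree cf' s'].
Proof.
move=> Z0; elim=> {c s s'}.
- move=> s _ _ _ p cf _ ep ag; exists cf; split=> //; first exact: reach_refl.
  by rewrite addn0.
- move=> x e r h j be ce zW [br bh] p cf /= /code_at_cat[cde] + ep [er eh].
  rewrite size_compile_expr => /code_at_cons[n1 h1 /code_at_cons[n2 h2 _]].
  have [c1 [R1 p1 v1 f1 hh1]] := reach_expr j Z0 ce zW br bh cde ep er eh.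
  set i1 := Const _ _ in n1; set i2 := Arith _ _ _ _ in n2.
  have b0 : bitlen 0 <= 2 by [].
  have bx : bitlen (eval r h e) <= W + 2.
    by apply/bitlen_bounded/(bounded_le zW)/bounded_eval.
  exists (exec i2 (coin (j + esize e).+1) (exec i1 (coin (j + esize e)) c1)); split.
  + apply: reach_trans R1 _.
    rewrite [X in reach _ _ X _](_ : _ = (j + esize e).+2); last lia.
    apply: reach_trans (_ : reach _ c1 (j + esize e).+1 (exec i1 (coin (j + esize e)) c1)) _; apply: reach1.
    * by rewrite p1.
    * by rewrite p1.
    * by case: (c1) => /= *; lia.
    * by case: (c1) p1 => /= *; rewrite -n2; congr nth; lia.
    * by case: (c1) p1 => /= *; lia.
    * by case: (c1) v1 => /= ? ? ? ? v1; rewrite /upd eqxx /= v1; lia.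
  + by rewrite size_cat size_compile_expr /=; case: (c1) p1 => /= *; lia.
  + split; last by case: (c1) hh1.
    move=> y; have fy : reg c1 y.*2.+1 = r y by rewrite f1 ?er //= odd_double.
    case: (c1) v1 fy => /= ? ? ? ? v1 fy; rewrite /upd eqxx /= v1 addr0.
    rewrite eqSS (inj_eq double_inj) (_ : (y.*2.+1 == 2) = false); last lia.
    by case: eqP.
- move=> a b r h j be /andP[ca cb] zW [br bh] p cf /= /code_at_cat[cda /code_at_cat[cdb]] + ep [er eh].
  rewrite !size_compile_expr in cdb * => /code_at_cons[ni hp _].
  have [za zb] := leq_mul_max zW.
  have [c1 [R1 p1 v1 f1 h1]] := reach_expr j Z0 ca za br bh cda ep er eh.
  have [|c2 [R2 p2 v2 f2 h2]] := reach_expr (j + esize a) Z0 cb zb br bh cdb p1 _ h1.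
    by move=> x; rewrite f1 ?er //= odd_double.
  have v1' : reg c2 0 = eval r h a by rewrite f2 ?v1.
  set i := Write _ _ in ni.
  have ba : bitlen (eval r h a) <= W + 2.
    by apply/bitlen_bounded/(bounded_le za)/bounded_eval.
  have bb : bitlen (eval r h b) <= W + 2.
    by apply/bitlen_bounded/(bounded_le zb)/bounded_eval.
  exists (exec i (coin (j + esize a + esize b)) c2); split.
  + apply: reach_trans R1 _; apply: reach_trans R2 _.
    rewrite [X in reach _ _ X _](_ : _ = (j + esize a + esize b).+1); last lia.
    apply: reach1; rewrite ?p2 //.
    by case: (c2) v1' v2 => /= ? ? ? ? v1' v2; rewrite v1' v2; lia.
  + by rewrite !size_cat !size_compile_expr /=; case: (c2) p2 => /= *; lia.
  + split=> [y|].
      rewrite -er -f1 /= ?odd_double // -f2 /= ?odd_double //; by case: (c2).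
    by case: (c2) v1' v2 h2 => /= ? ? ? ? v1' v2 h2; rewrite v1' v2 h2.
- move=> x r h j _ _ _ p cf /= /code_at_cons[ni hp _] ep [er eh].
  exists (exec (Flip x.*2.+1) (coin j) cf); split.
  + by apply: reach1; rewrite ?ep //; case: (cf) => /= *; lia.
  + by case: (cf) ep => /= *; lia.
  + split; last by case: (cf) eh.
    move=> y; move: (er y); case: (cf) => /= *; rewrite /upd eqSS (inj_eq double_inj).
    by case: eqP.
- move=> a b s1 s2 s3 e1 IH1 e2 IH2 /andP[ca cb] zW bs p cf /= /code_at_cat[cda cdb] ep ag.
  have [za zb] := leq_mul_max zW.
  have [c1 [R1 p1 a1]] := IH1 ca za bs p cf cda ep ag.
  have [c2 [R2 p2 a2]] := IH2 cb zb (ev_bounded Z0 e1 bs) _ c1 cdb p1 a1.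
  exists c2; split=> //; first exact: reach_trans R1 R2.
  by rewrite size_cat addnA.
- move=> e a s ne /andP[ce ca] zW [br bh] p cf cd0 ep [er eh].
  have cd := cd0; rewrite compile_while in cd; have [cde cdr] := code_at_cat cd; rewrite size_compile_expr in cdr.
  have [cdj _] := code_at_cat cdr.
  have [ze za] := leq_mul_max zW.
  have [c1 [R1 p1 v1 f1 h1]] := reach_expr (clock s) Z0 ce ze br bh cde ep er eh.
  have R2 := reach_jump (clock s + esize e) cdj p1.
  have bb : bitlen (reg c1 0) <= W + 2.
    by rewrite v1; apply/bitlen_bounded/(bounded_le ze)/bounded_eval.
  move: (R2 bb) => {}R2; rewrite {1}v1 (negbTE ne) in R2.
  have /code_at_cons[_ _ cd2] := cdj.
  have [c2 [R3 p3 f3 h3]] := reach_goto (clock s + esize e).+1 cd2 (c := Config (p + esize e).+1 (reg c1) (heap c1) (cost c1 + bitlen (reg c1 0))) erefl.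
  exists c2; split.
  + apply: reach_trans R1 _; apply: reach_trans R2 _ => /=.
    by rewrite [X in reach _ _ X _](_ : _ = (clock s + esize e).+1 + 2) //; lia.
  + by rewrite p3 compile_while !size_cat /= size_compile_expr; lia.
  + by split=> /= [y|]; rewrite ?h3 //= f3 /= f1 /= ?odd_double.
- move=> e a s s1 s2 pe e1 IH1 e2 IH2 cea zW bs p cf cd0 ep [er eh].
  have cd := cd0; rewrite compile_while in cd.
  have /andP[ce ca] := cea; have [br bh] := bs.
  have [cde cdr] := code_at_cat cd; rewrite size_compile_expr in cdr.
  have [cdj cdr'] := code_at_cat cdr; have [cda cdg] := code_at_cat cdr'.
  rewrite /= in cda cdg.
    have [ze za] := leq_mul_max zW.
  have [c1 [R1 p1 v1 f1 h1]] := reach_expr (clock s) Z0 ce ze br bh cde ep er eh.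
  have bb : bitlen (reg c1 0) <= W + 2.
    by rewrite v1; apply/bitlen_bounded/(bounded_le ze)/bounded_eval.
  have R2 := reach_jump (clock s + esize e) cdj p1 bb; rewrite {1}v1 pe in R2.
  have [||c2 [R3 p3 a3]] := IH1 ca za bs _ (Config (p + esize e + 3) (reg c1) (heap c1) (cost c1 + bitlen (reg c1 0))) cda _ _.
  + by [].
  + by split=> /= [y|]; rewrite ?h1 //= f1 /= ?odd_double.
  have [c3 [R4 p4 f4 h4]] := reach_goto (clock s1) cdg p3.
  have bs1 : state_bounded Z (tick s1 2).
    by have := ev_bounded Z0 e1 bs; case.
  have [|c4 [R5 p5 a5]] := IH2 cea zW bs1 p c3 cd0 p4.
    by case: a3 => a31 a32; split=> [y|] /=; rewrite ?f4 ?h4.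
  exists c4; split=> //.
  apply: reach_trans R1 _; apply: reach_trans R2 _; rewrite /= addnA addn1 in R3.
  by apply: reach_trans R3 _; apply: reach_trans R4 _.
- move=> e a b s s1 pe e1 IH1 /and3P[ce ca cb] zW bs p cf cd0 ep [er eh].
  have cd := cd0; rewrite compile_if in cd; have [cde cdr] := code_at_cat cd; rewrite size_compile_expr in cdr.
  have [cdj cdr'] := code_at_cat cdr; have [_ cdr2] := code_at_cat cdr'.
  have [_ cda] := code_at_cat cdr2.
  have [br bh] := bs.
  have [ze za] := leq_mul_max zW.
  have [c1 [R1 p1 v1 f1 h1]] := reach_expr (clock s) Z0 ce ze br bh cde ep er eh.
  have bb : bitlen (reg c1 0) <= W + 2.
    by rewrite v1; apply/bitlen_bounded/(bounded_le ze)/bounded_eval.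
  have R2 := reach_jump (clock s + esize e) cdj p1 bb; rewrite {1}v1 pe in R2.
  rewrite /= in cda.
  have [||c2 [R3 p3 a3]] := IH1 ca (leq_mul_max za).1 bs _ (Config (p + esize e + 1 + size (compile b (p + esize e + 1)) + 2) (reg c1) (heap c1) (cost c1 + bitlen (reg c1 0))) cda _ _.
  + by [].
  + by split=> /= [y|]; rewrite ?h1 //= f1 /= ?odd_double.
  exists c2; split=> //.
    apply: reach_trans R1 _; apply: reach_trans R2 _; rewrite /= addnA addn1 in R3.
    exact: R3.
  by rewrite p3 compile_if !size_cat /= size_compile_expr; lia.
- move=> e a b s s1 pe e1 IH1 /and3P[ce ca cb] zW bs p cf cd0 ep [er eh].
  have cd := cd0; rewrite compile_if in cd; have [cde cdr] := code_at_cat cd; rewrite size_compile_expr in cdr.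
  have [cdj cdr'] := code_at_cat cdr; have [cdb cdr2] := code_at_cat cdr'.
  have [cdg _] := code_at_cat cdr2.
  have [br bh] := bs.
  have [ze za] := leq_mul_max zW.
  have [c1 [R1 p1 v1 f1 h1]] := reach_expr (clock s) Z0 ce ze br bh cde ep er eh.
  have bb : bitlen (reg c1 0) <= W + 2.
    by rewrite v1; apply/bitlen_bounded/(bounded_le ze)/bounded_eval.
  have R2 := reach_jump (clock s + esize e) cdj p1 bb; rewrite {1}v1 (negbTE pe) in R2.
  rewrite /= in cdb cdg.
  have [||c2 [R3 p3 a3]] := IH1 cb (leq_mul_max za).2 bs _ (Config (p + esize e).+1 (reg c1) (heap c1) (cost c1 + bitlen (reg c1 0))) cdb _ _.
  + by rewrite /= addn1.
  + by split=> /= [y|]; rewrite ?h1 //= f1 /= ?odd_double.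
  have [c3 [R4 p4 f4 h4]] := reach_goto (clock s1) cdg p3.
  exists c3; split.
  + apply: reach_trans R1 _; apply: reach_trans R2 _; rewrite /= addnA addn1 in R3.
    exact: reach_trans R3 R4.
  + by rewrite p4 compile_if !size_cat /= size_compile_expr; lia.
  + by case: a3 => a31 a32; split=> [y|] /=; rewrite ?f4 ?h4.
Qed.

End Simulation.

End Compilation.
Import Compilation.

(** * Program logic with exact or bounded running time *)

Module Triples.
Local Open Scope nat_scope.

Lemma step_halted P c w : halted P c -> step P c w = c.
Proof. by rewrite /step => ->. Qed.

(** A halted machine ignores the remaining coins, so the coin tuple is split at the clock of the
    final state. *)
Lemma run_of_ev Z c s T (coins : T.-tuple bool) s' :
  0 < Z -> consts Z c ->
  (forall i, bounded Z (nth 0%R s i)) ->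
  ev Z (fun i => nth false coins i) c (State (fun=> 0%R) (fun i => nth 0%R s i) 0) s' ->
  clock s' * (2 * (Z * max_esize c + 2)) <= T ->
  [/\ halted (compile c 0) (run (compile c 0) s coins),
      cost (run (compile c 0) s coins) <= T
    & heap (run (compile c 0) s coins) = memory s'].
Proof.
move=> Z0 cc bs e le; set P := compile c 0; set w := fun i => nth false coins i.
have cd : code_at P 0 (compile c 0) by exists [::], [::]; rewrite cats0.
have bd : state_bounded Z (State (fun=> 0%R) (fun i => nth 0%R s i) 0).
  by split=> //= x; rewrite /bounded /= expn_gt0.
have ag : agree (init s) (State (fun=> 0%R) (fun i => nth 0%R s i) 0) by [].
have [cf [[_ R1 R2] p1 [_ a1]]] :=
  simulation (W := Z * max_esize c) Z0 e cc (leqnn _) bd cd (erefl : pc (init s) = 0) ag.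
rewrite /= subn0 in R1 R2; rewrite add0n in p1.
have hc : halted P cf by rewrite /halted p1.
have lT : clock s' <= T by apply: leq_trans le; rewrite leq_pmulr //; lia.
have E : tval coins = [seq w i | i <- iota 0 (clock s')] ++
                      [seq w i | i <- iota (clock s') (T - clock s')].
  rewrite -map_cat -iotaD subnKC //; apply: (@eq_from_nth _ false).
    by rewrite size_map size_iota size_tuple.
  by move=> i; rewrite size_tuple => iT; rewrite (nth_map 0) ?size_iota // nth_iota.
have -> : run P s coins = cf.
  rewrite /run E foldl_cat R1; elim: (map _ _) => //= b l IH.
  by rewrite step_halted.
by split=> //; apply: leq_trans R2 le.
Qed.

(** One set of rules serves both needs: exact durations where coins are drawn, because their
    positions must be known, and upper bounds elsewhere. *)
Definition rel (b : bool) (x y : nat) : bool := if b then x == y else x <= y.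

Lemma rel_refl b x : rel b x x. Proof. by case: b => /=. Qed.

Lemma relD b x y z k l : rel b y (x + k) -> rel b z (y + l) -> rel b z (x + (k + l)).
Proof. by case: b => /=; lia. Qed.

Section Triples.
Variables (b : bool) (Z : nat) (w : nat -> bool).

(* [c] takes exactly [K] steps if [b], and at most [K] steps otherwise. *)
Definition tri (c : cmd) (s : state) (K : nat) (Q : state -> Prop) :=
  exists s', [/\ ev Z w c s s', rel b (clock s') (clock s + K) & Q s'].

Lemma tri_skip s Q : Q s -> tri Skip s 0 Q.
Proof. by exists s; split=> //; rewrite ?addn0 ?rel_refl //; constructor. Qed.

Lemma tri_asg x e r h j Q : bounded Z (eval r h e) ->
  Q (State (upd r x (eval r h e)) h (j + (esize e + 2))) ->
  tri (Asg x e) (State r h j) (esize e + 2) Q.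
Proof. by move=> be q; eexists; split; [apply: EvAsg| exact: rel_refl| exact: q]. Qed.

Lemma tri_put a e r h j Q : bounded Z (eval r h e) ->
  Q (State r (upd h `|eval r h a|%N (eval r h e)) (j + (esize a + esize e + 1))) ->
  tri (Put a e) (State r h j) (esize a + esize e + 1) Q.
Proof. by move=> be q; eexists; split; [apply: EvPut| exact: rel_refl| exact: q]. Qed.

Lemma tri_rnd x r h j Q : Q (State (upd r x (Posz (w j))) h j.+1) ->
  tri (Rnd x) (State r h j) 1 Q.
Proof. by move=> q; eexists; split; [apply: EvRnd| rewrite addn1; exact: rel_refl| exact: q]. Qed.

Lemma tri_seq c1 c2 s K1 K2 Q : tri c1 s K1 (fun s1 => tri c2 s1 K2 Q) ->
  tri (Seq c1 c2) s (K1 + K2) Q.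
Proof.
move=> [s1 [e1 l1 [s2 [e2 l2 q]]]]; exists s2; split=> //.
  exact: EvSeq e1 e2.
exact: relD l1 l2.
Qed.

Lemma tri_conseq c s K (Q Q' : state -> Prop) : tri c s K Q ->
  (forall s', Q s' -> (forall x, x \notin writes c -> vars s' x = vars s x) ->
     (~~ puts c -> memory s' = memory s) -> rel b (clock s') (clock s + K) -> Q' s') ->
  tri c s K Q'.
Proof.
move=> [s1 [e1 l1 q]] QQ; exists s1; split=> //; apply: QQ => // [x|].
  exact: ev_vars e1.
exact: ev_mem e1.
Qed.

(** The invariant is indexed by the iteration, and the body is told the clock at its start; in the
    exact case this locates the coins of every iteration. *)
Lemma tri_while e c r h j K cnt (I : nat -> (nat -> int) -> (nat -> int) -> Prop) Q :
  I 0 r h ->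
  (forall i r1 h1, i <= cnt -> I i r1 h1 -> (0 < eval r1 h1 e)%R = (i < cnt)) ->
  (forall i r1 h1 j1, i < cnt -> (forall y, y \notin writes c -> r1 y = r y) ->
     (~~ puts c -> h1 = h) -> rel b j1 (j + (i * (K + esize e + 3) + esize e + 1)) ->
     I i r1 h1 -> tri c (State r1 h1 j1) K (fun s => I i.+1 (vars s) (memory s))) ->
  (forall r' h' j', (forall y, y \notin writes c -> r' y = r y) ->
     (~~ puts c -> h' = h) ->
     rel b j' (j + (cnt * (K + esize e + 3) + esize e + 3)) -> I cnt r' h' -> Q (State r' h' j')) ->
  tri (While e c) (State r h j) (cnt * (K + esize e + 3) + esize e + 3) Q.
Proof.
move=> I0 tst body post.
suff H k i r1 h1 j1 : k = cnt - i -> i <= cnt ->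
    (forall y, y \notin writes c -> r1 y = r y) -> (~~ puts c -> h1 = h) ->
    rel b j1 (j + i * (K + esize e + 3)) -> I i r1 h1 ->
    tri (While e c) (State r1 h1 j1) (k * (K + esize e + 3) + esize e + 3) Q.
  apply: (H cnt 0) => //; rewrite ?subn0 ?mul0n ?addn0 ?rel_refl //.
elim: k i r1 h1 j1 => [|k IH] i r1 h1 j1 ek il fr fh rj Ii.
  have ei : i = cnt by lia.
  rewrite {}ei {il ek} in rj Ii.
  exists (tick (State r1 h1 j1) (esize e + 3)); split.
  - by apply: EvWhileF; rewrite /= (tst cnt) // ltnn.
  - by rewrite /= rel_refl.
  - rewrite /tick /=; apply: post => //.
    by rewrite -addnA; apply: relD rj _; exact: rel_refl.
have il' : i < cnt by lia.
have [|s1 [e1 l1 I1]] := body i r1 h1 (j1 + (esize e + 1)) il' fr fh _ Ii.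
  by rewrite -addnA; apply: relD rj _; exact: rel_refl.
case: s1 e1 l1 I1 => r2 h2 j2 /= e1 l1 I1.
have l2 : rel b (j2 + 2) (j1 + (K + esize e + 3)) by case: (b) l1 => /=; lia.
have [|||||s3 [e3 l3 q3]] := IH i.+1 r2 h2 (j2 + 2) _ _ _ _ _ I1.
- by lia.
- by lia.
- by move=> y ny; rewrite -fr //; exact: (ev_vars e1).
- by move=> np; rewrite -fh //; exact: (ev_mem e1).
- by have := relD rj l2; rewrite mulSn [_ + i * _]addnC.
exists s3; split=> //.
  apply: (@EvWhileT Z w e c (State r1 h1 j1) (State r2 h2 j2) s3) => //.
  by rewrite /= (tst i) // ltnW.
have := relD l2 l3; rewrite mulSn; case: (b) => /=; lia.
Qed.

Definition For (x l : nat) (c : cmd) : cmd :=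
  Seq (Asg x (Lit 0))
    (While (Bin OpSub (Var l) (Var x)) (Seq c (Asg x (Bin OpAdd (Var x) (Lit 1))))).

Lemma tri_for x l c r h j K cnt (I : nat -> (nat -> int) -> (nat -> int) -> Prop) Q :
  [&& x \notin writes c, l \notin writes c & x != l] ->
  r l = Posz cnt -> cnt < 2 ^ Z ->
  (forall i r h v, I i r h -> I i (upd r x v) h) ->
  I 0 r h ->
  (forall i r1 h1 j1, i < cnt -> r1 x = Posz i ->
     (forall y, y \notin x :: writes c -> r1 y = r y) ->
     (~~ puts c -> h1 = h) -> rel b j1 (j + (i * (K + 14) + 9)) ->
     I i r1 h1 -> tri c (State r1 h1 j1) K (fun s => I i.+1 (vars s) (memory s))) ->
  (forall r' h' j', (forall y, y \notin x :: writes c -> r' y = r y) ->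
     (~~ puts c -> h' = h) ->
     rel b j' (j + (cnt * (K + 14) + 11)) -> I cnt r' h' -> Q (State r' h' j')) ->
  tri (For x l c) (State r h j) (cnt * (K + 14) + 11) Q.
Proof.
move=> /and3P[xc lc xl] rl cZ Ix I0 body post.
have ic i : i <= cnt -> bounded Z (Posz i).
  by move=> il; rewrite /bounded /=; apply: leq_ltn_trans cZ.
have {1}-> : cnt * (K + 14) + 11 = 3 + (cnt * ((K + 6) + 5 + 3) + 5 + 3) by lia.
apply: tri_seq; apply: tri_asg => /=; first by rewrite /bounded /= expn_gt0.
set c' := Seq c _.
have wr y : y \notin writes c' -> y \notin x :: writes c.
  by rewrite /= mem_cat !inE orbC.
have wr' y : y \notin x :: writes c -> y \notin writes c'.
  by rewrite /= mem_cat !inE orbC.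
have yx y : y \notin x :: writes c -> (y == x) = false.
  by rewrite inE negb_or => /andP[/negbTE].
apply: (tri_while (I := fun i r h => [/\ I i r h, r x = Posz i & r l = Posz cnt])).
- by split; [apply: Ix| rewrite /upd eqxx| rewrite /upd eq_sym (negbTE xl)].
- by move=> i r1 h1 _ [_ /= -> ->]; lia.
- move=> i r1 h1 j1 il fr fh rj [Ii rx rl1].
  apply: tri_seq; apply: tri_conseq.
    apply: body (il) rx _ _ _ Ii.
    + by move=> y ny; rewrite fr ?wr' // /upd yx.
    + by move=> np; apply: fh; rewrite /= orbF.
    + have := rj; rewrite /=; case: (b) => /=; lia.
  move=> [r2 h2 j2] /= I2 f2 _ _.
  apply: tri_asg => /=.
    by rewrite f2 // rx; have := ic i.+1 il; rewrite /bounded; lia.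
  by split; [apply: Ix| rewrite /upd eqxx f2 // rx; lia| rewrite /upd eq_sym (negbTE xl) f2].
- move=> r' h' j' fr fh rj [Ic _ _]; apply: post => //.
  + by move=> y ny; rewrite fr ?wr' // /upd yx.
  + by move=> np; apply: fh; rewrite /= orbF.
  + have := rj; rewrite /=; case: (b) => /=; lia.
Qed.

End Triples.

Section Bounds.
Variables (Z : nat) (w : nat -> bool).
Local Notation tri0 := (tri false Z w).

Lemma tri_le c s K K' Q : tri0 c s K Q -> K <= K' -> tri0 c s K' Q.
Proof. by move=> [s' [e l q]] KK; exists s'; split=> //=; rewrite /= in l *; lia. Qed.

(** The false branch spends two more instructions on jumping over the true one. Hence this rule
    exists for upper bounds only, and the postcondition must not depend on the clock. *)
Lemma tri_if e c1 c2 r h j K Q :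
  ((0 < eval r h e)%R -> tri0 c1 (State r h (j + (esize e + 1))) K
     (fun s => forall k, Q (tick s k))) ->
  (~~ (0 < eval r h e)%R -> tri0 c2 (State r h (j + (esize e + 1))) K
     (fun s => forall k, Q (tick s k))) ->
  tri0 (If e c1 c2) (State r h j) (K + esize e + 3) Q.
Proof.
move=> H1 H2; case E : (0 < eval r h e)%R.
  have [s' [e1 l1 q1]] := H1 E; exists s'; split; first exact: EvIfT.
    by rewrite /= in l1 *; lia.
  by have := q1 0; rewrite /tick addn0; case: (s').
have [s' [e1 l1 q1]] := H2 (negbT E); exists (tick s' 2); split=> //.
  by apply: EvIfF => //; rewrite E.
by rewrite /= in l1 *; lia.
Qed.

Lemma tri_exact c s K Q : tri true Z w c s K Q -> tri0 c s K Q.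
Proof. by move=> [s' [e /eqP l q]]; exists s'; split=> //=; rewrite l. Qed.

End Bounds.

End Triples.
Import Triples.

(** * Vectors as integers in base Q, with signed digits *)

Module Digits.
Local Open Scope ring_scope.

Section Pack.
Variable Q : int.
Hypothesis Q0 : 0 < Q.

Definition pack n (v : nat -> int) : int := \sum_(i < n) v i * Q ^+ i.

Lemma packS n v : pack n.+1 v = v 0%N + Q * pack n (fun i => v i.+1).
Proof.
rewrite /pack big_ord_recl expr0 mulr1 mulr_sumr; congr (_ + _).
by apply: eq_bigr => i _; rewrite exprS /= mulrCA.
Qed.

Lemma packSr n v : pack n.+1 v = pack n v + v n * Q ^+ n.
Proof. by rewrite /pack big_ord_recr. Qed.

Lemma packD n u v : pack n (fun i => u i + v i) = pack n u + pack n v.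
Proof. by rewrite /pack -big_split; apply: eq_bigr => i _; rewrite mulrDl. Qed.

Lemma packZ n c v : pack n (fun i => c * v i) = c * pack n v.
Proof. by rewrite /pack mulr_sumr; apply: eq_bigr => i _; rewrite mulrA. Qed.

Lemma packB n u v : pack n (fun i => u i - v i) = pack n u - pack n v.
Proof.
rewrite -[in RHS]mulN1r -packZ -packD; apply: eq_bigr => i _ /=.
by rewrite mulN1r.
Qed.

Lemma eq_pack n u v : (forall i, (i < n)%N -> u i = v i) -> pack n u = pack n v.
Proof. by move=> uv; apply: eq_bigr => i _; rewrite uv. Qed.

Lemma pack_sum n m (F : nat -> nat -> int) :
  pack n (fun i => \sum_(j < m) F i j) = \sum_(j < m) pack n (F ^~ j).
Proof.
rewrite /pack exchange_big; apply: eq_bigr => i _ /=; exact: mulr_suml.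
Qed.

Lemma expQ_gt0 k : 0 < Q ^+ k. Proof. exact: exprn_gt0. Qed.

Lemma pack_bound n v M : M < Q -> (forall i, (i < n)%N -> - M <= v i <= M) ->
  - Q ^+ n < pack n v < Q ^+ n.
Proof.
move=> MQ; elim: n => [|n IH] vM; first by rewrite /pack big_ord0 expr0.
have {}IH := IH (fun i il => vM i (ltnW il)); have vn := vM n (ltnSn n).
rewrite packSr exprS; have := expQ_gt0 n; move: (pack n v) (Q ^+ n) IH => p q; nia.
Qed.

Definition digit (y : int) (j : nat) : int := ((y %/ Q ^+ j)%Z %% Q)%Z.

Lemma divX_succ y j : ((y %/ Q ^+ j)%Z %/ Q)%Z = (y %/ Q ^+ j.+1)%Z.
Proof. by rewrite exprSr divzMA_ge0 // ltW // expQ_gt0. Qed.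

Lemma div_pack n v t : (forall i, (i < n)%N -> 0 <= v i < Q) ->
  ((pack n v + Q ^+ n * t) %/ Q ^+ n)%Z = t.
Proof.
move=> vQ; rewrite addrC mulrC divzMDl; last by rewrite gt_eqF // expQ_gt0.
rewrite divz_small ?addr0 //.
have : forall i, (i < n)%N -> 0 <= v i < Q by [].
rewrite gtz0_abs ?expQ_gt0 //.
elim: n {vQ} => [|n IH] vQ; first by rewrite /pack big_ord0 expr0.
have {}IH := IH (fun i il => vQ i (ltnW il)); have vn := vQ n (ltnSn n).
rewrite packSr exprS; have := expQ_gt0 n; move: (pack n v) (Q ^+ n) IH => p q; nia.
Qed.

Lemma digit_pack n v t j : (forall i, (i < n)%N -> 0 <= v i < Q) -> (j < n)%N ->
  digit (pack n v + Q ^+ n * t) j = v j.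
Proof.
elim: n v t j => // n IH v t [|j] vQ jn.
  rewrite /digit expr0 divz1 packS exprS -addrA -mulrA -mulrDr addrC mulrC modzMDl.
  by rewrite modz_small // vQ.
rewrite /digit (exprS Q j) divzMA_ge0 1?ltW // packS exprS -addrA -mulrA -mulrDr addrC mulrC divzMDl ?gt_eqF //.
rewrite [(v _ %/ _)%Z]divz_small ?addr0; last by rewrite gtz0_abs // vQ.
by apply: (IH (fun i => v i.+1)) => // i il; apply: vQ.
Qed.

(** A negative [v 0] would borrow from the next place and show as the digit [v 0 + Q], which is at
    least [Q - Q %/ 2] and so exceeds [2 * D]. Thus [v 0] is its own digit, nothing is borrowed, and
    the induction goes on. *)
Lemma digits_le_pack n v D : 2 * D < Q - (Q %/ 2)%Z ->
  (forall i, (i < n)%N -> - (Q %/ 2)%Z <= v i <= (Q %/ 2)%Z) ->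
  (forall j, (j < n)%N -> digit (pack n v) j <= 2 * D) ->
  forall i, (i < n)%N -> 0 <= v i <= 2 * D.
Proof.
move=> DQ; elim: n v => // n IH v vQ dD.
have d0 := dD 0%N isT; have v0Q := vQ 0%N isT.
have v0 : 0 <= v 0%N <= 2 * D.
  move: d0; rewrite /digit expr0 divz1 packS addrC mulrC modzMDl.
  have [v0|v0] := leP 0 (v 0%N); first by rewrite modz_small; lia.
  have -> : v 0%N = (-1) * Q + (v 0%N + Q) by ring.
  by rewrite modzMDl modz_small; lia.
move=> [|i] // il; apply: (IH (fun i => v i.+1)) => // [k kn|j jn]; first exact: vQ.
have := dD j.+1 jn; rewrite /digit (exprS Q j) (divzMA_ge0 _ _ (ltW Q0)) packS addrC mulrC.
rewrite divzMDl ?gt_eqF // [(v _ %/ _)%Z]divz_small ?addr0 // gtz0_abs //; lia.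
Qed.

End Pack.

End Digits.
Import Digits.

(** * The sieve on packed vectors *)

Module SieveModel.
Local Open Scope ring_scope.

Lemma PoszX a k : Posz (a ^ k)%N = Posz a ^+ k.
Proof. by elim: k => // k IH; rewrite expnS PoszM IH exprS. Qed.

(** Each of the [j] lowest digits, expected in [0, 2R], is sorted into one of 4 pieces; the pieces
    are the base 4 digits of the result. *)
Fixpoint cells_of (Q R y : int) (j : nat) : int :=
  if j is i.+1 then 4 * cells_of Q R y i + ((4 * digit Q y i) %/ (2 * R + 1))%Z else 0.

Lemma cells_of_bound Q R y n : 0 <= R ->
  (forall j, (j < n)%N -> 0 <= digit Q y j <= 2 * R) ->
  0 <= cells_of Q R y n < 4 ^+ n.
Proof.
move=> R0; elim: n => [|n IH] yR; first by rewrite expr0.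
have {}IH := IH (fun j jn => yR j (ltnW jn)); have := yR n (ltnSn n).
rewrite /= exprS; move: (digit Q y n) (cells_of Q R y n) IH => d c IH dR.
have c4 : 0 <= ((4 * d) %/ (2 * R + 1))%Z < 4.
  by rewrite divz_ge0 ?ltz_divLR; lia.
by move: ((4 * d) %/ (2 * R + 1))%Z (4 ^+ n) c4 IH => q e; lia.
Qed.

(** Two integers in the same quarter of an interval of 2R + 1 integers differ by at most R/2. *)
Lemma cells_of_inj Q R y y' n : 0 <= R ->
  (forall j, (j < n)%N -> 0 <= digit Q y j <= 2 * R) ->
  (forall j, (j < n)%N -> 0 <= digit Q y' j <= 2 * R) ->
  cells_of Q R y n = cells_of Q R y' n ->
  forall j, (j < n)%N -> 2 * `|digit Q y j - digit Q y' j| <= R.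
Proof.
move=> R0; elim: n => [|n IH] yR yR' // E j.
have yRn := yR n (ltnSn n); have yRn' := yR' n (ltnSn n).
move: E => /=.
have c4 d : 0 <= d <= 2 * R -> 0 <= ((4 * d) %/ (2 * R + 1))%Z < 4.
  by move=> dR; rewrite divz_ge0 ?ltz_divLR; lia.
have := c4 _ yRn; have := c4 _ yRn' => c1 c2 E.
have [E1 E2] : cells_of Q R y n = cells_of Q R y' n /\
    ((4 * digit Q y n) %/ (2 * R + 1))%Z = ((4 * digit Q y' n) %/ (2 * R + 1))%Z.
  by move: (divz _ _) (divz _ _) (cells_of _ _ _ _) (cells_of _ _ _ _) c1 c2 E; lia.
rewrite ltnS leq_eqVlt => /orP[/eqP->|jn]; last first.
  by apply: (IH) jn => // k kn; [apply: yR|apply: yR']; exact: ltnW.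
have R1 : 2 * R + 1 != 0 by lia.
have := divz_eq (4 * digit Q y n) (2 * R + 1).
have := divz_eq (4 * digit Q y' n) (2 * R + 1).
have := modz_ge0 (4 * digit Q y n) R1; have := ltz_mod (4 * digit Q y n) R1.
have := modz_ge0 (4 * digit Q y' n) R1; have := ltz_mod (4 * digit Q y' n) R1.
rewrite E2; move: (divz _ _) (modz _ _) (modz _ _) => q m m'.
by move: (digit Q y n) (digit Q y' n); nia.
Qed.

Section Sieve.
Variables (n : nat) (Q PM : int) (R : nat -> int) (levels base : nat).

Let ones : int := pack Q n (fun=> 1).

(** Adding [R l] in every coordinate makes the low digits nonnegative. Digit [n] is part of the key
    so that subtracting a vector of the same cell keeps the target coefficient in range. *)
Definition key (l : nat) (y : int) : int :=
  2 * cells_of Q (R l) (y + R l * pack Q n (fun=> 1)) n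
  + (((y + R l * pack Q n (fun=> 1)) %/ Q ^+ n)%Z %% Q)%Z.

Definition ncells : nat := (2 * 4 ^ n)%N.

Definition slot (l : nat) (y : int) : nat :=
  absz (base%:Z + ncells%:Z * l%:Z + key l y).

(** Larger than any lattice vector that is stored; stored entries become positive, and an entry 0
    means an empty cell. *)
Definition offset : int := Q ^+ n.+1 * Q ^+ n.+1.

(* [y] goes down the levels, subtracting at each of them the lattice vector
   stored in its cell, until an empty cell is met; the lattice vector [y - x]
   is then stored there. Only in this case does the result depend on [x]. *)
Fixpoint sieve (f l : nat) (h : nat -> int) (y x : int) : (nat -> int) * option int :=
  if f is f'.+1 then
    if 0 < h (slot l y) then sieve f' l.+1 h (y - (h (slot l y) - offset)) x
    else (upd h (slot l y) (y - x + offset), None)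
  else (h, Some y).

Variables (B : nat -> nat -> int) (T cr s : nat -> int).
Hypotheses (Q0 : 0 < Q) (PM0 : 0 < PM).
Hypothesis RS : forall l, (l < levels)%N -> R l.+1 = (R l %/ 2)%Z + PM.
Hypothesis RQ : forall l, (l <= levels)%N -> 0 <= R l /\ 8 * (R l + PM) <= Q.
Hypothesis crQ : forall i, (i < n)%N -> 8 * `|cr i| <= Q.
Hypothesis s1 : forall i, (i < n)%N -> 1 <= s i.

Definition rawv (U : nat -> int) (k : int) (i : nat) : int :=
  \sum_(j < n) B i j * U j + k * T i.
Definition scaledv U k i : int := s i * (rawv U k i + k * cr i).
(** The lattice vector with coefficients [U] on the basis and [k] on the target: scaled coordinates
    below, then [k] itself, then the unscaled coordinates. The sum [cr] moves the centre of the box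
    to the origin, and [s] stretches the box to a cube. *)
Definition latv U k : int :=
  pack Q n (scaledv U k) + k * Q ^+ n + Q ^+ n.+1 * pack Q n (rawv U k).
Definition pert (xv : nat -> int) (tau : bool) : int := pack Q n xv + tau%:Z * Q ^+ n.
Definition small (xv : nat -> int) := forall i, (i < n)%N -> 0 <= xv i < PM.

Lemma rawvB U U' k k' i : rawv (fun j => U j - U' j) (k - k') i = rawv U k i - rawv U' k' i.
Proof.
rewrite /rawv opprD addrACA -mulrBl; congr (_ + _).
by rewrite -sumrB; apply: eq_bigr => j _; rewrite mulrBr.
Qed.

Lemma scaledvB U U' k k' i :
  scaledv (fun j => U j - U' j) (k - k') i = scaledv U k i - scaledv U' k' i.
Proof. by rewrite /scaledv rawvB; ring. Qed.

Lemma latvB U U' k k' : latv (fun j => U j - U' j) (k - k') = latv U k - latv U' k'.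
Proof.
rewrite /latv (eq_pack _ (fun i _ => scaledvB U U' k k' i)).
by rewrite (eq_pack _ (fun i _ => rawvB U U' k k' i)) !packB; ring.
Qed.

(** The coefficients [U], [k] exist only in the proof. The sum [tau + k] is digit [n] of [y],
    whereas [tau] and [k] separately cannot be read off from [y]. *)
Definition reduced (l : nat) (y : int) (xv : nat -> int) (tau : bool) :=
  exists U k, [/\ y = pert xv tau + latv U k,
    forall i, (i < n)%N -> - R l <= xv i + scaledv U k i <= R l
    & 0 <= tau%:Z + k <= 1].

Lemma reduced_digits l y xv (tau : bool) U k : (l <= levels)%N ->
  y = pert xv tau + latv U k ->
  (forall i, (i < n)%N -> - R l <= xv i + scaledv U k i <= R l) ->
  0 <= tau%:Z + k <= 1 ->
  (forall i, (i < n)%N -> digit Q (y + R l * ones) i = xv i + scaledv U k i + R l) /\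
  (((y + R l * ones) %/ Q ^+ n)%Z %% Q)%Z = tau%:Z + k.
Proof.
move=> ll -> xR tk; have [R0 RQl] := RQ ll.
have E : pert xv tau + latv U k + R l * ones =
   pack Q n (fun i => xv i + scaledv U k i + R l) +
   Q ^+ n * (pack Q n (rawv U k) * Q + (tau%:Z + k)).
  rewrite (packD Q n (fun i => xv i + scaledv U k i) (fun=> R l)) packD.
  have -> : pack Q n (fun=> R l) = R l * ones.
    by rewrite -packZ; apply: eq_pack => i _; rewrite mulr1.
  by rewrite /pert /latv exprS; ring.
have dg i : (i < n)%N -> 0 <= xv i + scaledv U k i + R l < Q.
  by move=> il; have := xR i il; lia.
rewrite E; split=> [i il|]; first exact: digit_pack.
by rewrite div_pack // modzMDl modz_small //; lia.
Qed.

Lemma key_bound l y xv tau : (l <= levels)%N -> reduced l y xv tau ->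
  0 <= key l y < ncells%:Z.
Proof.
move=> ll [U [k [Ey xR tk]]]; have [R0 RQl] := RQ ll.
have [dg top] := reduced_digits ll Ey xR tk.
have := @cells_of_bound Q (R l) (y + R l * ones) n R0.
rewrite /key /ncells -/ones top => H.
have /H : forall j, (j < n)%N -> 0 <= digit Q (y + R l * ones) j <= 2 * R l.
  by move=> j jn; rewrite dg //; have := xR j jn; lia.
have -> : (2 * 4 ^ n)%N%:Z = 2 * 4 ^+ n by rewrite PoszM PoszX.
move: (cells_of _ _ _ _) (4 ^+ n) => c e; lia.
Qed.

Lemma key_close l y xv (tau : bool) U k y' xv' (tau' : bool) U' k' : (l <= levels)%N ->
  y = pert xv tau + latv U k ->
  (forall i, (i < n)%N -> - R l <= xv i + scaledv U k i <= R l) ->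
  0 <= tau%:Z + k <= 1 ->
  y' = pert xv' tau' + latv U' k' ->
  (forall i, (i < n)%N -> - R l <= xv' i + scaledv U' k' i <= R l) ->
  0 <= tau'%:Z + k' <= 1 -> key l y = key l y' ->
  (forall i, (i < n)%N ->
    2 * `|(xv i + scaledv U k i) - (xv' i + scaledv U' k' i)| <= R l) /\
  tau%:Z + k = tau'%:Z + k'.
Proof.
move=> ll Ey xR tk Ey' xR' tk'; have [R0 RQl] := RQ ll.
have [dg top] := reduced_digits ll Ey xR tk.
have [dg' top'] := reduced_digits ll Ey' xR' tk'.
rewrite /key -/ones top top' => E.
have [E1 E2] : cells_of Q (R l) (y + R l * ones) n = cells_of Q (R l) (y' + R l * ones) n
   /\ tau%:Z + k = tau'%:Z + k'.
  by move: (cells_of _ _ _ _) (cells_of _ _ _ _) E; lia.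
split=> // i il.
have := @cells_of_inj Q (R l) (y + R l * ones) (y' + R l * ones) n R0 _ _ E1 i il.
rewrite dg // dg' //.
have -> : xv i + scaledv U k i + R l - (xv' i + scaledv U' k' i + R l) =
  xv i + scaledv U k i - (xv' i + scaledv U' k' i) by ring.
apply=> j jn; rewrite ?dg ?dg' //; [have := xR j jn|have := xR' j jn]; lia.
Qed.

(** Vectors of one cell differ by at most R/2 in each coordinate; subtracting the lattice vector
    [y' - pert xv' tau'] instead of [y'] adds at most the size PM of a perturbation. This is the
    recurrence for [R]. *)
Lemma reduced_step l y xv tau y' xv' tau' : (l < levels)%N ->
  reduced l y xv tau -> reduced l y' xv' tau' -> small xv' -> key l y = key l y' ->
  reduced l.+1 (y - (y' - pert xv' tau')) xv tau.
Proof.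
move=> ll [U [k [Ey xR tk]]] [U' [k' [Ey' xR' tk']]] sx' E.
have [cl ek] := key_close (ltnW ll) Ey xR tk Ey' xR' tk' E.
exists (fun j => U j - U' j), (k - k'); split.
- by rewrite latvB Ey Ey'; ring.
- move=> i il; rewrite scaledvB RS //; have := cl i il; have := sx' i il.
  have := xR i il; have := xR' i il.
  by move: (scaledv _ _ _) (scaledv _ _ _) (xv i) (xv' i) (R l); lia.
(* Equal keys give [tau + (k - k') = tau'], which is 0 or 1. *)
- by case: (tau') ek tk tk' => /=; lia.
Qed.

Lemma rawv_bound U k i M : (i < n)%N -> -1 <= k <= 1 ->
  - M <= scaledv U k i <= M -> - (M + `|cr i|) <= rawv U k i <= M + `|cr i|.
Proof.
move=> il k1; rewrite /scaledv; have := s1 il.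
move: (s i) (rawv U k i) (cr i) => a r c a1.
have [k_|[k_|k_]] : k = -1 \/ k = 0 \/ k = 1 by lia.
all: rewrite k_; nia.
Qed.

Lemma reduced_lat l xv U k i : small xv -> (i < n)%N ->
  - R l <= xv i + scaledv U k i <= R l ->
  - (R l + PM) <= scaledv U k i <= R l + PM.
Proof. by move=> sx il; have := sx i il; lia. Qed.

Lemma latv_bound l xv (tau : bool) U k : (l <= levels)%N -> small xv ->
  (forall i, (i < n)%N -> - R l <= xv i + scaledv U k i <= R l) ->
  0 <= tau%:Z + k <= 1 ->
  4 * `|latv U k| <= 3 * offset.
Proof.
move=> ll sx xR tk; have [R0 RQl] := RQ ll.
have k1 : -1 <= k <= 1 by case: (tau) tk => /=; lia.
have b1 : - Q ^+ n < pack Q n (scaledv U k) < Q ^+ n.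
  apply: (@pack_bound _ Q0 _ _ (R l + PM)); first lia.
  by move=> i il; apply: (reduced_lat (l := l) (xv := xv)) => //; exact: xR.
have b2 : - Q ^+ n < pack Q n (rawv U k) < Q ^+ n.
  apply: (@pack_bound _ Q0 _ _ (Q %/ 2)%Z); first lia.
  move=> i il; have b := reduced_lat sx il (xR i il).
  have := rawv_bound il k1 b; have := crQ il; lia.
have Q8 : 8 <= Q by lia.
have e0 := expQ_gt0 Q0 n.
rewrite /offset /latv exprS.
move: (pack Q n _) (pack Q n _) (Q ^+ n) b1 b2 e0 => c a q b1 b2 e0.
have kq : `|k * q| <= q by rewrite normrM; nia.
have c1 : - (Q * q * q) <= Q * q * c <= Q * q * q.
  have : 0 < Q * q by rewrite mulr_gt0.
  by move: (Q * q) => p; nia.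
have c2 : 8 * q <= Q * q * q.
  rewrite -mulrA; have : q <= q * q by nia.
  by move: (q * q) => p; nia.
have c3 : Q * q * (Q * q) = Q * (Q * q * q) by ring.
have c4 : 8 * (Q * q * q) <= Q * (Q * q * q).
  have : 0 < Q * q * q by rewrite !mulr_gt0.
  by move: (Q * q * q) => p; nia.
by rewrite c3; move: (Q * q * c) (Q * q * q) (Q * (Q * q * q)) (k * q) c1 c2 c4 kq; lia.
Qed.

Definition stored (h : nat -> int) := forall l q, (l < levels)%N -> (q < ncells)%N ->
  0 < h (base + ncells * l + q)%N ->
  exists y' xv' tau', [/\ small xv', reduced l y' xv' tau', key l y' = q%:Z &
    h (base + ncells * l + q)%N = y' - pert xv' tau' + offset].

Lemma slotE l y xv tau : (l <= levels)%N -> reduced l y xv tau ->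
  exists q, [/\ (q < ncells)%N, key l y = q%:Z & slot l y = (base + ncells * l + q)%N].
Proof.
move=> ll /(key_bound ll) /andP[k0 k1]; exists (absz (key l y)).
by rewrite /slot; move: (key l y) k0 k1 => k k0 k1; split; lia.
Qed.

(** The last clause shows that a sample that does not survive uses up an empty cell, which bounds
    the number of losses by the size of the table. *)
Lemma sieve_spec f l h (y : int) xv tau : stored h -> small xv -> reduced l y xv tau ->
  (l + f)%N = levels ->
  let h' := (sieve f l h y (pert xv tau)).1 in
  [/\ stored h',
      forall y', (sieve f l h y (pert xv tau)).2 = Some y' -> reduced levels y' xv tau
    & (sieve f l h y (pert xv tau)).2 = None ->
      exists (a : nat) (v : int), [/\ (base <= a < base + ncells * levels)%N, ~~ (0 < h a), 0 < v,
        v < 2 * offset & h' = upd h a v]].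
Proof.
move=> sh sx; elim: f l y => [|f IH] l y red lf /=.
  by split=> // y' [<-]; rewrite addn0 in lf; rewrite -lf.
have ll : (l < levels)%N by lia.
have [q [qc kq ->]] := slotE (ltnW ll) red.
case: ifP => [pos|/negbT neg].
  have [y' [xv' [tau' [sx' red' kq' ->]]]] := sh l q ll qc pos.
  rewrite addrK; apply: IH; last lia.
  by apply: reduced_step; rewrite ?kq.
have [U [k [Ey xR tk]]] := red.
have := latv_bound (ltnW ll) sx xR tk.
have -> : latv U k = y - pert xv tau by rewrite Ey; ring.
have off0 : 0 < offset by rewrite mulr_gt0 // expQ_gt0.
move=> lb; split=> //=.
- move=> l1 q1 ll1 qc1; rewrite /upd; case: eqP => [E _|_]; last exact: sh.
  have [El Eq] : l1 = l /\ q1 = q.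
    have : l1 = l by move: E qc qc1; nia.
    by move=> l1l; split=> //; move: E; rewrite l1l; lia.
  by exists y, xv, tau; rewrite El Eq.
- move=> _; exists (base + ncells * l + q)%N, (y - pert xv tau + offset); split=> //.
  + by move: qc; nia.
  + by move: (y - _) lb => z; lia.
  + by move: (y - _) lb => z; lia.
Qed.

(* The visible data [y] determine the coefficient [tau + k] of the target, so
   changing the hidden bit [tau] changes the coefficient [k] itself. *)
Definition tcoef (y x : int) : int :=
  (((y - x + ((R levels + PM) * ones + Q ^+ n)) %/ Q ^+ n)%Z %% Q)%Z - 1.

Definition rawpart (y x : int) : int :=
  (((y - x + ((R levels + PM) * ones + Q ^+ n)) %/ Q ^+ n)%Z %/ Q)%Z.

(** The summand [Q ^+ n] moves [k] from {-1, 0, 1} to {0, 1, 2}, so that it can be read as a digit;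
    [tcoef] subtracts the 1 again. *)
Lemma survivorE (y : int) xv (tau : bool) U k : small xv -> y = pert xv tau + latv U k ->
  (forall i, (i < n)%N -> - R levels <= xv i + scaledv U k i <= R levels) ->
  0 <= tau%:Z + k <= 1 ->
  tcoef y (pert xv tau) = k /\ rawpart y (pert xv tau) = pack Q n (rawv U k).
Proof.
move=> sx Ey xR tk; have [R0 RQl] := RQ (leqnn levels).
set M := R levels + PM.
have E : y - pert xv tau + (M * ones + Q ^+ n) =
   pack Q n (fun i => scaledv U k i + M) + Q ^+ n * (pack Q n (rawv U k) * Q + (k + 1)).
  rewrite packD (_ : pack Q n (fun=> M) = M * ones); last first.
    by rewrite -packZ; apply: eq_pack => i _; rewrite mulr1.
  by rewrite Ey /latv exprS; ring.
have dg i : (i < n)%N -> 0 <= scaledv U k i + M < Q.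
  move=> il; have := reduced_lat sx il (xR i il); rewrite /M; lia.
have k1 : 0 <= k + 1 < Q by move: tk RQl PM0; case: (tau) => /=; lia.
rewrite /tcoef /rawpart E div_pack // modzMDl divzMDl ?gt_eqF //.
by rewrite modz_small // divz_small ?addr0 ?addrK // gtz0_abs.
Qed.

Lemma top_shift l y d :
  (((y + Q ^+ n.+1 * d + R l * ones) %/ Q ^+ n)%Z %% Q)%Z =
  (((y + R l * ones) %/ Q ^+ n)%Z %% Q)%Z.
Proof.
rewrite addrAC [_ + Q ^+ _ * _]addrC exprSr -mulrA mulrC divzMDl ?gt_eqF ?expQ_gt0 //.
by rewrite mulrC modzMDl.
Qed.

Lemma tcoef_flip (y d : int) xv tau xv' : small xv -> small xv' ->
  reduced levels y xv tau -> reduced levels (y + Q ^+ n.+1 * d) xv' (~~ tau) ->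
  tcoef y (pert xv tau) = 0 -> tcoef (y + Q ^+ n.+1 * d) (pert xv' (~~ tau)) != 0.
Proof.
move=> sx sx' [U [k [Ey xR tk]]] [U' [k' [Ey' xR' tk']]].
have [-> _] := survivorE sx Ey xR tk; have [-> _] := survivorE sx' Ey' xR' tk'.
have [_ top] := reduced_digits (leqnn _) Ey xR tk.
have [_ top'] := reduced_digits (leqnn _) Ey' xR' tk'.
by rewrite top_shift top in top'; case: (tau) top' => /=; lia.
Qed.

Lemma digit_shift y d j : (j < n.+1)%N -> digit Q (y + Q ^+ n.+1 * d) j = digit Q y j.
Proof.
move=> jn; rewrite /digit -(subnKC jn) exprD exprSr.
rewrite addrC -!mulrA mulrC divzMDl ?gt_eqF ?expQ_gt0 //.
by rewrite mulrC modzMDl.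
Qed.

Lemma key_shift l y d : key l (y + Q ^+ n.+1 * d) = key l y.
Proof.
rewrite /key -/ones top_shift; congr (2 * _ + _).
have : forall m, (m <= n)%N -> cells_of Q (R l) (y + Q ^+ n.+1 * d + R l * ones) m =
   cells_of Q (R l) (y + R l * ones) m; last exact.
elim=> //= m IH mn; rewrite IH 1?ltnW // addrAC digit_shift //; exact: ltnW.
Qed.

(** Keys depend on the low n+1 digits only, so a change of the high block does not alter the path
    through the table. A survivor writes nothing, and only a write would have involved [x]. *)
Lemma sieve_shift f l h y (d : int) x x' h' y' : sieve f l h y x = (h', Some y') ->
  h' = h /\ sieve f l h (y + Q ^+ n.+1 * d) x' = (h, Some (y' + Q ^+ n.+1 * d)).
Proof.
elim: f l y => [|f IH] l y /=; first by case=> <- <-.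
rewrite /slot key_shift; case: ifP => // _ /IH[-> E]; split=> //.
by rewrite addrAC; exact: E.
Qed.

End Sieve.

End SieveModel.
Import SieveModel.

(** * Counting sample sequences by flipping the first survivor *)

Module FlipCounting.
Local Open Scope nat_scope.

Section TupleCounting.
Variable H : finType.

Lemma sum_tupleS N (f : N.+1.-tuple H -> nat) :
  \sum_t f t = \sum_h \sum_(t : N.-tuple H) f [tuple of h :: t].
Proof.
rewrite pair_big /= (reindex (fun p : H * N.-tuple H => [tuple of p.1 :: p.2])) //=.
exists (fun t => (thead t, [tuple of behead t])) => [[h t] _|t _] /=.
  by congr pair; apply: val_inj.
by case/tupleP: t => h t; apply: val_inj.
Qed.

Lemma card_sum (T : finType) (mA : mem_pred T) :
  card mA = \sum_t (in_mem t mA : nat).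
Proof.
case: mA => p; rewrite -[card _]/(#|p|) -sum1_card big_mkcond.
by apply: eq_bigr => t _; rewrite unfold_in; case: (p t).
Qed.

Lemma sum_count_tuple N (F : pred H) :
  #|H| * \sum_(t : N.-tuple H) count F t = N * #|F| * #|H| ^ N.
Proof.
elim: N => [|N IH].
  rewrite big1 ?muln0 // => t _; by rewrite (tuple0 t).
rewrite sum_tupleS /= (eq_bigr (fun h => ((h \in F) : nat) * #|H| ^ N + \sum_(t : N.-tuple H) count F t)).
  rewrite big_split /= -big_distrl /= -card_sum sum_nat_const mulnDr IH expnS.
  by rewrite mulSn; ring.
move=> h _; rewrite big_split /= sum_nat_const card_tuple; congr (_ + _); exact: mulnC.
Qed.

Lemma card_all_tuple N (P : pred H) :
  #|[pred t : N.-tuple H | all P t]| = #|P| ^ N.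
Proof.
elim: N => [|N IH].
  rewrite expn0 -(expn0 #|H|) -(card_tuple 0 H).
  by apply: eq_card => t; rewrite !inE (tuple0 t).
rewrite expnS [LHS]card_sum sum_tupleS -IH /= [#|P|]card_sum big_distrl /=.
apply: eq_bigr => h _; rewrite card_sum big_distrr /=; apply: eq_bigr => t _.
by rewrite mulnb !inE.
Qed.

Lemma card_all_index N (P : nat -> pred H) M :
  (forall j, j < N -> M <= #|P j|) ->
  M ^ N <= #|[pred t : N.-tuple H | [forall j : 'I_N, P j (tnth t j)]]|.
Proof.
elim: N P => [|N IH] P MP.
  rewrite expn0; apply/card_gt0P; exists [tuple]; rewrite inE.
  by apply/forallP => -[].
rewrite expnS [X in _ <= X]card_sum sum_tupleS.
apply: (@leq_trans (\sum_h ((h \in P 0) : nat) * M ^ N)).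
  by rewrite -big_distrl /= -card_sum leq_mul2r MP ?orbT.
apply: leq_sum => h _; case P0 : (h \in P 0); rewrite ?mul0n // mul1n.
apply: leq_trans (IH (fun j => P j.+1) _) _; first by move=> j jN; apply: MP.
rewrite card_sum; apply: leq_sum => t _ /=; rewrite !inE.
case: forallP => // Pt; rewrite (_ : [forall j, _] = true) //; apply/forallP.
case=> -[|j] jN /=; first by rewrite (tnth_nth h).
have := Pt (Ordinal (jN : j < N)); by rewrite !(tnth_nth h).
Qed.

End TupleCounting.

(* A process reads samples one after the other; a sample that survives leaves
   the state unchanged, and at most [C] samples do not survive. Flipping the
   first survivor in [F] is an involution that turns failure into success. *)
Section FlipArgument.
Variables (S : Type) (H : finType) (Inv : S -> Prop).
Variables (nxt : S -> H -> S) (sur win : S -> H -> bool) (F : pred H) (flip : H -> H).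
Hypothesis Inv_nxt : forall s h, Inv s -> Inv (nxt s h).
Hypothesis flipF : forall h, F h -> F (flip h) /\ flip (flip h) = h.
Hypothesis sur_flip : forall s h, Inv s -> F h -> sur s h ->
  [/\ sur s (flip h), nxt s (flip h) = nxt s h & ~~ win s h -> win s (flip h)].

Fixpoint wins s hs : bool :=
  if hs is h :: hs' then sur s h && win s h || wins (nxt s h) hs' else false.
Fixpoint has_survivor s hs : bool :=
  if hs is h :: hs' then F h && sur s h || has_survivor (nxt s h) hs' else false.
Fixpoint losses s hs : nat :=
  if hs is h :: hs' then ~~ sur s h + losses (nxt s h) hs' else 0.
Fixpoint flip_first s hs : seq H :=
  if hs is h :: hs' then
    if F h && sur s h then flip h :: hs' else h :: flip_first (nxt s h) hs'
  else [::].

Lemma wins_rcons s hs h : wins s (rcons hs h) =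
  wins s hs || sur (foldl nxt s hs) h && win (foldl nxt s hs) h.
Proof. by elim: hs s => [|h' hs IH] s /=; rewrite ?orbF // IH orbA. Qed.

Lemma size_flip_first s hs : size (flip_first s hs) = size hs.
Proof. by elim: hs s => //= h hs IH s; case: ifP => //= _; rewrite IH. Qed.

(** The flipped sample is again in [F] and survives in the same state, so it is the first such
    sample of the new sequence too. *)
Lemma flip_firstK s hs : Inv s -> flip_first s (flip_first s hs) = hs.
Proof.
elim: hs s => //= h hs IH s Is; case: ifP => [/andP[Fh Sh]|nFS] /=.
  have [F2 ff] := flipF Fh; have [-> _ _] := sur_flip Is Fh Sh.
  by rewrite F2 ff.
by rewrite nFS IH //; apply: Inv_nxt.
Qed.

Lemma flip_first_wins s hs : Inv s -> has_survivor s hs -> ~~ wins s hs ->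
  wins s (flip_first s hs).
Proof.
elim: hs s => //= h hs IH s Is; rewrite negb_or.
case: ifP => [/andP[Fh Sh] _ /andP[nw _]|nFS] /=.
  have [-> _ W] := sur_flip Is Fh Sh; rewrite Sh /= in nw.
  by rewrite W.
move=> hS /andP[_ nw]; apply/orP; right.
by apply: IH => //; exact: Inv_nxt.
Qed.

Lemma count_no_survivor s hs : ~~ has_survivor s hs -> count F hs <= losses s hs.
Proof.
elim: hs s => //= h hs IH s; rewrite negb_or negb_and => /andP[nFS /IH le].
by apply: leq_add => //; case: (F h) nFS; case: (sur s h).
Qed.

(** On average at least N/D >= 2C samples lie in [F], while a sequence without a survivor in [F]
    contains at most C of them, all lost. Hence a fraction 1/(2D) of the sequences has such a
    survivor, and the involution makes at least half as many sequences win. *)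
Lemma card_wins s N C D : Inv s ->
  (forall hs, losses s hs <= C) -> #|H| <= D * #|F| -> 2 * D * C <= N -> 0 < N -> 0 < #|H| ->
  #|H| ^ N <= 4 * D * #|[pred t : N.-tuple H | wins s t]|.
Proof.
move=> Is lC HF NC N0 H0.
set Wn := [pred t : N.-tuple H | wins s t].
pose G := [pred t : N.-tuple H | has_survivor s t].
pose L := [pred t : N.-tuple H | has_survivor s t && ~~ wins s t].
have fsz (t : N.-tuple H) : size (flip_first s t) == N by rewrite size_flip_first size_tuple.
pose f t : N.-tuple H := Tuple (fsz t).
have LW : #|L| <= #|Wn|.
  rewrite -(card_in_image (f := f) (A := L)); last first.
    by move=> t1 t2 _ _ /(congr1 val) /= E; apply: val_inj; rewrite /= -(flip_firstK t1 Is) E flip_firstK.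
  apply: subset_leq_card; apply/subsetP => _ /imageP[t /andP[h1 h2] ->].
  by rewrite inE /= flip_first_wins.
have GW : #|G| <= 2 * #|Wn|.
  rewrite mul2n -addnn; apply: leq_trans (leq_add LW (leqnn _)).
  rewrite -cardUI; apply: leq_trans (leq_addr _ _); apply: subset_leq_card.
  by apply/subsetP => t; rewrite !inE => ->; case: (wins s t).
have cnt : \sum_(t : N.-tuple H) count F t <= C * #|H| ^ N + N * #|G|.
  rewrite [#|G|]card_sum big_distrr /= -card_tuple -[C * _]mulnC -sum_nat_const -big_split /=.
  apply: leq_sum => t _; rewrite inE; case E : (has_survivor s t).
    by rewrite muln1; apply: leq_trans (count_size _ _) _; rewrite size_tuple leq_addl.
  by rewrite muln0 addn0; apply: leq_trans (lC t); apply: count_no_survivor; rewrite E.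
have tot := sum_count_tuple N F.
move: cnt tot GW; move: (\sum_t _) #|G| #|Wn| => a g wn cnt tot GW.
have X0 : 0 < #|H| ^ N by rewrite expn_gt0 H0.
move: (#|H| ^ N) X0 cnt tot => X X0 cnt tot.
(* N X |H| <= D N |F| X = D |H| a, hence N X <= D a *)
have NX : N * X <= D * a.
  rewrite -(leq_pmul2l H0) [#|H| * (D * a)]mulnCA tot.
  have := leq_mul (leqnn (N * X)) HF; lia.
have : N * X <= D * (C * X) + D * (N * g).
  by apply: leq_trans NX _; rewrite -mulnDr leq_mul2l cnt orbT.
have : 2 * (D * (C * X)) <= N * X by have := leq_mul NC (leqnn X); lia.
rewrite -(leq_pmul2l N0).
have : D * (N * g) <= N * (2 * (D * wn)) by have := leq_mul (leqnn (D * N)) GW; lia.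
nia.
Qed.

End FlipArgument.

End FlipCounting.
Import FlipCounting.

(** * Small coefficients, and the covering of an interval by cells *)

Module Covering.
Local Open Scope ring_scope.

Lemma sum_abs_le n (F : 'I_n -> int) (M : nat) :
  (forall j, (absz (F j) <= M)%N) -> (absz (\sum_j F j)%R <= n * M)%N.
Proof.
move=> FM; elim: n F FM => [|n IH] F FM; first by rewrite big_ord0.
rewrite big_ord_recr /= mulSn; have := FM ord_max; have := IH _ (fun j => FM (widen_ord (leqnSn n) j)).
move: (\sum_j _) (F _) (n * M)%N => a b c ac bM; lia.
Qed.

(* If a coefficient is large, two points of the discretised segment from 0 to
   [U] have the same image, and their difference can be subtracted from [U]. *)
Lemma small_coefficients n (B : 'I_n -> 'I_n -> int) (v U : 'I_n -> int) (b V : nat) :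
  (forall i j, (absz (B i j) <= b)%N) -> (forall i, (absz (v i) <= V)%N) ->
  (forall i, \sum_j B i j * U j = v i) ->
  exists U', (forall i, \sum_j B i j * U' j = v i) /\
    forall j, (absz (U' j) <= (2 * (V + n * b) + 1) ^ n)%N.
Proof.
move=> Bb vV; set M := (V + n * b)%N; set L := ((2 * M + 1) ^ n)%N.
have [s sU] := ubnP (\sum_j absz (U j))%N.
elim: s U sU => // s IH U; rewrite ltnS => sU UE.
case: (boolP [forall j, (absz (U j) <= L)%N]) => [/forallP le|]; first by exists U.
rewrite negb_forall => /existsP[j0]; rewrite -ltnNge => Lj0.
set N := absz (U j0) in Lj0; have N0 : (0 < N)%N by lia.
(* The point i/N of the segment, rounded towards 0 in each coordinate. Its image is (i/N) v up to a
   rounding error of at most n b. *)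
pose p (i : nat) (j : 'I_n) : int := sgz (U j) * (i * absz (U j) %/ N)%N%:Z.
pose img (i : nat) (k : 'I_n) : int := \sum_j B k j * p i j.
have frac i j : (absz (i%:Z * U j - N%:Z * p i j)%R <= N)%N.
  have := divn_eq (i * absz (U j)) N; have := ltn_pmod (i * absz (U j)) N0.
  rewrite /p; move: (divn _ _) (modn _ _) => q m mN E.
  have E' : i%:Z * `|U j| = q%:Z * N%:Z + m%:Z by lia.
  by case: (sgzP (U j)) E' => [->|U0|U0] E'; nia.
have imgM i k : (i <= N)%N -> (absz (img i k) <= M)%N.
  move=> iN.
  have E : N%:Z * img i k = i%:Z * v k - \sum_j B k j * (i%:Z * U j - N%:Z * p i j).
    rewrite -UE /img !mulr_sumr -sumrB; apply: eq_bigr => j _; ring.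
  have S : (absz (\sum_j B k j * (i%:Z * U j - N%:Z * p i j))%R <= n * (b * N))%N.
    by apply: sum_abs_le => j; rewrite abszM leq_mul.
  have : (absz (N%:Z * img i k)%R <= N * M)%N.
    rewrite E; apply: (@leq_trans (absz (i%:Z * v k)%R + n * (b * N))%N).
      by move: (\sum_j _) S (i%:Z * v k) => a S c; lia.
    have : (absz (i%:Z * v k)%R <= N * V)%N by rewrite abszM leq_mul.
    by rewrite /M; nia.
  by rewrite abszM absz_nat leq_pmul2l.
have inM (z : int) : (absz z <= M)%N -> (absz (z + M%:Z)%R < 2 * M + 1)%N by lia.
pose f (i : 'I_N.+1) : {ffun 'I_n -> 'I_(2 * M + 1)} :=
  [ffun k => Ordinal (inM _ (imgM i k (ltn_ord i : (i <= N)%N)))].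
(* There are N + 1 > L points but only L possible images. *)
have /injectivePn[i1 [i2 i12 E12]] : ~~ injectiveb f.
  apply/negP => /injectiveP /leq_card; rewrite card_ord card_ffun !card_ord -/L; lia.
wlog lt12 : i1 i2 i12 E12 / (i1 < i2)%N.
  by move=> W; have [/W|/W|/val_inj] := ltngtP i1 i2; [apply| rewrite eq_sym; apply| move/eqP; rewrite (negbTE i12)].
have img12 k : img i1 k = img i2 k.
  have := congr1 (fun g : {ffun _ -> 'I__} => val (g k)) E12; rewrite !ffunE /=.
  have := imgM i1 k (ltn_ord i1 : (i1 <= N)%N); have := imgM i2 k (ltn_ord i2 : (i2 <= N)%N); lia.
(* This kernel vector lies between 0 and [U] in every coordinate. Subtracting it increases no
   absolute value and lowers that of coordinate [j0] by i2 - i1. *)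
pose q j := p i2 j - p i1 j.
have qE j : absz (U j - q j)%R = (absz (U j) - (i2 * absz (U j) %/ N - i1 * absz (U j) %/ N))%N.
  have l1 : (i1 * absz (U j) %/ N <= i2 * absz (U j) %/ N)%N.
    by apply: leq_div2r; rewrite leq_mul2r (ltnW lt12) orbT.
  have l2 : (i2 * absz (U j) %/ N <= absz (U j))%N.
    rewrite -[X in (_ <= X)%N](mulKn _ N0); apply: leq_div2r.
    by rewrite leq_mul2r -ltnS ltn_ord orbT.
  rewrite /q /p; move: (divn _ _) (divn _ _) l1 l2 => a c l1 l2.
  by case: (sgzP (U j)) => U0; lia.
apply: (IH (fun j => U j - q j)); last first.
  move=> k; rewrite -UE -[RHS]subr0 -[X in _ - X](subrr (img i2 k)) -{2}img12.
  by rewrite /img -!sumrB; apply: eq_bigr => j _; rewrite /q; ring.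
apply: leq_trans sU; rewrite (bigD1 j0) //= [X in (_ < X)%N](bigD1 j0) //=.
rewrite -addSn leq_add //.
  by rewrite qE -/N !mulnK //; have := ltn_ord i2; lia.
by apply: leq_sum => j _; rewrite qE leq_subr.
Qed.

(** The cell index [i] encodes the level [i %/ 128], a position [i %/ 2 %% 64] and the sign
    [i %% 2]. At level k the half width is 2^(e-k) and the cells start at distance 64 half widths
    from the end of the interval. *)
Definition box_h (e : nat) (i : nat) : int := 2 ^+ (e - i %/ 128).
Definition box_c (e : nat) (i : nat) : int :=
  (1 - 2 * (i %% 2)%N%:Z) *
  (64 * 2 ^+ e - 64 * box_h e i + (i %/ 2 %% 64)%N%:Z * box_h e i).

(* The cells are finer near the ends of the interval, so that enlarging one of
   them 16 times does not leave the slightly larger interval. *)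
Lemma interval_cover e (r x : int) : 1 <= r -> `|x| <= 64 * 2 ^+ e * r ->
  exists2 i, (i < 128 * e.+1)%N & `|x - box_c e i * r| <= box_h e i * r /\
   forall x', `|x' - box_c e i * r| <= 16 * box_h e i * r ->
     `|x'| <= (2 ^+ e + 1) * 64 * r.
Proof.
move=> r1 xr; pose z : int := `|x|; have z0 : 0 <= z by rewrite normr_ge0.
pose lo k : int := (64 * 2 ^+ e - 64 * 2 ^+ (e - k)) * r.
have ex0 : exists k, (k <= e)%N && (lo k <= z) by exists 0%N; rewrite /lo subn0 subrr mul0r.
have exb k : (k <= e)%N && (lo k <= z) -> (k <= e)%N by case/andP.
case: (ex_maxnP ex0 exb) => k /andP[ke lok] kmax.
set h : int := 2 ^+ (e - k); have h1 : 1 <= h by rewrite /h exprn_ege1.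
have hr : 0 < h * r by nia.
pose d : int := ((z - lo k) %/ (h * r))%Z.
have dE := divz_eq (z - lo k) (h * r).
have d1 := modz_ge0 (z - lo k) (lt0r_neq0 hr).
have := ltz_mod (z - lo k) (lt0r_neq0 hr); rewrite gtr0_norm // => d2.
rewrite -/d in dE; move: (modz _ _) dE d1 d2 => m dE d1 d2.
have loE : lo k = 64 * 2 ^+ e * r - 64 * (h * r) by rewrite /lo -/h; ring.
have d0 : 0 <= d by nia.
have d64 : d <= 64 by rewrite -/z in xr; nia.
(* The value 64 arises only at the right end point of the interval, which is given to the last
   cell. *)
pose q : nat := if d == 64 then 63%N else absz d.
have q64 : (q < 64)%N by rewrite /q; case: eqP; lia.
have qr : 0 <= z - lo k - q%:Z * (h * r) <= h * r.
  rewrite /q; case: eqP => dd; last first.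
    by have -> : (absz d)%:Z = d; [lia|rewrite dE; move: (d * (h * r)); lia].
  by rewrite dd in dE; rewrite -/z in xr; nia.
have top : z + 16 * (h * r) <= (2 ^+ e + 1) * 64 * r.
  have [ek|ek] := eqVneq k e.
    by rewrite -/z in xr; rewrite /h ek subnn expr0; move: (2 ^+ e * r) xr; nia.
  (* By maximality of [k] there remain at least 32 half widths to the end of the interval, more than
     the 16 that are needed. On the last level the half width is 1 and the slack 64 r suffices. *)
  have : ~~ (lo k.+1 <= z).
    by apply/negP => lz; have := kmax k.+1; rewrite lz; lia.
  rewrite /lo -ltNge; have -> : 64 * 2 ^+ (e - k.+1) = 32 * h :> int.
    by rewrite /h (_ : (e - k)%N = (e - k.+1).+1) ?exprS; [ring|lia].
  move: (2 ^+ e) => E lt.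
  have -> : (E + 1) * 64 * r = 64 * E * r + 64 * r by ring.
  have : (64 * E - 32 * h) * r = 64 * E * r - 32 * (h * r) by ring.
  move: (64 * E * r) (h * r) hr => u t; lia.
pose i : nat := (128 * k + 2 * q + (x < 0)%R)%N.
have i1 : (i %/ 128)%N = k by rewrite /i; case: (x < 0); lia.
have i2 : (i %% 2)%N = (x < 0)%R by rewrite /i; case: (x < 0); lia.
have i3 : (i %/ 2 %% 64)%N = q by rewrite /i; case: (x < 0); lia.
exists i; first by rewrite /i; case: (x < 0); nia.
rewrite /box_c /box_h i1 i2 i3 -/h.
have -> : (1 - 2 * (x < 0)%R%:Z) * (64 * 2 ^+ e - 64 * h + q%:Z * h) * r =
  (1 - 2 * (x < 0)%R%:Z) * (lo k + q%:Z * (h * r)) by rewrite loE; ring.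
have -> : 16 * h * r = 16 * (h * r) by ring.
have lo0 : 0 <= lo k + q%:Z * (h * r).
  rewrite loE; have : h <= 2 ^+ e by rewrite /h; apply: ler_weXn2l => //; exact: leq_subr.
  by move: (2 ^+ e) => E hE; nia.
have {}qr : 0 <= z - (lo k + q%:Z * (h * r)) <= h * r by rewrite opprD addrA.
move: (lo k + q%:Z * (h * r)) ((2 ^+ e + 1) * 64 * r) (h * r) lo0 qr top hr => c t u.
rewrite /z; move=> c0 qr top hr; split=> [|x']; case: (ltP x 0) qr top => x0 /= qr top; lia.
Qed.

End Covering.
Import Covering.

(** * One trial: random digits, the flip, and its success probability *)

Module TrialModel.
Local Open Scope ring_scope.

Lemma card_shift_ord (M2 : nat) (d : int) : (absz d <= M2)%N ->
  (M2 <= #|[pred t : 'I_(2 * M2) | (0 <= t%:Z + d < (2 * M2)%N%:Z)%R]|)%N.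
Proof.
move=> dM; pose c : nat := if 0 <= d then 0%N else M2.
have lt (i : 'I_M2) : (i + c < 2 * M2)%N.
  by rewrite /c; have := ltn_ord i; case: ifP; lia.
pose f i : 'I_(2 * M2) := Ordinal (lt i).
rewrite -{1}(card_ord M2) -(card_image (f := f)); last first.
  by move=> i j /(congr1 val) /= /addIn /val_inj.
apply: subset_leq_card; apply/subsetP => _ /imageP[i _ ->]; rewrite inE /= /c.
by have := ltn_ord i; case: (ltP d 0) => d0 /=; lia.
Qed.

Section Trial.
Variables (n : nat) (Q : int) (M2 : nat) (R : nat -> int) (levels base : nat).
Variables (B : nat -> nat -> int) (T cr s : nat -> int).
Local Notation M := (2 * M2)%N.
Local Notation PM := (M%:Z).
Hypotheses (Q0 : 0 < Q) (PM0 : 0 < PM).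
Hypothesis RS : forall l, (l < levels)%N -> R l.+1 = (R l %/ 2)%Z + PM.
Hypothesis RQ : forall l, (l <= levels)%N -> 0 <= R l /\ 8 * (R l + PM) <= Q.
Hypothesis crQ : forall i, (i < n)%N -> 8 * `|cr i| <= Q.
Hypothesis s1 : forall i, (i < n)%N -> 1 <= s i.
Local Notation latv := (latv n Q B T cr s).
Local Notation scaledv := (scaledv n B T cr s).
Local Notation rawv := (rawv n B T).
Local Notation pert := (pert n Q).
Local Notation stored := (stored n Q PM R levels base B T cr s).
Local Notation small := (small n PM).
Local Notation sieve := (sieve n Q R base levels 0).
Hypothesis R0big : forall uv (tau : bool) i, small uv -> (i < n)%N ->
  `|scaledv uv (- tau%:Z) i| + PM <= R 0%N.

Local Notation H := ((2 * n).+1.-tuple 'I_M).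

(* Digit 0 carries the random bit tau, digits 1 to n the perturbation and the
   last n digits the coefficients of a random lattice vector. *)
Definition dig (h : seq 'I_M) (j : nat) : nat := nth 0%N (map val h) j.
Definition tau_of (h : seq 'I_M) : bool := odd (dig h 0).
Definition xv_of (h : seq 'I_M) (j : nat) : int := (dig h j.+1)%:Z.
Definition uv_of (h : seq 'I_M) (j : nat) : int := (dig h (n + j).+1)%:Z.
Definition x_of h : int := pert (xv_of h) (tau_of h).
Definition y_of h : int := x_of h + latv (uv_of h) (- (tau_of h)%:Z).

Definition step_table (tb : nat -> int) (h : H) := (sieve tb (y_of h) (x_of h)).1.
Definition survives (tb : nat -> int) (h : H) : bool :=
  isSome (sieve tb (y_of h) (x_of h)).2.
Definition target_seen (tb : nat -> int) (h : H) : bool :=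
  if (sieve tb (y_of h) (x_of h)).2 is Some y
  then tcoef n Q PM R levels y (x_of h) != 0 else false.

Lemma dig_lt (h : H) j : (j < (2 * n).+1)%N -> (dig h j < M)%N.
Proof.
move=> jn; rewrite /dig -[j]/(val (Ordinal jn)) (nth_map (tnth_default h (Ordinal jn))) ?size_tuple //.
exact: ltn_ord.
Qed.

Lemma dig_tnth (h : H) j : dig h (val j) = val (tnth h j).
Proof.
rewrite /dig (nth_map (tnth_default h j)); last by rewrite size_tuple; exact: ltn_ord.
by [].
Qed.

Lemma small_xv (h : H) : small (xv_of h).
Proof. by move=> i il; rewrite /xv_of; have := @dig_lt h i.+1; move: (dig _ _) il; clear; lia. Qed.
Lemma small_uv (h : H) : small (uv_of h).
Proof. by move=> i il; rewrite /uv_of; have := @dig_lt h (n + i).+1; move: (dig _ _) il; clear; lia. Qed.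

Lemma reduced_start (h : H) :
  reduced n Q R B T cr s 0 (y_of h) (xv_of h) (tau_of h).
Proof.
exists (uv_of h), (- (tau_of h)%:Z); split=> // [i il|]; last by case: (tau_of h).
have := R0big (tau_of h) (small_uv h) il; have := small_xv h il.
move: (scaledv _ _ _) (xv_of h i) (R 0%N); clear; lia.
Qed.

Lemma sieve_of_spec tb (h : H) : stored tb ->
  [/\ stored (step_table tb h),
      forall y', (sieve tb (y_of h) (x_of h)).2 = Some y' ->
        reduced n Q R B T cr s levels y' (xv_of h) (tau_of h)
    & ~~ survives tb h ->
      exists (a : nat) (v : int), [/\ (base <= a < base + ncells n * levels)%N,
        ~~ (0 < tb a), 0 < v, v < 2 * offset n Q & step_table tb h = upd tb a v]].
Proof.
move=> st.
have [S1 S2 S3] := sieve_spec Q0 PM0 RS RQ crQ s1 st (small_xv h) (reduced_start h) (add0n levels).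
split=> // ; rewrite /survives /step_table; case: (sieve _ _ _) S3 => a [] //= S3 _; exact: S3.
Qed.

Definition agree_table (t t' : nat -> int) :=
  forall a, (base <= a < base + ncells n * levels)%N -> t a = t' a.

(** Winning sequences are counted for a run that starts from the memory [fun=> 0], whereas the
    program's memory holds other data outside the table. This transfers the outcome from one to the
    other. *)
Lemma sieve_agree f l t t' y xv tau : stored t -> agree_table t t' ->
  small xv -> reduced n Q R B T cr s l y xv tau -> (l + f)%N = levels ->
  (SieveModel.sieve n Q R base f l t y (pert xv tau)).2 =
  (SieveModel.sieve n Q R base f l t' y (pert xv tau)).2 /\
  agree_table (SieveModel.sieve n Q R base f l t y (pert xv tau)).1
              (SieveModel.sieve n Q R base f l t' y (pert xv tau)).1.
Proof.
move=> st ag sx; elim: f l y => [|f IH] l y red lf //=.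
have ll : (l < levels)%N by lia.
have [q [qc kq sq]] := slotE base Q0 PM0 RQ (ltnW ll) red.
have slb : (base <= slot n Q R base l y < base + ncells n * levels)%N.
  by rewrite sq; move: qc; nia.
rewrite -(ag _ slb); case: ifP => [pos|neg].
  apply: IH; last by lia.
  rewrite sq in pos *; have [y' [xv' [tau' [sx' red' kq' ->]]]] := st l q ll qc pos.
  by rewrite addrK; apply: (reduced_step Q0 PM0 RS RQ ll red red' sx'); rewrite kq kq'.
by split=> // a ab; rewrite /= /upd; case: (a == _) => //; exact: ag.
Qed.

(** The number of free cells is a potential: a lost sample fills one, a survivor leaves the table as
    it is. *)
Lemma losses_le tb hs : stored tb ->
  (losses step_table survives tb hs <= ncells n * levels)%N.
Proof.
pose free (t : nat -> int) := #|[pred a : 'I_(ncells n * levels) | ~~ (0 < t (base + a)%N)]|.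
move=> st; apply: (@leq_trans (free tb)); last by rewrite -[leqRHS]card_ord max_card.
elim: hs tb st => //= h hs IH tb st.
have [S1 _ S3] := sieve_of_spec h st.
case E : (survives tb h); rewrite /=.
  rewrite add0n; suff E1 : step_table tb h = tb by rewrite E1; exact: IH.
  move: E; rewrite /survives /step_table; case E : (sieve _ _ _) => [t [y|]] //= _.
  by have [] := sieve_shift Q0 0 0 E.
have [a [v [aM na v0 _ E1]]] := S3 (negbT E); rewrite add1n.
have aM' : (a - base < ncells n * levels)%N by lia.
apply: leq_ltn_trans (IH _ S1) _; rewrite E1; apply: proper_card; apply/properP; split.
  apply/subsetP => b; rewrite !inE /upd; case: eqP => // _.
  by rewrite v0.
have sb : (base + (a - base))%N = a by lia.
exists (Ordinal aM'); first by rewrite inE /= sb na.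
by rewrite inE /= sb /upd eqxx v0.
Qed.

Variable us : nat -> int.
Hypothesis usM : forall j, (j < n)%N -> (absz (us j) <= M2)%N.
Hypothesis wM : forall i, (i < n)%N -> (absz (scaledv us (-1) i) <= M2)%N.

(** Here [us] are the coefficients of a lattice vector near the target. The flip adds [us] to the
    random coefficients and removes the scaled difference from the perturbation; the sign [sg]
    reverses this when [tau] is set, which makes the flip an involution. *)
Definition delta (j : nat) : int := if (j < n)%N then - scaledv us (-1) j else us (j - n)%N.
Definition sg (h : H) : int := if tau_of h then -1 else 1.
Definition flippable (h : H) : bool :=
  [forall j : 'I_(2 * n), 0 <= (dig h j.+1)%:Z + sg h * delta j < PM].
Definition target (h : H) (j : nat) : nat :=
  if j is i.+1 then absz ((dig h j)%:Z + sg h * delta i)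
  else if odd (dig h 0) then (dig h 0).-1 else (dig h 0).+1.
(** The default [tnth h j] is never taken on [flippable] samples. *)
Definition flip (h : H) : H := [tuple insubd (tnth h j) (target h j) | j < (2 * n).+1].

Lemma target_lt h j : flippable h -> (j < (2 * n).+1)%N -> (target h j < M)%N.
Proof.
move=> /forallP fl; case: j => [|j] jn /=.
  by have := @dig_lt h 0 isT; case: ifP; lia.
by have := fl (Ordinal (jn : (j < 2 * n)%N)) => /=; lia.
Qed.

Lemma dig_flip h j : flippable h -> (j < (2 * n).+1)%N -> dig (flip h) j = target h j.
Proof.
move=> fl jn; rewrite -[j]/(val (Ordinal jn)) dig_tnth tnth_mktuple val_insubd.
by rewrite target_lt.
Qed.

Lemma tau_flip h : flippable h -> tau_of (flip h) = ~~ tau_of h.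
Proof. by move=> fl; rewrite /tau_of dig_flip //=; case: ifP; lia. Qed.

Lemma sg_flip h : flippable h -> sg (flip h) = - sg h.
Proof. by move=> fl; rewrite /sg tau_flip //; case: (tau_of h). Qed.

Lemma dig_flipS h j : flippable h -> (j < 2 * n)%N ->
  (dig (flip h) j.+1)%:Z = (dig h j.+1)%:Z + sg h * delta j.
Proof.
move=> fl jn; rewrite dig_flip //=.
by have /forallP/(_ (Ordinal jn)) /= := fl; lia.
Qed.

Lemma flippable_flip h : flippable h -> flippable (flip h) /\ flip (flip h) = h.
Proof.
move=> fl; have fl' : flippable (flip h).
  apply/forallP => j; rewrite dig_flipS // sg_flip // mulNr addrK.
  by have := @dig_lt h j.+1; have := ltn_ord j; lia.
split=> //; apply: eq_from_tnth => j; apply: val_inj; rewrite -!dig_tnth.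
case: j => -[|j] jn /=; rewrite dig_flip //=.
  by rewrite dig_flip //=; case: ifP; case: ifP; lia.
rewrite dig_flipS // sg_flip // mulNr addrK; lia.
Qed.

Lemma eq_rawv U U' k i : (forall j, (j < n)%N -> U j = U' j) -> rawv U k i = rawv U' k i.
Proof. by move=> E; congr (_ + _); apply: eq_bigr => j _; rewrite E. Qed.

Lemma eq_latv U U' k : (forall j, (j < n)%N -> U j = U' j) -> latv U k = latv U' k.
Proof.
move=> E; rewrite /SieveModel.latv; congr (_ + _ + _ * _); apply: eq_pack => i _.
  by rewrite /SieveModel.scaledv (eq_rawv _ _ E).
exact: eq_rawv.
Qed.

(** In the low block the change of the perturbation cancels that of the lattice vector, and in digit
    [n] the change of [tau] cancels that of the target coefficient. Only the high block moves. *)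
Lemma y_flip h : flippable h ->
  y_of (flip h) = y_of h + Q ^+ n.+1 * (sg h * pack Q n (rawv us (-1))).
Proof.
move=> fl; rewrite /y_of /x_of /SieveModel.pert tau_flip //.
have -> : pack Q n (xv_of (flip h)) = pack Q n (xv_of h) - sg h * pack Q n (scaledv us (-1)).
  rewrite -packZ -packB; apply: eq_pack => j jn.
  by rewrite /xv_of dig_flipS ?/delta ?jn ?mulrN //; lia.
have E j : (j < n)%N -> uv_of (flip h) j = uv_of h j + sg h * us j.
  move=> jn; rewrite /uv_of dig_flipS; [|by []|lia].
  by rewrite /delta ltnNge leq_addr /= addKn.
rewrite /sg in E *; case: (tau_of h) E => /= E.
  have -> : latv (uv_of (flip h)) (- 0) = latv (uv_of h) (-1) - latv us (-1).
    rewrite -(latvB n Q B T cr s); have -> : (-1 - -1 : int) = - 0 by ring.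
    by apply: eq_latv => j jn; rewrite E //; ring.
  by rewrite {2}/SieveModel.latv; ring.
have -> : latv (uv_of (flip h)) (-1) = latv (uv_of h) (- 0) + latv us (-1).
  apply/eqP; rewrite -subr_eq -(latvB n Q B T cr s); have -> : (-1 - -1 : int) = - 0 by ring.
  by apply/eqP/eq_latv => j jn; rewrite E //; ring.
by rewrite {2}/SieveModel.latv; ring.
Qed.

Lemma survives_flip tb h : stored tb -> flippable h -> survives tb h ->
  [/\ survives tb (flip h), step_table tb (flip h) = step_table tb h
    & ~~ target_seen tb h -> target_seen tb (flip h)].
Proof.
move=> st fl; have [fl' _] := flippable_flip fl.
have [_ red _] := sieve_of_spec h st; have [_ red' _] := sieve_of_spec (flip h) st.
move: red red'; rewrite /survives /step_table /target_seen.
case E : (sieve tb (y_of h) (x_of h)) => [t [y|]] //= red red' _.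
have [-> E'] := sieve_shift Q0 (sg h * pack Q n (rawv us (-1))) (x_of (flip h)) E.
rewrite -y_flip // in E'; rewrite E' /= in red' *; split=> // /negPn/eqP tc.
have := red' _ erefl; have := red _ erefl; rewrite tau_flip // => r1 r2.
rewrite /x_of tau_flip //; apply: (tcoef_flip Q0 PM0 RQ (small_xv h) (small_xv (flip h)) r1 r2).
exact: tc.
Qed.

(** For a fixed digit 0 the directions of all shifts are fixed, and no shift exceeds half of the
    range. So each of the 2n other digits stays in range for at least half of its values, giving the
    fraction 2^(-2n). *)
Lemma card_flippable : (0 < M2)%N -> (#|{: H}| <= 4 ^ n * #|flippable|)%N.
Proof.
move=> M20; rewrite card_tuple card_ord card_sum sum_tupleS expnS.
apply: (@leq_trans (4 ^ n * \sum_(g : 'I_M) M2 ^ (2 * n))%N).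
  rewrite sum_nat_const card_ord mulnCA leq_mul2l; apply/orP; right.
  by rewrite expnMn (expnM 2 2 n).
rewrite leq_mul2l; apply/orP; right; apply: leq_sum => g _.
pose sgn : int := if odd g then -1 else 1.
pose P j := [pred t : 'I_M | (0 <= t%:Z + sgn * delta j < M%:Z)%R].
have PM2 j : (j < 2 * n)%N -> (M2 <= #|P j|)%N.
  move=> jn; apply: card_shift_ord.
  have : (absz (delta j) <= M2)%N.
    rewrite /delta; case: ifP => jn'; first by rewrite abszN wM.
    by apply: usM; lia.
  by rewrite /sgn; case: ifP; lia.
apply: leq_trans (card_all_index PM2) _; rewrite card_sum; apply: leq_sum => t _.
rewrite inE /in_mem /=; case: forallP => // Pt; rewrite (_ : flippable _ = true) //.
apply/forallP => j; have := Pt j; rewrite /P /sg /sgn /tau_of /= /dig /=.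
by rewrite (nth_map g) ?size_tuple // (tnth_nth g).
Qed.

Lemma card_trial_wins tb N : stored tb -> (0 < M2)%N -> (0 < N)%N ->
  (2 * 4 ^ n * (ncells n * levels) <= N)%N ->
  (#|{: H}| ^ N <= 4 * 4 ^ n *
     #|[pred t : N.-tuple H | wins step_table survives target_seen tb t]|)%N.
Proof.
move=> st M20 N0 NC.
apply: (@card_wins _ _ stored step_table survives target_seen flippable flip _ _ _
          tb N (ncells n * levels) (4 ^ n)) => //.
- by move=> t h /sieve_of_spec-/(_ h)[].
- exact: flippable_flip.
- exact: survives_flip.
- by move=> hs; exact: losses_le.
- exact: card_flippable.
- by rewrite card_tuple card_ord expn_gt0; lia.
Qed.

End Trial.

End TrialModel.
Import TrialModel.

(** * Events that depend on selected coins only *)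

Module CoinCounting.
Local Open Scope ring_scope.

(** Adding a fixed pattern modulo 2 permutes the coin sequences and carries one fibre of the
    restriction map onto another, so all fibres are equally large. *)
Lemma card_fiber_inj (I : finType) T (f : I -> 'I_T) : injective f ->
  forall G : pred {ffun I -> bool},
  (#|[pred c : T.-tuple bool | G [ffun i => tnth c (f i)]]| * 2 ^ #|I| = 2 ^ T * #|G|)%N.
Proof.
move=> fi G.
pose res (c : T.-tuple bool) : {ffun I -> bool} := [ffun i => tnth c (f i)].
pose fib b := #|[pred c | res c == b]|.
pose ext (b : {ffun I -> bool}) (t : 'I_T) : bool :=
  if [pick i | f i == t] is Some i then b i else false.
have extE b i : ext b (f i) = b i.
  by rewrite /ext; case: pickP => [k /eqP/fi->|/(_ i)] //; rewrite eqxx.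
pose sh b (c : T.-tuple bool) : T.-tuple bool := [tuple tnth c t (+) ext b t | t < T].
have shE b c t : tnth (sh b c) t = tnth c t (+) ext b t by rewrite tnth_mktuple.
have resE c i : res c i = tnth c (f i) by rewrite ffunE.
have shK b : involutive (sh b).
  by move=> c; apply/eq_from_tnth => t; rewrite !shE -addbA addbb addbF.
have fibE b : fib b = fib [ffun=> false].
  rewrite /fib -(card_image (f := sh b) (inv_inj (shK b))).
  apply: eq_card => c; rewrite !inE; apply/idP/eqP => [/imageP[c' cb ->]|c0].
    move: cb; rewrite inE => /eqP <-; apply/ffunP => i.
    by rewrite resE shE extE resE addbb ffunE.
  apply/imageP; exists (sh b c); last by rewrite shK.
  rewrite inE; apply/eqP/ffunP => i; rewrite resE shE extE.
  by have := congr1 (fun g : {ffun _ -> _} => g i) c0; rewrite resE ffunE => ->.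
have cnt (P : pred {ffun I -> bool}) :
    #|[pred c | P (res c)]| = (#|P| * fib [ffun=> false])%N.
  rewrite -sum1_card (partition_big res P) //=.
  rewrite -sum_nat_const; apply: eq_bigr => b Pb; rewrite sum1_card -(fibE b).
  apply: eq_card => c; rewrite unfold_in [RHS]unfold_in /=.
  by case: eqP => [E|_]; rewrite ?andbF // andbT inE /= E.
have := cnt predT; rewrite (eq_card (B := predT)) // !card_ffun card_tuple card_bool => E.
by rewrite (cnt G) E; ring.
Qed.

End CoinCounting.
Import CoinCounting.

(** * Independent repetitions and the union bound *)

Module Amplification.
Local Open Scope ring_scope.

Lemma bernoulli_nat c k : (c ^ k.+1 + k.+1 * c ^ k <= c.+1 ^ k.+1)%N.
Proof.
elim: k => [|k IH]; first by rewrite !expn1 expn0 muln1 addn1.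
rewrite [leqRHS]expnS; apply: leq_trans (leq_mul (leqnn c.+1) IH).
by rewrite !expnS; move: (c ^ k)%N => x; nia.
Qed.

(** That is (1 - 1/c)^c <= 1/2, from Bernoulli's inequality: [c] repetitions with success
    probability 1/c halve the failure probability. *)
Lemma double_pred_exp c : (0 < c)%N -> (2 * c.-1 ^ c <= c ^ c)%N.
Proof.
case: c => // c _ /=; apply: leq_trans (bernoulli_nat c c).
by rewrite mul2n -addnn leq_add2l expnS leq_mul2r leqnSn orbT.
Qed.

Lemma amplify (K : finType) (P : pred K) c k : (0 < c)%N -> (#|K| <= c * #|P|)%N ->
  (2 ^ k * #|predC P| ^ (c * k) <= #|K| ^ (c * k))%N.
Proof.
move=> c0 KP; have Kc := cardC P; move: #|predC P| Kc => q Kc.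
have cq : (c * q <= c.-1 * #|K|)%N.
  by rewrite -Kc in KP *; case: c c0 KP => // c _ /=; move: #|P|; clear; nia.
have e1 : ((c * q) ^ (c * k) <= (c.-1 * #|K|) ^ (c * k))%N.
  by case: (posnP (c * k)) => [->//|ck]; rewrite leq_exp2r.
have e2 : (2 ^ k * c.-1 ^ (c * k) <= c ^ (c * k))%N.
  rewrite !expnM -expnMn; case: (posnP k) => [->//|k0]; rewrite leq_exp2r //.
  exact: double_pred_exp.
have p0 : (0 < c ^ (c * k))%N by rewrite expn_gt0 c0.
rewrite -(leq_pmul2l p0) mulnCA -expnMn.
apply: (leq_trans (leq_mul (leqnn (2 ^ k)) e1)); rewrite expnMn mulnA.
by rewrite leq_mul2r e2 orbT.
Qed.

(** With [wd + n] groups of [c] repetitions each event fails with probability at most 2^-(wd+n); the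
    part 2^-wd pays for the [S] events. *)
Lemma union_bound (K : finType) (S : nat) (P : nat -> pred K) c wd n :
  (0 < c)%N -> (S <= 2 ^ wd)%N -> (forall s, (s < S)%N -> (#|K| <= c * #|P s|)%N) ->
  (2 ^ n * #|[pred om : (c * (wd + n)).-tuple K |
      [exists s : 'I_S, all (predC (P s)) om]]| <= #|K| ^ (c * (wd + n)))%N.
Proof.
move=> c0 Sw KP; set L := (c * (wd + n))%N.
apply: (@leq_trans (2 ^ n * \sum_(s < S) #|predC (P s)| ^ L)).
  rewrite leq_mul2l; apply/orP; right.
  rewrite (eq_bigr (fun s : 'I_S => #|[pred om : L.-tuple K | all (predC (P s)) om]|)); last first.
    by move=> s _; rewrite card_all_tuple.
  rewrite card_sum (eq_bigr (fun s : 'I_S => \sum_(t : L.-tuple K) (all (predC (P s)) t : nat))); last first.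
    by move=> s _; rewrite card_sum; apply: eq_bigr.
  rewrite exchange_big /=; apply: leq_sum => t _; rewrite inE.
  by case: existsP => // -[s as_]; rewrite (bigD1 s) //= as_ leq_addr.
apply: (@leq_trans (2 ^ n * \sum_(s < S) (#|K| ^ L %/ 2 ^ (wd + n)))).
  rewrite leq_mul2l; apply/orP; right; apply: leq_sum => s _.
  by rewrite leq_divRL ?expn_gt0 // mulnC; apply: amplify => //; exact: KP.
rewrite sum_nat_const card_ord mulnA.
apply: (@leq_trans (2 ^ n * 2 ^ wd * (#|K| ^ L %/ 2 ^ (wd + n)))).
  by rewrite leq_mul2r leq_mul2l Sw !orbT.
by rewrite -expnD addnC mulnC; exact: leq_divM.
Qed.

End Amplification.
Import Amplification.

(** * From coin bits to random digits *)

Module Decoding.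
Local Open Scope ring_scope.

Fixpoint dval (b : nat -> bool) (k : nat) : nat :=
  if k is k'.+1 then 2 * dval b k' + b k' else 0.

Lemma dval_lt b k : (dval b k < 2 ^ k)%N.
Proof. by elim: k => //= k IH; rewrite expnS; case: (b k) => /=; lia. Qed.

Lemma dval_inj b b' k : dval b k = dval b' k -> forall i, (i < k)%N -> b i = b' i.
Proof.
elim: k => //= k IH E i; have [E1 E2] : dval b k = dval b' k /\ b k = b' k.
  by move: E; case: (b k); case: (b' k) => /=; lia.
by rewrite ltnS leq_eqVlt => /orP[/eqP->//|]; exact: IH.
Qed.

Lemma eq_dval b b' k : (forall i, (i < k)%N -> b i = b' i) -> dval b k = dval b' k.
Proof.
elim: k => //= k IH E; rewrite IH ?E // => i ik; apply: E; exact: ltnW.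
Qed.

Section Decode.
Variables (m s N reps M : nat).
Hypotheses (ME : M = (2 ^ m)%N) (s0 : (0 < s)%N) (N0 : (0 < N)%N).
Local Notation H := (s.-tuple 'I_M).
Local Notation len := (reps * N * s)%N.
Local Notation bits := {ffun 'I_len * 'I_m -> bool}.

Lemma M_gt0 : (0 < M)%N. Proof. by rewrite ME expn_gt0. Qed.

Definition lookup (g : bits) (a b : nat) : bool :=
  if (insub a, insub b) is (Some x, Some y) then g (x, y) else false.

Definition symbol (x : nat) : 'I_M := insubd (Ordinal M_gt0) x.

Lemma symbolE x : (x < 2 ^ m)%N -> val (symbol x) = x.
Proof.
move=> xm; have xM : (x < M)%N by rewrite ME.
by rewrite val_insubd xM.
Qed.

Definition block (f : nat -> nat) (p : nat) : N.-tuple H :=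
  [tuple [tuple symbol (f (p * (N * s) + i * s + k)%N) | k < s] | i < N].

Lemma nth_block f p dflt i k : (i < N)%N -> (k < s)%N ->
  (f (p * (N * s) + i * s + k) < 2 ^ m)%N ->
  nth 0%N (map val (nth dflt (block f p) i)) k = f (p * (N * s) + i * s + k)%N.
Proof.
move=> iN ks fm; have -> : nth dflt (block f p) i = tnth (block f p) (Ordinal iN).
  by rewrite (tnth_nth dflt).
rewrite tnth_mktuple (nth_map (symbol 0)) ?size_tuple //.
set t := mktuple _; have -> : nth (symbol 0) t k = tnth t (Ordinal ks) by rewrite (tnth_nth (symbol 0)).
by rewrite tnth_mktuple symbolE.
Qed.

Lemma eq_block f f' p : (p < reps)%N -> (forall a, (a < len)%N -> f a = f' a) ->
  block f p = block f' p.
Proof.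
move=> pr E; apply: eq_from_tnth => i; rewrite !tnth_mktuple.
apply: eq_from_tnth => k; rewrite !tnth_mktuple E //.
have := ltn_ord i; have := ltn_ord k; move: (val i) (val k) => x y yk xi.
have h1 : (x * s + y < N * s)%N by nia.
by rewrite -mulnA; move: pr h1; move: (N * s)%N (x * s)%N => u v; nia.
Qed.

Definition decode (g : bits) : reps.-tuple (N.-tuple H) :=
  [tuple block (fun a => dval (lookup g a) m) p | p < reps].

Lemma decode_inj : injective decode.
Proof.
move=> g g' E; apply/ffunP => -[a b].
have al := ltn_ord a; have ns : (0 < N * s)%N by rewrite muln_gt0 N0.
have p1 : (a %/ (N * s) < reps)%N by rewrite ltn_divLR // mulnA.
have p2 : (a %% (N * s) %/ s < N)%N by rewrite ltn_divLR // ltn_pmod.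
have p3 : (a %% (N * s) %% s < s)%N by rewrite ltn_pmod.
have aE : (a %/ (N * s) * (N * s) + a %% (N * s) %/ s * s + a %% (N * s) %% s = a)%N.
  by rewrite -addnA -divn_eq -divn_eq.
have dE : dval (lookup g a) m = dval (lookup g' a) m.
  have := congr1 (fun t : reps.-tuple _ => tnth t (Ordinal p1)) E; rewrite !tnth_mktuple /=.
  move=> /(congr1 (fun t : N.-tuple H => tnth t (Ordinal p2))); rewrite !tnth_mktuple /=.
  move=> /(congr1 (fun t : H => val (tnth t (Ordinal p3)))); rewrite !tnth_mktuple /= aE.
  by rewrite !symbolE ?dval_lt.
have := dval_inj dE (ltn_ord b); by rewrite /lookup !valK.
Qed.

(** As [M] is a power of two, both sides have the same number of elements and the injection [decode]
    is a bijection: fair bits give uniform digits. *)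
Lemma card_decode (G : pred (reps.-tuple (N.-tuple H))) :
  #|[pred g | G (decode g)]| = #|G|.
Proof.
have cE : #|{: bits}| = #|{: reps.-tuple (N.-tuple H)}|.
  rewrite card_ffun card_prod !card_ord card_bool !card_tuple card_ord ME -!expnM.
  by congr expn; ring.
have [f fK Kf] := inj_card_bij decode_inj (eq_leq (esym cE)).
rewrite -(card_image (f := decode) decode_inj); apply: eq_card => t.
apply/imageP/idP => [[g gG ->]|tG]; first exact: gG.
by exists (f t); rewrite ?Kf // inE /= Kf.
Qed.

End Decode.

End Decoding.
Import Decoding.

(** * The program *)

Module CvpProgram.
Local Open Scope ring_scope.

Declare Scope prog_scope.
Delimit Scope prog_scope with prog.
Coercion Var : nat >-> expr.
Notation "a +' b" := (Bin OpAdd a b) (at level 50, left associativity) : prog_scope.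
Notation "a -' b" := (Bin OpSub a b) (at level 50, left associativity) : prog_scope.
Notation "a *' b" := (Bin OpMul a b) (at level 40, left associativity) : prog_scope.
Notation "a /' b" := (Bin OpDiv a b) (at level 40, left associativity) : prog_scope.
Notation "a %' b" := (Bin OpSub a (Bin OpMul b (Bin OpDiv a b))) (at level 40, left associativity) : prog_scope.
Notation "x <~ e" := (Asg x e) (at level 70) : prog_scope.
Notation "c ;; d" := (Seq c d) (at level 75, right associativity) : prog_scope.
Notation "'$' z" := (Lit (Posz z)) (at level 8, z at level 8) : prog_scope.
Bind Scope prog_scope with expr cmd.

(** Variables below 23 are assigned by [p_setup] only and keep their values afterwards. *)
Notation vn := 0%N. Notation vG := 1%N. Notation vw := 2%N. Notation vPW := 3%N.
Notation vm := 4%N. Notation vPM := 5%N. Notation vQ := 6%N. Notation vQN := 7%N.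
Notation vones := 8%N. Notation vcells := 9%N. Notation vMB := 10%N. Notation vlev := 11%N.
Notation vN := 12%N. Notation vreps := 13%N. Notation vcol := 14%N. Notation vtape := 15%N.
Notation vtab := 16%N. Notation vOFF := 17%N. Notation vntab := 18%N. Notation vR0 := 19%N.
Notation vQR := 20%N. Notation vlen := 21%N. Notation vF4 := 22%N.
Notation vlo := 23%N. Notation vstep := 24%N. Notation vr := 25%N. Notation vfound := 26%N.
Notation vD := 27%N. Notation vbest := 28%N. Notation vk := 29%N. Notation vbeta := 30%N.
Notation vrep := 31%N. Notation vi := 32%N. Notation vtp := 33%N. Notation vbb := 34%N.
Notation vio := 35%N. Notation vh := 36%N. Notation vc := 37%N. Notation vs := 38%N.
Notation vP := 39%N. Notation vf := 40%N. Notation va := 41%N. Notation vb := 42%N.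
Notation vkk := 43%N. Notation vtau := 44%N. Notation vx := 45%N. Notation vy := 46%N.
Notation vR := 47%N. Notation valive := 48%N. Notation vl := 49%N. Notation vY := 50%N.
Notation vkey := 51%N. Notation vd := 52%N. Notation vent := 53%N. Notation vz := 54%N.
Notation vok := 55%N. Notation vX := 56%N. Notation vacc := 57%N. Notation vtot := 58%N.
Notation vtc := 59%N. Notation vE := 60%N.

Section Program.
Variable e : nat.
Local Open Scope prog_scope.
Local Notation pe := (Lit (Posz (2 ^ e)%N)).
Local Notation Mb := (Lit (Posz (128 * e.+1)%N)).

Definition p_key : cmd :=
  For va vn (vd <~ vY %' vQ ;; vY <~ vY /' vQ ;;
             vkey <~ $4 *' vkey +' $4 *' vd /' ($2 *' vR +' $1)).

Definition p_level : cmd :=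
  vY <~ vy +' vR *' vones ;; vkey <~ $0 ;; p_key ;;
  vkey <~ vtab +' vcells *' vl +' ($2 *' vkey +' vY %' vQ) ;;
  vent <~ Get vkey ;;
  If vent (vy <~ vy -' (vent -' vOFF) ;; vR <~ vR /' $2 +' vPM)
          (Put vkey (vy -' vx +' vOFF) ;; valive <~ $0).

Definition p_levels : cmd := For vl vlev (If valive p_level Skip).

Definition p_accept : cmd :=
  For va vn (If (vY %' vQ -' $2 *' vD) (vok <~ $0) Skip ;; vY <~ vY /' vQ).

(** The target coefficient is squared because [If] tests for a positive value. The candidate is
    multiplied by minus this coefficient, which makes the coefficient -1, so that it represents a
    lattice vector minus the target. *)
Definition p_check : cmd :=
  vz <~ (vy -' vx +' ((vR +' vPM) *' vones +' vQN)) /' vQN ;;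
  vtc <~ vz %' vQ -' $1 ;;
  If (vtc *' vtc)
    (vE <~ $0 -' vtc *' (vz /' vQ) ;; vY <~ vE +' vD *' vones ;; vok <~ $1 ;;
     p_accept ;; If vok (vfound <~ $1 ;; vbest <~ vE) Skip) Skip.

Definition p_getx : cmd :=
  For va vn (vx <~ vx +' Get (vtp +' va) *' vP ;; vP <~ vP *' vQ).
Definition p_gety : cmd :=
  For va vn (vy <~ vy +' Get (vtp +' va) *' Get (vcol +' va)).

Definition p_sample : cmd :=
  vtau <~ Get vtp %' $2 ;; vtp <~ vtp +' $1 ;;
  vx <~ $0 ;; vP <~ $1 ;; p_getx ;; vtp <~ vtp +' vn ;;
  vy <~ vx ;; p_gety ;; vtp <~ vtp +' vn ;;
  vx <~ vx +' vtau *' vQN ;;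
  vy <~ vy +' vtau *' (vQN -' Get (vcol +' vn)) ;;
  vR <~ vR0 ;; valive <~ $1 ;; p_levels ;; If valive p_check Skip.

Definition p_clear : cmd := For va vntab (Put (vtab +' va) $0).
Definition p_trial : cmd := p_clear ;; For vi vN p_sample.

Definition p_halve : cmd := For vb vkk (vh <~ vh /' $2).
Definition p_col : cmd :=
  For vb vn (Put (vcol +' vb)
    (Get (vcol +' vb) +' vf *' (Get ($1 +' $2 *' (va *' vn +' vb)) *'
       (vG /' Get ($2 +' $2 *' (va *' vn +' vb)))))).
Definition p_tgt : cmd :=
  Put (vcol +' vn)
    (Get (vcol +' vn) +' vf *' (Get ($1 +' $2 *' (vn *' vn +' va)) *'
       (vG /' Get ($2 +' $2 *' (vn *' vn +' va)))) +' vs *' vc *' vP).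

(** The factor [vf] is (s + Q^(n+1)) Q^i: one multiplication puts an entry of row i into the scaled
    low block and the unscaled high block of its packed column. *)
Definition p_coord : cmd :=
  vio <~ vbb %' Mb ;; vbb <~ vbb /' Mb ;;
  vkk <~ vio /' $128 ;; vh <~ pe ;; p_halve ;;
  vc <~ ($1 -' $2 *' (vio %' $2)) *'
        ($64 *' pe -' $64 *' vh +' (vio /' $2) %' $64 *' vh) *' vr ;;
  vs <~ vPM /' ($2 *' vh *' vr) ;;
  vf <~ (vs +' vQR) *' vP ;;
  p_col ;; p_tgt ;; vP <~ vP *' vQ.

Definition p_box : cmd :=
  For va vn (Put (vcol +' va) $0) ;; Put (vcol +' vn) vQN ;;
  vbb <~ vbeta ;; vP <~ $1 ;; For va vn p_coord.

Definition p_round : cmd :=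
  For vbeta vMB (p_box ;; vtp <~ vtape ;; For vrep vreps p_trial).

Definition p_search : cmd :=
  vlo <~ $0 ;; vstep <~ vPW ;; vbest <~ $0 ;;
  For vk vw
    (vstep <~ vstep /' $2 ;; vr <~ vlo +' vstep ;; vfound <~ $0 ;;
     vD <~ (pe +' $1) *' $64 *' vr ;;
     p_round ;; If vfound Skip (vlo <~ vr)).

(** Adding PM^2 to every coordinate makes the digits readable. Adding the target back turns the
    difference into a lattice vector, written with the common denominator [vG]. *)
Definition p_output : cmd :=
  vY <~ vbest +' vPM *' vPM *' vones ;;
  For va vn
    (vd <~ vY %' vQ ;; vY <~ vY /' vQ ;;
     Put ($2 *' va) (vd -' vPM *' vPM +' Get ($1 +' $2 *' (vn *' vn +' va)) *'
                       (vG /' Get ($2 +' $2 *' (vn *' vn +' va)))) ;;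
     Put ($2 *' va +' $1) vG).

Definition p_digit : cmd :=
  vacc <~ $0 ;; For vb vm (Rnd vd ;; vacc <~ $2 *' vacc +' vd) ;;
  Put (vtape +' va) vacc.
Definition p_tape : cmd := For va vlen p_digit.

(** The number [vX] exceeds n and all entries after clearing denominators; its bit length [vw],
    found by repeated halving, is the parameter from which all sizes are derived. *)
Definition p_setup : cmd :=
  vn <~ Get $0 ;; vtot <~ vn *' vn +' vn ;; vG <~ $128 *' pe ;; vX <~ vn +' $2 ;;
  For va vtot (vG <~ vG *' Get ($2 *' va +' $2) ;;
               vX <~ vX +' Get ($2 *' va +' $1) *' Get ($2 *' va +' $1)) ;;
  vX <~ vX *' vG ;; vw <~ $0 ;; vPW <~ $1 ;;
  While vX (vX <~ vX /' $2 ;; vPW <~ vPW *' $2 ;; vw <~ vw +' $1) ;;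
  vm <~ $5 *' vw *' vn ;; vPM <~ $1 ;;
  For va vn (vPM <~ vPM *' vPW *' vPW *' vPW *' vPW *' vPW) ;;
  vQ <~ vPM *' vPM *' vPM *' vPM *' vPM *' vPM ;;
  vR0 <~ vPM *' vPM *' vPM *' vPM ;;
  vQN <~ $1 ;; vones <~ $0 ;; vF4 <~ $1 ;; vMB <~ $1 ;;
  For va vn (vones <~ vones +' vQN ;; vQN <~ vQN *' vQ ;;
             vF4 <~ vF4 *' $4 ;; vMB <~ vMB *' Mb) ;;
  vcells <~ $2 *' vF4 ;; vlev <~ $3 *' vm ;; vntab <~ vcells *' vlev ;;
  vN <~ $2 *' vF4 *' vntab ;; vreps <~ $4 *' vF4 *' (vw +' vn) ;;
  vcol <~ $2 *' (vn *' vn +' vn) +' $1 ;; vtape <~ vcol +' vn +' $1 ;;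
  vlen <~ vreps *' vN *' ($2 *' vn +' $1) ;; vtab <~ vtape +' vlen ;;
  vQR <~ vQN *' vQ ;; vOFF <~ vQR *' vQR.

Definition cvp_program : cmd := p_setup ;; p_tape ;; p_search ;; p_output.

End Program.

End CvpProgram.
Import CvpProgram.

(** * Verification of a trial *)

Module TrialProgram.
Local Open Scope ring_scope.
Arguments upd f i z j /.

Lemma tri_asg_seq Z w x e c r h j K Q : bounded Z (eval r h e) ->
  tri false Z w c (State (upd r x (eval r h e)) h (j + (esize e + 2))) K Q ->
  tri false Z w (Seq (Asg x e) c) (State r h j) (esize e + 2 + K) Q.
Proof. by move=> b t; apply: tri_seq; apply: tri_asg. Qed.

Lemma tri_call Z w c1 c2 s K1 K2 (Q1 Q : state -> Prop) : tri false Z w c1 s K1 Q1 ->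
  (forall r h j, Q1 (State r h j) ->
    (forall x, x \notin writes c1 -> r x = vars s x) ->
    (~~ puts c1 -> h = memory s) -> tri false Z w c2 (State r h j) K2 Q) ->
  tri false Z w (Seq c1 c2) s (K1 + K2) Q.
Proof.
move=> t1 t2; apply: tri_seq; apply: tri_conseq t1 _ => -[r h j] q fr fh _; exact: t2.
Qed.

Lemma tri_post Z w c s K (Q Q' : state -> Prop) : tri false Z w c s K Q ->
  (forall r h j, Q (State r h j) ->
    (forall x, x \notin writes c -> r x = vars s x) ->
    (~~ puts c -> h = memory s) -> Q' (State r h j)) -> tri false Z w c s K Q'.
Proof. by move=> t1 t2; apply: tri_conseq t1 _ => -[r h j] q fr fh _; exact: t2. Qed.

Lemma subz_mulz_div (x y : int) : x - y * (x %/ y)%Z = (x %% y)%Z.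
Proof. by rewrite /modz mulrC. Qed.

Section Inner.
Variables (Z : nat) (w : nat -> bool) (cv : nat -> int).
Local Notation tri := (tri false Z w).
Definition cst (r : nat -> int) := forall x, (x < 23)%N -> r x = cv x.

Lemma cst_frame L r r' : (forall y, y \notin L -> r' y = r y) -> all (leq 23) L ->
  cst r -> cst r'.
Proof.
move=> fr /allP aL C x x23; rewrite fr ?C //; apply/negP => /aL; lia.
Qed.

Lemma cst_upd r x v : (22 < x)%N -> cst r -> cst (upd r x v).
Proof. by move=> x23 C y y23 /=; rewrite (_ : (y == x) = false) ?C //; lia. Qed.

Variables (n : nat) (Q : int) (M2 : nat) (R : nat -> int) (levels base : nat).
Local Notation PM := ((2 * M2)%N%:Z).
Local Notation ones := (pack Q n (fun=> 1)).
Local Notation OFF := (offset n Q).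

Hypotheses (c_n : cv vn = n%:Z) (c_PM : cv vPM = PM) (c_Q : cv vQ = Q)
  (c_QN : cv vQN = Q ^+ n) (c_ones : cv vones = ones) (c_cells : cv vcells = (ncells n)%:Z)
  (c_lev : cv vlev = levels%:Z) (c_tab : cv vtab = base%:Z) (c_OFF : cv vOFF = OFF)
  (c_R0 : cv vR0 = R 0%N).
Hypothesis n0 : (0 < n)%N.
Hypotheses (Q0 : 0 < Q) (PM0 : 0 < PM) (Z0 : (0 < Z)%N).
Hypothesis bndQ : forall v, `|v| <= 8 * OFF * Q -> bounded Z v.
Hypothesis RS : forall l, (l < levels)%N -> R l.+1 = (R l %/ 2)%Z + PM.
Hypothesis RQ : forall l, (l <= levels)%N -> 0 <= R l /\ 8 * (R l + PM) <= Q.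
Hypothesis baseQ : 8 * (base%:Z + (ncells n)%:Z * levels%:Z + (ncells n)%:Z) <= Q.

Lemma cstE r : cst r -> (r vn = n%:Z) * (r vPM = PM) * (r vQ = Q) * (r vQN = Q ^+ n) *
  (r vones = ones) * (r vcells = (ncells n)%:Z) * (r vlev = levels%:Z) *
  (r vtab = base%:Z) * (r vOFF = OFF) * (r vR0 = R 0%N).
Proof. by move=> C; rewrite !C. Qed.

Lemma Q16 : 16 <= Q.
Proof. by have [_] := RQ (leq0n levels); have [] := RQ (leq0n levels); lia. Qed.

Lemma QN_ge : Q <= Q ^+ n.
Proof. by rewrite -{1}(expr1 Q) ler_weXn2l //; have := Q16; lia. Qed.

Lemma OFF_big : 64 * (Q * Q ^+ n) <= OFF.
Proof.
rewrite /offset exprS; have u256 : 256 <= Q * Q ^+ n.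
  by have := QN_ge; have := Q16; move: (Q ^+ n) => q; nia.
by move: (Q * Q ^+ n) u256 => u; nia.
Qed.

Lemma QN_OFF : 1024 * Q ^+ n <= OFF.
Proof.
apply: le_trans OFF_big; have := Q16; have := expQ_gt0 Q0 n.
by move: (Q ^+ n) => q; nia.
Qed.

Lemma bnd_small v : `|v| <= OFF -> bounded Z v.
Proof.
move=> vO; apply: bndQ; have := Q16; have : 0 <= OFF by rewrite mulr_ge0 // ltW // expQ_gt0.
by move: (OFF) vO => o; nia.
Qed.

Lemma bnd_OFF v : `|v| <= 64 * OFF -> bounded Z v.
Proof.
move=> vO; apply: bndQ; have := Q16; have : 0 <= OFF by rewrite mulr_ge0 // ltW // expQ_gt0.
by move: (OFF) vO => o; nia.
Qed.

Lemma OFF_QN : Q * Q ^+ n <= OFF.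
Proof.
have := OFF_big; have := expQ_gt0 Q0 n; move: (Q ^+ n) (OFF) => q o; nia.
Qed.

Lemma bnd_Q v : `|v| <= 8 * Q -> bounded Z v.
Proof.
move=> vQ; apply: bnd_small; have := OFF_QN; have := QN_ge; have := Q16.
by move: (Q ^+ n) (OFF) => q o; nia.
Qed.

Lemma bnd0 : bounded Z 0. Proof. by rewrite /bounded expn_gt0. Qed.
Lemma bnd1 : bounded Z 1.
Proof. by apply: bnd_Q; have := Q16; lia. Qed.

Lemma ones_bound : 0 <= ones <= Q ^+ n.
Proof.
have := Q16 => Q1.
have : 0 <= ones by apply: sumr_ge0 => i _; rewrite mul1r ltW // expQ_gt0.
have : - Q ^+ n < ones < Q ^+ n by apply: (@pack_bound Q Q0 n _ 1); lia.
by move: (ones) (Q ^+ n); lia.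
Qed.

Lemma n_lt : 4 ^+ n <= Q -> (n < 2 ^ Z)%N.
Proof.
move=> Q4; have := @bnd_Q n%:Z; rewrite /bounded /=; apply.
have : (4 ^ n)%N%:Z <= Q by rewrite PoszX.
by have := ltn_expl n (isT : 1 < 4)%N; lia.
Qed.

Lemma t_key r h j Rl Y0 : cst r -> r vR = Rl -> r vY = Y0 -> r vkey = 0 ->
  0 <= Rl -> 8 * Rl <= Q -> (forall j, (j < n)%N -> 0 <= digit Q Y0 j <= 2 * Rl) ->
  `|Y0| <= OFF -> 4 ^+ n <= Q ->
  tri p_key (State r h j) (n * 52 + 11) (fun s' =>
    vars s' vkey = cells_of Q Rl Y0 n /\ vars s' vY = (Y0 %/ Q ^+ n)%Z).
Proof.
move=> C rR rY rk R0 RQl dg Yb Q4; have CE := cstE C.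
have nZ := n_lt Q4.
have Yd i : `|(Y0 %/ Q ^+ i)%Z| <= OFF.
  by apply: le_trans Yb; have := absz_divz_le Y0 (Q ^+ i); lia.
eapply tri_le.
  eapply (tri_for (cnt := n) (I := fun i r1 h1 => r1 vY = (Y0 %/ Q ^+ i)%Z /\
                                    r1 vkey = cells_of Q Rl Y0 i)) => //.
  + by rewrite !CE.
  + by rewrite expr0 divz1.
  + move=> i r1 h1 j1 il ri fr _ _ [r1Y r1k].
    have C1 := cst_frame fr isT C; have CE1 := cstE C1.
    have r1R : r1 vR = Rl by rewrite fr.
    have dgi := dg i il.
    have cb := @cells_of_bound Q Rl Y0 i R0 (fun j jl => dg j (ltn_trans jl il)).
    have cb' := @cells_of_bound Q Rl Y0 i.+1 R0 (fun j jl => dg j (leq_trans jl il)).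
    have e4 : 4 ^+ i.+1 <= 4 ^+ n :> int by rewrite ler_weXn2l.
    eapply tri_asg_seq => /=.
      by rewrite r1Y !CE1 subz_mulz_div -/(digit Q Y0 i); apply: bnd_Q; lia.
    eapply tri_asg_seq => /=.
      by rewrite r1Y !CE1 divX_succ //; apply: bnd_small.
    eapply tri_asg => /=; rewrite r1Y r1R r1k !CE1 subz_mulz_div -/(digit Q Y0 i).
      by apply: bnd_Q; move: cb' => /=; lia.
    by rewrite divX_succ.
  + by move=> r' h' j' _ _ _ [].
by rewrite /=; lia.
Qed.

Variables (B : nat -> nat -> int) (T cr s : nat -> int).
Hypothesis crQ : forall i, (i < n)%N -> 8 * `|cr i| <= Q.
Hypothesis s1 : forall i, (i < n)%N -> 1 <= s i.
Hypothesis Q4 : 4 ^+ n <= Q.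
Local Notation reduced := (reduced n Q R B T cr s).
Local Notation latv := (latv n Q B T cr s).
Local Notation pert := (pert n Q).
Local Notation stored := (stored n Q PM R levels base B T cr s).
Local Notation small := (small n PM).
Local Notation sieve := (sieve n Q R base).
Local Notation slot := (slot n Q R base).

Lemma OFF_gt0 : 0 < OFF. Proof. by rewrite mulr_gt0 // expQ_gt0. Qed.

Lemma pert_bound xv tau : small xv -> 0 <= pert xv tau <= 2 * Q ^+ n.
Proof.
move=> sx; have Q1 := Q16; have [R00 RQ0] := RQ (leq0n levels).
have : - Q ^+ n < pack Q n xv < Q ^+ n.
  by apply: (@pack_bound Q Q0 n _ PM); [lia|move=> i /sx; lia].
have : 0 <= pack Q n xv.
  by apply: sumr_ge0 => i _; rewrite mulr_ge0 ?(ltW (expQ_gt0 _ _)) //; have /andP[] := sx i (ltn_ord i).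
by rewrite /SieveModel.pert; case: tau; move: (pack _ _ _) (Q ^+ n) => a b /=; lia.
Qed.

Lemma reduced_bound l y xv tau : (l <= levels)%N -> small xv -> reduced l y xv tau ->
  8 * `|y| <= 7 * OFF.
Proof.
move=> ll sx [U [k [-> xR tk]]].
have := latv_bound Q0 PM0 RQ crQ s1 ll sx xR tk; have := pert_bound tau sx.
have := QN_OFF.
by move: (pert _ _) (latv _ _) (Q ^+ n) (OFF) => p L q o; lia.
Qed.

Lemma t_level r h j l y xv tau : cst r -> (l < levels)%N ->
  r vl = l%:Z -> r vy = y -> r vx = pert xv tau -> r vR = R l ->
  small xv -> reduced l y xv tau -> stored h ->
  (forall a, bounded Z (h a)) ->
  tri p_level (State r h j) (n * 52 + 200) (fun s' =>
    if 0 < h (slot l y) then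
      [/\ vars s' vy = y - (h (slot l y) - OFF), vars s' vR = R l.+1,
          vars s' valive = r valive & memory s' = h]
    else vars s' valive = 0 /\ memory s' = upd h (slot l y) (y - pert xv tau + OFF)).
Proof.
move=> C ll rl ry rx rR sx red st bh; have CE := cstE C.
have [R00 RQl] := RQ (ltnW ll).
have yb := reduced_bound (ltnW ll) sx red.
have [U [k [Ey xR tk]]] := red.
have [dg top] := reduced_digits Q0 PM0 RQ (ltnW ll) Ey xR tk.
have ob := ones_bound; have Q1 := Q16; have QN := QN_ge.
have [q [qc kq sq]] := slotE base Q0 PM0 RQ (ltnW ll) red.
have Yb : `|y + R l * ones| <= OFF.
  have : 0 <= R l * ones <= Q * Q ^+ n.
    by rewrite mulr_ge0 ?ler_pM //; lia.
  have : 32 * (Q * Q ^+ n) <= OFF.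
    by have := OFF_big; have := expQ_gt0 Q0 n; move: (Q ^+ n) (OFF) => u o; nia.
  by move: (R l * ones) (Q * Q ^+ n) (OFF) yb; lia.
have kE : 2 * cells_of Q (R l) (y + R l * ones) n + (tau%:Z + k) = q%:Z.
  by rewrite -kq /key top.
eapply tri_le.
  eapply tri_asg_seq => /=; first by rewrite ry rR !CE; apply: bnd_small.
  eapply tri_asg_seq => /=; first by (exact: bnd0 || exact: bnd1 || (apply: bnd_Q; lia)).
  eapply tri_call.
    eapply (@t_key _ _ _ (R l) (y + R l * ones)) => //=.
    + by do 2!apply: cst_upd => //.
    + by rewrite ry rR !CE.
    + by lia.
    + by move=> i il; rewrite dg //; have := xR i il; lia.
  move=> r1 h1 j1 /= [k1 Y1] fr /(_ isT) ->.
  have C1 : cst r1 by apply: cst_frame fr isT _; do 2!apply: cst_upd => //.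
  have CE1 := cstE C1.
  have [f1 f2 f3] : [/\ r1 vl = l%:Z, r1 vy = y & r1 vx = pert xv tau] by rewrite !fr.
  have [f4 f5] : r1 vR = R l /\ r1 valive = r valive by rewrite !fr.
  have slE : base%:Z + (ncells n)%:Z * l%:Z + (2 * r1 vkey + (r1 vY %% Q)%Z) = (slot l y)%:Z.
    by rewrite k1 Y1 top kE sq; lia.
  eapply tri_asg_seq => /=.
    rewrite f1 !CE1 subz_mulz_div slE; apply: bnd_Q; rewrite sq.
    have : (ncells n * l <= ncells n * levels)%N by rewrite leq_mul2l (ltnW ll) orbT.
    by move: baseQ; lia.
  rewrite f1 !CE1 subz_mulz_div slE.
  eapply tri_asg_seq => /=; first exact: bh.
  eapply tri_if => /=.
    move=> pos; eapply tri_asg_seq => /=.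
      rewrite f2 !CE1; apply: bnd_OFF.
      have [y' [xv' [tau' [sx' red' _ E]]]] : exists y' xv' tau',
          [/\ small xv', reduced l y' xv' tau', key n Q R l y' = q%:Z &
           h (base + ncells n * l + q)%N = y' - pert xv' tau' + OFF].
        by apply: st; rewrite // -sq.
      rewrite sq E addrK; have := reduced_bound (ltnW ll) sx' red'.
      have := pert_bound tau' sx'; have := QN_OFF.
      have := OFF_gt0; move: (OFF) (Q ^+ n) (pert xv' tau') yb; clear; lia.
    eapply tri_asg => /=.
      by rewrite f4 !CE1; apply: bnd_Q; lia.
    by move=> _; rewrite f2 f4 f5 !CE1 RS // pos.
  move=> neg; eapply tri_le.
    apply: tri_seq; eapply tri_put => /=.
      rewrite f2 f3 !CE1; apply: bnd_OFF; have := pert_bound tau sx.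
      have := QN_OFF.
      have := OFF_gt0; move: (OFF) (Q ^+ n) (pert xv tau) yb; clear; lia.
    eapply tri_asg => /=; first by (exact: bnd0 || exact: bnd1 || (apply: bnd_Q; lia)).
    by move=> _; rewrite (negbTE neg) f2 f3 !CE1.
  by [].
by rewrite /=; lia.
Qed.

Lemma reduced_next h l y xv tau : (l < levels)%N -> stored h -> reduced l y xv tau ->
  0 < h (slot l y) -> reduced l.+1 (y - (h (slot l y) - OFF)) xv tau.
Proof.
move=> ll st red; have [q [qc kq ->]] := slotE base Q0 PM0 RQ (ltnW ll) red => pos.
have [y' [xv' [tau' [sx' red' kq' ->]]]] := st l q ll qc pos.
by rewrite addrK; apply: (reduced_step Q0 PM0 RS RQ ll red red' sx'); rewrite kq kq'.
Qed.

Lemma ncells_gt0 : (0 < ncells n)%N. Proof. by rewrite muln_gt0 expn_gt0. Qed.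

Lemma levels_lt : (levels < 2 ^ Z)%N.
Proof.
have := @bnd_Q levels%:Z; rewrite /bounded /=; apply.
by have := ncells_gt0; move: (ncells n) baseQ => c; nia.
Qed.

Lemma t_levels r h0 j y0 xv tau : cst r ->
  r vy = y0 -> r vx = pert xv tau -> r vR = R 0%N -> r valive = 1 ->
  small xv -> reduced 0 y0 xv tau -> stored h0 -> (forall a, bounded Z (h0 a)) ->
  tri p_levels (State r h0 j) (levels * (n * 52 + 250) + 11) (fun s' =>
    memory s' = (sieve levels 0 h0 y0 (pert xv tau)).1 /\
    if (sieve levels 0 h0 y0 (pert xv tau)).2 is Some y' then
      [/\ vars s' valive = 1, vars s' vy = y' & vars s' vR = R levels]
    else vars s' valive = 0).
Proof.
move=> C ry rx rR ral sx red st bh; have CE := cstE C.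
set x := pert xv tau.
pose I (i : nat) (r1 h1 : nat -> int) :=
  ([/\ r1 valive = 1, h1 = h0,
      sieve levels 0 h0 y0 x = sieve (levels - i) i h0 (r1 vy) x,
      reduced i (r1 vy) xv tau & r1 vR = R i]) \/
  (r1 valive = 0 /\ sieve levels 0 h0 y0 x = (h1, None)).
eapply tri_le.
  eapply (tri_for (cnt := levels) (I := I)) => //.
  + by rewrite !CE.
  + exact: levels_lt.
  + by left; split; rewrite ?subn0 ?ry.
  + move=> i r1 h1 j1 il ri fr _ _ Ii.
    have C1 := cst_frame fr isT C.
    have r1x : r1 vx = x by rewrite fr.
    eapply tri_if => /=.
      case: Ii => [[al -> E redi Ri]|[-> //]] _.
      eapply tri_post.
        by eapply (@t_level r1 h0 _ i (r1 vy) xv tau).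
      move=> r2 h2 j2 /= Q2 fr2 _ k.
      have E1 : (levels - i = (levels - i.+1).+1)%N by lia.
      rewrite E1 /= in E; move: E Q2; case: ifP => [pos|neg] E.
        move=> [e1 e2 e3 e4]; left; split; rewrite ?e1 ?e2 ?e3 ?e4 //.
        exact: reduced_next.
      by move=> [e1 e2]; right; rewrite e1 e2 E.
    case: Ii => [[-> //]|[al E]] _.
    eapply tri_le; first by eapply tri_skip => k /=; right.
    by [].
  + move=> r' h' j' _ _ _ [[al -> E redi Ri]|[al E]] /=.
      by rewrite E subnn.
    by rewrite E.
by rewrite /=; lia.
Qed.

Definition accepted (D E : int) : bool :=
  all (fun j => digit Q (E + D * ones) j <= 2 * D) (iota 0 n).

Lemma t_accept r h j D Y0 : cst r -> r vY = Y0 -> r vok = 1 -> r vD = D ->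
  `|Y0| <= OFF ->
  tri p_accept (State r h j) (n * 70 + 11) (fun s' =>
    vars s' vok = (all (fun j => digit Q Y0 j <= 2 * D) (iota 0 n))%:Z).
Proof.
move=> C rY rok rD Yb; have CE := cstE C.
have Yd i : `|(Y0 %/ Q ^+ i)%Z| <= OFF.
  by apply: le_trans Yb; have := absz_divz_le Y0 (Q ^+ i); lia.
eapply tri_le.
  eapply (tri_for (cnt := n) (I := fun i r1 h1 => r1 vY = (Y0 %/ Q ^+ i)%Z /\
     r1 vok = (all (fun j => digit Q Y0 j <= 2 * D) (iota 0 i))%:Z)) => //.
  + by rewrite !CE.
  + exact: n_lt.
  + by rewrite expr0 divz1.
  + move=> i r1 h1 j1 il ri fr _ _ [r1Y r1k].
    have C1 := cst_frame fr isT C; have CE1 := cstE C1.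
    have r1D : r1 vD = D by rewrite fr.
    have aE P : P 0%N && all P (iota 1 i) = all P (iota 0 i) && P i.
      by rewrite -[LHS]/(all P (iota 0 i.+1)) -addn1 iotaD all_cat /= andbT.
    apply: tri_seq; eapply tri_if => /=; rewrite r1Y r1D !CE1 subz_mulz_div -/(digit Q Y0 i) => pos.
      eapply tri_asg => /=; first by (exact: bnd0 || exact: bnd1 || (apply: bnd_Q; lia)).
      move=> k; eapply tri_asg => /=; first by rewrite r1Y !CE1 divX_succ //; apply: bnd_small.
      rewrite r1Y !CE1 divX_succ // (aE (fun j => digit Q Y0 j <= 2 * D)); split=> //.
      by case: (leP (digit Q Y0 i) (2 * D)) pos => //=; rewrite ?andbF; lia.
    eapply tri_le; first eapply tri_skip => k /=.
      eapply tri_asg => /=; first by rewrite r1Y !CE1 divX_succ //; apply: bnd_small.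
      rewrite r1Y !CE1 divX_succ // (aE (fun j => digit Q Y0 j <= 2 * D)) r1k; split=> //.
      by case: (leP (digit Q Y0 i) (2 * D)) pos => //=; rewrite ?andbT; lia.
    by [].
  + by move=> r' h' j' _ _ _ [].
by rewrite /=; lia.
Qed.

(** For a target coefficient 1 or -1 this normalises it to -1. *)
Definition cand (y x : int) : int := - tcoef n Q PM R levels y x * rawpart n Q PM R levels y x.

Lemma t_check r h j D y xv tau : cst r -> r vy = y -> r vx = pert xv tau ->
  r vR = R levels -> r vD = D -> 0 <= D -> 8 * D <= Q -> small xv ->
  reduced levels y xv tau ->
  tri p_check (State r h j) (n * 70 + 300) (fun s' =>
    if (tcoef n Q PM R levels y (pert xv tau) != 0) && accepted D (cand y (pert xv tau))
    then vars s' vfound = 1 /\ vars s' vbest = cand y (pert xv tau)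
    else vars s' vfound = r vfound /\ vars s' vbest = r vbest).
Proof.
move=> C ry rx rR rD D0 DQ sx red; have CE := cstE C.
have [U [k [Ey xR tk]]] := red; have [R00 RQl] := RQ (leqnn levels).
have [tE rE] := survivorE Q0 PM0 RQ sx Ey xR tk.
set x := pert xv tau in ry rx tE rE *.
have k1 : -1 <= k <= 1 by case: (tau) tk => /=; lia.
have rawb : - Q ^+ n < pack Q n (rawv n B T U k) < Q ^+ n.
  apply: (@pack_bound _ Q0 _ _ (Q %/ 2)%Z); first by have := Q16; lia.
  move=> i il; have b : - (R levels + PM) <= scaledv n B T cr s U k i <= R levels + PM.
    by have := sx i il; have := xR i il; lia.
  have := rawv_bound Q0 PM0 s1 il k1 b; have := crQ il; lia.
have yb := reduced_bound (leqnn levels) sx red; have xb := pert_bound tau sx.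
have ob := ones_bound; have Q1 := Q16; have QN := QN_ge.
have O1 := OFF_big; have O2 := QN_OFF; have e0 := expQ_gt0 Q0 n.
have M1 a : 0 <= a -> a <= Q -> 0 <= a * ones <= Q * Q ^+ n.
  by move=> a0 aQ; rewrite mulr_ge0 ?ler_pM //; lia.
have zb : `|y - x + ((R levels + PM) * ones + Q ^+ n)| <= OFF.
  have := M1 (R levels + PM); rewrite -/x in xb.
  move: ((R levels + PM) * ones) (Q ^+ n) (OFF) (x) (Q * Q ^+ n) xb yb O1 O2 e0 R00 RQl PM0; clear; lia.
have zb' : `|((y - x + ((R levels + PM) * ones + Q ^+ n)) %/ Q ^+ n)%Z| <= OFF.
  by apply: le_trans zb; have := absz_divz_le (y - x + ((R levels + PM) * ones + Q ^+ n)) (Q ^+ n); lia.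
have candE : cand y x = - k * pack Q n (rawv n B T U k) by rewrite /cand tE rE.
have candb : `|cand y x| <= Q ^+ n.
  rewrite candE; have k3 : k = -1 \/ k = 0 \/ k = 1 by move: k1; clear; lia.
  by move: (pack _ _ _) (Q ^+ n) rawb => a b; case: k3 => [->|[->|->]]; clear; lia.
have Yb : `|cand y x + D * ones| <= OFF.
  have := M1 D; move: (D * ones) (cand y x) (Q ^+ n) (OFF) (Q * Q ^+ n) candb O1 O2 D0 DQ; clear; lia.
eapply tri_le.
  eapply tri_asg_seq => /=; first by rewrite ry rx rR !CE; apply: bnd_small.
  eapply tri_asg_seq => /=.
    rewrite ry rx rR !CE subz_mulz_div -/(tcoef n Q PM R levels y x) tE.
    by apply: bnd_Q; move: k1 Q1; clear; lia.
  rewrite ry rx rR !CE subz_mulz_div -/(tcoef n Q PM R levels y x) tE.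
  eapply tri_if => /=.
    move=> kk; have k0 : k != 0 by apply/eqP => k0; rewrite k0 in kk.
    have EE : 0 - k * (((y - x + ((R levels + PM) * ones + Q ^+ n)) %/ Q ^+ n)%Z %/ Q)%Z = cand y x.
      by rewrite -/(rawpart n Q PM R levels y x) candE rE; ring.
    rewrite k0; eapply tri_asg_seq => /=.
      by rewrite !CE EE; apply: bnd_small; move: (cand y x) (Q ^+ n) (OFF) candb O2 e0; clear; lia.
    rewrite !CE EE; eapply tri_asg_seq => /=.
      by rewrite rD !CE; apply: bnd_small.
    eapply tri_asg_seq => /=; first by (exact: bnd0 || exact: bnd1 || (apply: bnd_Q; lia)).
    eapply tri_call.
      eapply (@t_accept _ _ _ D (cand y x + D * ones)) => //=.
      + by do 5!apply: cst_upd => //.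
      + by rewrite rD !CE.
    move=> r1 h1 j1 /= ok fr /(_ isT) ->; rewrite -/(accepted D (cand y x)) in ok.
    eapply tri_if => /=; rewrite ok.
      case: (accepted _ _) => //= _.
      eapply tri_asg_seq => /=; first by (exact: bnd0 || exact: bnd1 || (apply: bnd_Q; lia)).
      eapply tri_asg => /=; rewrite fr //=.
      by apply: bnd_small; move: (cand y x) (Q ^+ n) (OFF) candb O2 e0; clear; lia.
    case: (accepted _ _) => //= _.
    eapply tri_le; first by eapply tri_skip => k2 k3 /=; rewrite !fr.
    by [].
  move=> kk; eapply tri_le; first eapply tri_skip => k2 /=.
    by rewrite (_ : (k != 0) = false) //=; move: kk k1; lia || (move=> kk ?; apply/negbTE/negPn/eqP; nia).
  by [].
by rewrite /=; lia.
Qed.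

Variable col : nat.
Hypothesis c_col : cv vcol = col%:Z.
Definition colv (j : nat) : int :=
  pack Q n (fun i => s i * B i j) + Q ^+ n.+1 * pack Q n (fun i => B i j).
Definition colT : int :=
  pack Q n (fun i => s i * (T i + cr i)) + Q ^+ n + Q ^+ n.+1 * pack Q n T.
Hypotheses (colb : forall j, (j < n)%N -> `|colv j| <= OFF) (colTb : `|colT| <= OFF).
Hypothesis nPM : n%:Z * PM <= Q.
Hypothesis R0big : forall uv (tau : bool) i, small uv -> (i < n)%N ->
  `|scaledv n B T cr s uv (- tau%:Z) i| + PM <= R 0%N.

(** Packing is linear: the program forms a packed lattice vector from packed columns and never
    unpacks a matrix. *)
Lemma latv_cols U k : latv U k = \sum_(j < n) U j * colv j + k * colT.
Proof.
have E1 : pack Q n (rawv n B T U k) =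
    \sum_(j < n) U j * pack Q n (fun i => B i j) + k * pack Q n T.
  rewrite /rawv (packD Q n (fun i => \sum_(j < n) B i j * U j) (fun i => k * T i)) packZ.
  rewrite (pack_sum Q n n (fun i j => B i j * U j)); congr (_ + _); apply: eq_bigr => i _.
  by rewrite -packZ; apply: eq_pack => l _; rewrite mulrC.
have E2 : pack Q n (scaledv n B T cr s U k) =
    \sum_(j < n) U j * pack Q n (fun i => s i * B i j) +
    k * pack Q n (fun i => s i * (T i + cr i)).
  rewrite -packZ (eq_bigr (fun j : 'I_n => pack Q n (fun i => U j * (s i * B i j)))); last first.
    by move=> i _; rewrite packZ.
  rewrite -(pack_sum Q n n (fun i j => U j * (s i * B i j))) -packD.
  apply: eq_pack => i _; rewrite /scaledv /rawv !mulrDr mulr_sumr -!addrA; congr (_ + _).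
    by apply: eq_bigr => j _; ring.
  by ring.
rewrite /SieveModel.latv E1 E2 /colT [in RHS](eq_bigr (fun j : 'I_n =>
  U j * pack Q n (fun i => s i * B i j) + Q ^+ n.+1 * (U j * pack Q n (fun i => B i j)))).
  by rewrite big_split /= -mulr_sumr; ring.
by move=> j _; rewrite /colv; ring.
Qed.

Lemma t_getx r h j p xv : cst r -> r vtp = p%:Z -> r vx = 0 -> r vP = 1 -> small xv ->
  (forall i, (i < n)%N -> h (p + i)%N = xv i) ->
  tri p_getx (State r h j) (n * 52 + 11) (fun s' => vars s' vx = pack Q n xv).
Proof.
move=> C rp rx rP sx hx; have CE := cstE C.
have [R00 RQ0] := RQ (leq0n levels).
have pb i : (i <= n)%N -> `|pack Q i xv| <= Q ^+ n.
  move=> il; have : - Q ^+ i < pack Q i xv < Q ^+ i.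
    apply: (@pack_bound Q Q0 i _ PM); first by lia.
    by move=> k ki; have := sx k (leq_trans ki il); lia.
  have : Q ^+ i <= Q ^+ n by rewrite ler_weXn2l //; have := Q16; lia.
  by move: (pack _ _ _) (Q ^+ i) (Q ^+ n); clear; lia.
eapply tri_le.
  eapply (tri_for (cnt := n) (I := fun i r1 h1 => r1 vx = pack Q i xv /\ r1 vP = Q ^+ i)) => //.
  + by rewrite !CE.
  + exact: n_lt.
  + by rewrite /pack big_ord0.
  + move=> i r1 h1 j1 il ri fr /(_ isT) -> _ [r1x r1P].
    have C1 := cst_frame fr isT C; have CE1 := cstE C1.
    have r1p : r1 vtp = p%:Z by rewrite fr.
    have E : r1 vx + h (absz (r1 vtp + r1 va)) * r1 vP = pack Q i.+1 xv.
      by rewrite r1p ri r1x r1P packSr -hx.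
    eapply tri_asg_seq => /=.
      rewrite E; apply: bnd_small; have := pb i.+1 il; have := QN_OFF; have := expQ_gt0 Q0 n.
      by move: (pack _ _ _) (Q ^+ n) (OFF); clear; lia.
    rewrite E; eapply tri_asg => /=; rewrite r1P !CE1 -exprSr //.
    apply: bnd_small; have : Q ^+ i.+1 <= Q ^+ n by rewrite ler_weXn2l //; have := Q16; lia.
    have := QN_OFF; have := expQ_gt0 Q0 i.+1.
    by move: (Q ^+ i.+1) (Q ^+ n) (OFF); clear; lia.
  + by move=> r' h' j' _ _ _ [].
by rewrite /=; lia.
Qed.

Lemma t_gety r h j p uv y0 : cst r -> r vtp = p%:Z -> r vy = y0 -> small uv ->
  `|y0| <= OFF ->
  (forall i, (i < n)%N -> h (p + i)%N = uv i) ->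
  (forall j, (j < n)%N -> h (col + j)%N = colv j) ->
  tri p_gety (State r h j) (n * 52 + 11) (fun s' =>
    vars s' vy = y0 + \sum_(i < n) uv i * colv i /\
    `|vars s' vy| <= OFF + OFF * Q).
Proof.
move=> C rp ry su y0b hu hc; have CE := cstE C; have O0 := OFF_gt0.
have pb i : (i <= n)%N -> `|y0 + \sum_(j < i) uv j * colv j| <= OFF + i%:Z * PM * OFF.
  elim: i => [|i IH] il; first by rewrite big_ord0 addr0 !mul0r addr0.
  have {}IH := IH (ltnW il).
  have : `|uv i * colv i| <= PM * OFF.
    by rewrite normrM ler_pM //; [have := su i il; lia|exact: colb].
  have -> : i.+1%:Z * PM * OFF = i%:Z * PM * OFF + PM * OFF by rewrite -addn1 PoszD; ring.
  move: IH; rewrite big_ord_recr /= addrA.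
  by move: (y0 + _) (uv i * colv i) (i%:Z * PM * OFF) (PM * OFF) (OFF); clear; lia.
have pb' i : (i <= n)%N -> `|y0 + \sum_(j < i) uv j * colv j| <= OFF + OFF * Q.
  move=> il; apply: le_trans (pb i il) _; rewrite lerD2l mulrC ler_pM2l //.
  by apply: le_trans nPM; rewrite ler_pM2r //; lia.
eapply tri_le.
  eapply (tri_for (cnt := n) (I := fun i r1 h1 => r1 vy = y0 + \sum_(j < i) uv j * colv j)) => //.
  + by rewrite !CE.
  + exact: n_lt.
  + by rewrite big_ord0 addr0.
  + move=> i r1 h1 j1 il ri fr /(_ isT) -> _ r1y.
    have C1 := cst_frame fr isT C; have CE1 := cstE C1.
    have r1p : r1 vtp = p%:Z by rewrite fr.
    have E : r1 vy + h (absz (r1 vtp + r1 va)) * h (absz (r1 vcol + r1 va)) =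
        y0 + \sum_(j < i.+1) uv j * colv j.
      by rewrite r1p ri r1y (C1 vcol) // c_col big_ord_recr /= -hu // -hc // addrA.
    eapply tri_asg => /=; rewrite E //; apply: bndQ.
    apply: le_trans (pb' i.+1 il) _; have := Q16; move: (OFF) O0; clear; nia.
  + by move=> r' h' j' _ _ _ /= ->; split=> //; exact: pb'.
by rewrite /=; lia.
Qed.

Local Notation y_of := (y_of n Q B T cr s).
Local Notation x_of := (x_of n Q).
Local Notation step_table := (step_table Q R levels base B T cr s).
Local Notation H := ((2 * n).+1.-tuple 'I_(2 * M2)).

Definition found_after (D : int) (h : nat -> int) (hs : H) (fe fe' : int * int) : Prop :=
  fe' = if (sieve levels 0 h (y_of hs) (x_of hs)).2 is Some y then
          if (tcoef n Q PM R levels y (x_of hs) != 0) && accepted D (cand y (x_of hs))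
          then (1, cand y (x_of hs)) else fe
        else fe.

Lemma t_sample r h j p (hs : H) D : cst r -> r vtp = p%:Z -> r vD = D ->
  0 <= D -> 8 * D <= Q -> (p + (2 * n).+1)%N%:Z <= Q ->
  (forall i, (i < (2 * n).+1)%N -> h (p + i)%N = (dig hs i)%:Z) ->
  (forall j, (j < n)%N -> h (col + j)%N = colv j) -> h (col + n)%N = colT ->
  stored h -> (forall a, bounded Z (h a)) ->
  tri p_sample (State r h j) (levels * (n * 52 + 250) + n * 200 + 1000) (fun s' =>
    [/\ memory s' = step_table h hs, vars s' vtp = (p + (2 * n).+1)%N%:Z &
      found_after D h hs (r vfound, r vbest) (vars s' vfound, vars s' vbest)]).
Proof.
move=> C rp rD D0 DQ pQ hd hc hT st bh; have CE := cstE C; have Q1 := Q16.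
set xv := xv_of hs; set uv := uv_of n hs; set tau := tau_of hs.
have sx : small xv by apply: small_xv. have su : small uv by apply: small_uv.
have red : reduced 0 (y_of hs) xv tau by apply: reduced_start.
have O0 := OFF_gt0; have O1 := QN_OFF; have e0 := expQ_gt0 Q0 n.
have tE : h (absz (r vtp)) - 2 * (h (absz (r vtp)) %/ 2)%Z = tau%:Z.
  rewrite subz_mulz_div rp /= -[p]addn0 hd // modz_nat modn2 //.
have pp := pert_bound false sx; rewrite /SieveModel.pert mul0r addr0 in pp.
have xE : pack Q n xv + tau%:Z * Q ^+ n = pert xv tau by [].
have xb := pert_bound tau sx.
eapply tri_le.
  eapply tri_asg_seq => /=; first by rewrite tE; apply: bnd_Q; case: (tau) => /=; lia.
  rewrite tE; eapply tri_asg_seq => /=.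
    by rewrite rp; apply: bnd_Q; lia.
  eapply tri_asg_seq => /=; first by (exact: bnd0 || exact: bnd1 || (apply: bnd_Q; lia)).
  eapply tri_asg_seq => /=; first by (exact: bnd0 || exact: bnd1 || (apply: bnd_Q; lia)).
  eapply tri_call.
    eapply (@t_getx _ _ _ p.+1 xv) => //=.
    + by do 4!apply: cst_upd => //.
    + by rewrite rp; lia.
    + by move=> i il; rewrite addSnnS hd //; lia.
  move=> r1 h1 j1 /= x1 fr1 /(_ isT) ->.
  have C1 : cst r1 by apply: cst_frame fr1 isT _; do 4!apply: cst_upd => //.
  have CE1 := cstE C1.
  have [t1 p1] : r1 vtau = tau%:Z /\ r1 vtp = p.+1%:Z by rewrite !fr1 //= rp; split=> //; lia.
  eapply tri_asg_seq => /=.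
    by rewrite p1 !CE1; apply: bnd_Q; lia.
  eapply tri_asg_seq => /=.
    by rewrite x1; apply: bnd_small; move: (pack _ _ _) (Q ^+ n) (OFF) pp O1 e0; clear; lia.
  rewrite x1; eapply tri_call.
    eapply (@t_gety _ _ _ (p.+1 + n) uv (pack Q n xv)) => //=.
    + by do 2!apply: cst_upd => //.
    + by rewrite p1 !CE1; lia.
    + by move: (pack _ _ _) (Q ^+ n) (OFF) pp O1 e0; clear; lia.
    + by move=> i il; rewrite -addnA addSnnS hd //; lia.
  move=> r2 h2 j2 /= [y2 y2b] fr2 /(_ isT) ->.
  have C2 : cst r2 by apply: cst_frame fr2 isT _; do 2!apply: cst_upd => //.
  have CE2 := cstE C2.
  have [t2 p2 x2] : [/\ r2 vtau = tau%:Z, r2 vtp = (p.+1 + n)%N%:Z & r2 vx = pack Q n xv].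
    by rewrite !fr2 //= p1 !CE1; split=> //; lia.
  eapply tri_asg_seq => /=.
    by rewrite p2 !CE2; apply: bnd_Q; lia.
  eapply tri_asg_seq => /=.
    rewrite x2 t2 !CE2 xE; apply: bnd_small.
    by move: (pert _ _) (Q ^+ n) (OFF) xb O1 e0; clear; lia.
  have yE : r2 vy + tau%:Z * (Q ^+ n - colT) = y_of hs.
    rewrite y2 /TrialModel.y_of /TrialModel.x_of latv_cols -/xv -/tau -/uv /SieveModel.pert.
    by rewrite -/(uv_of n hs); ring.
  eapply tri_asg_seq => /=.
    rewrite t2 !CE2 (C2 vcol) // c_col -PoszD /= hT yE.
    by apply: bnd_small; have := reduced_bound (leq0n levels) sx red; move: (y_of hs) (OFF) O0; clear; lia.
  rewrite x2 t2 !CE2 (C2 vcol) // c_col -PoszD /= hT yE xE.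
  eapply tri_asg_seq => /=.
    by rewrite !CE2; apply: bnd_Q; have [] := RQ (leq0n levels); lia.
  eapply tri_asg_seq => /=; first by (exact: bnd0 || exact: bnd1 || (apply: bnd_Q; lia)).
  rewrite !CE2; eapply tri_call.
    by eapply (@t_levels _ _ _ (y_of hs) xv tau) => //=; do 5!apply: cst_upd => //.
  move=> r3 h3 j3 /= [-> Q3] fr3 _.
  have C3 : cst r3 by apply: cst_frame fr3 isT _; do 5!apply: cst_upd => //.
  have [p3 x3 D3] : [/\ r3 vtp = (p + (2 * n).+1)%N%:Z, r3 vx = pert xv tau & r3 vD = D].
    by rewrite !fr3 //= p2 fr2 //= fr1 //=; split=> //; lia.
  have [f3 b3] : r3 vfound = r vfound /\ r3 vbest = r vbest.
    by rewrite !fr3 //= !fr2 //= !fr1 //=.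
  rewrite -f3 -b3 /TrialModel.step_table.
  have [_ redy _] := sieve_of_spec Q0 PM0 RS RQ crQ s1 R0big hs st.
  have xE' : pert xv tau = x_of hs by [].
  rewrite xE' in Q3 x3 *.
  case E : (sieve levels 0 h (y_of hs) (x_of hs)) Q3 redy => [h' [y|]] /= Q3 redy.
    have {Q3} [al y3 R3] := Q3; eapply tri_if => /=; rewrite al // => _.
    eapply tri_post.
      by eapply (@t_check _ _ _ D y xv tau) => //; exact: redy.
    move=> r4 h4 j4 /=; rewrite xE' => q4 fr4 /(_ isT) -> k; split=> //; first by rewrite fr4.
    by rewrite /found_after E /=; move: q4; case: ifP => _ [-> ->].
  eapply tri_if => /=; rewrite Q3 // => _.
  eapply tri_le; first by eapply tri_skip => k /=; split=> //; rewrite /found_after E.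
  by [].
by rewrite /=; lia.
Qed.

(** Soundness: every accepted candidate satisfies this, whatever the coins are. *)
Definition valid (D E : int) := exists U,
  (forall i, (i < n)%N -> `|rawv n B T U (-1) i| <= D) /\ E = pack Q n (rawv n B T U (-1)).

Lemma cand_form y xv tau : small xv -> reduced levels y xv tau ->
  tcoef n Q PM R levels y (pert xv tau) != 0 ->
  exists U, [/\ cand y (pert xv tau) = pack Q n (rawv n B T U (-1)),
    forall i, (i < n)%N -> 4 * `|rawv n B T U (-1) i| <= Q &
    forall i, (i < n)%N -> `|scaledv n B T cr s U (-1) i| <= R levels + PM].
Proof.
move=> sx [U [k [Ey xR tk]]]; have [R00 RQl] := RQ (leqnn levels).
have [tE rE] := survivorE Q0 PM0 RQ sx Ey xR tk; rewrite /cand tE rE => k0.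
have k1 : k = -1 \/ k = 1 by case: (tau) tk k0 => /=; clear; lia.
have rN i : rawv n B T (fun j => - k * U j) (-1) i = - k * rawv n B T U k i.
  rewrite /rawv mulrDr mulr_sumr; congr (_ + _); last by case: k1 => ->; ring.
  by apply: eq_bigr => j _; ring.
have sN i : scaledv n B T cr s (fun j => - k * U j) (-1) i = - k * scaledv n B T cr s U k i.
  by rewrite /scaledv rN; case: k1 => ->; ring.
exists (fun j => - k * U j); split.
- by rewrite -packZ; apply: eq_pack => i _; rewrite rN.
- move=> i il; have b : - (R levels + PM) <= scaledv n B T cr s U k i <= R levels + PM.
    by have := sx i il; have := xR i il; move: (scaledv _ _ _ _ _ _ _ _) (xv i); clear; lia.
  have k2 : -1 <= k <= 1 by case: k1 => ->.
  have := rawv_bound Q0 PM0 s1 il k2 b; have := crQ il; rewrite rN.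
  by move: (rawv _ _ _ _ _ _) (cr i) RQl => u v; case: k1 => ->; clear; lia.
- move=> i il; rewrite sN; have := sx i il; have := xR i il.
  by move: (scaledv _ _ _ _ _ _ _ _) (xv i) => u v; case: k1 => ->; clear; lia.
Qed.

Lemma pack_add_ones v D : pack Q n v + D * ones = pack Q n (fun i => v i + D).
Proof. by rewrite packD -packZ; congr (_ + _); apply: eq_pack => i _; rewrite mulr1. Qed.

Lemma cand_valid y xv tau D : 0 <= D -> 8 * D <= Q -> small xv -> reduced levels y xv tau ->
  tcoef n Q PM R levels y (pert xv tau) != 0 ->
  accepted D (cand y (pert xv tau)) -> valid D (cand y (pert xv tau)).
Proof.
move=> D0 DQ sx red k0 /allP ac; have [U [cE rb _]] := cand_form sx red k0.
exists U; split=> // i il; rewrite cE pack_add_ones in ac.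
have Q1 := Q16.
have := @digits_le_pack Q Q0 n (fun i => rawv n B T U (-1) i + D) D _ _ _ i il.
move=> H; have {H} : 0 <= rawv n B T U (-1) i + D <= 2 * D.
  apply: H; first by move: DQ Q1; clear; lia.
    by move=> k kn; have := rb k kn; move: (rawv _ _ _ _ _ _) DQ D0; clear; lia.
  by move=> k kn; apply: ac; rewrite mem_iota.
by move: (rawv _ _ _ _ _ _); clear; lia.
Qed.

(** Completeness: in such a box every difference short enough to leave the last level of the sieve
    passes the acceptance test. *)
Definition good_box (D : int) := forall U,
  (forall i, (i < n)%N -> `|scaledv n B T cr s U (-1) i| <= R levels + PM) ->
  forall i, (i < n)%N -> `|rawv n B T U (-1) i| <= D.

Lemma cand_good y xv tau D : 0 <= D -> 8 * D <= Q -> good_box D -> small xv ->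
  reduced levels y xv tau -> tcoef n Q PM R levels y (pert xv tau) != 0 ->
  accepted D (cand y (pert xv tau)).
Proof.
move=> D0 DQ gb sx red k0; have [U [cE _ /gb rD]] := cand_form sx red k0.
apply/allP => j; rewrite mem_iota add0n => jn; rewrite cE pack_add_ones.
have -> : pack Q n (fun i => rawv n B T U (-1) i + D) =
  pack Q n (fun i => rawv n B T U (-1) i + D) + Q ^+ n * 0 by rewrite mulr0 addr0.
have dg i : (i < n)%N -> 0 <= rawv n B T U (-1) i + D < Q.
  by move=> il; have := rD i il; have := Q16; move: (rawv _ _ _ _ _ _) DQ; clear; lia.
rewrite digit_pack //; have := rD j jn; move: (rawv _ _ _ _ _ _); clear; lia.
Qed.

Variable N : nat.
Hypotheses (c_ntab : cv vntab = (ncells n * levels)%N%:Z) (c_N : cv vN = N%:Z).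

Lemma t_clear r h j : cst r -> tri p_clear (State r h j) (ncells n * levels * 30 + 11)
  (fun s' => forall a, memory s' a =
     if (base <= a < base + ncells n * levels)%N then 0 else h a).
Proof.
move=> C; have CE := cstE C; have Q1 := Q16.
eapply tri_le.
  eapply (tri_for (cnt := ncells n * levels) (I := fun i r1 h1 => forall a, h1 a =
     if (base <= a < base + i)%N then 0 else h a)) => //.
  + by rewrite C // c_ntab.
  + have := @bnd_Q (ncells n * levels)%N%:Z; rewrite /bounded /=; apply.
    by move: baseQ; rewrite PoszM; lia.
  + by move=> a; rewrite addn0; case: ifP => //; lia.
  + move=> i r1 h1 j1 il ri fr _ _ Ii.
    have C1 := cst_frame fr isT C; have CE1 := cstE C1.
    eapply tri_put => /=; first exact: bnd0.
    move=> a; rewrite ri !CE1 /=; case: eqP => [->|ne]; first by rewrite (_ : (base <= base + i < base + i.+1)%N) //; lia.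
    by rewrite Ii; have -> : (base <= a < base + i.+1)%N = (base <= a < base + i)%N by lia.
by rewrite /=; lia.
Qed.

Local Notation survives := (survives Q R levels base B T cr s).
Local Notation target_seen := (target_seen Q R levels base B T cr s).
Local Notation twins := (wins step_table survives target_seen (fun=> 0)).

Lemma t_trial r h j p (dflt : H) (hs : N.-tuple H) D : cst r -> r vtp = p%:Z -> r vD = D ->
  0 <= D -> 8 * D <= Q -> (p + N * (2 * n).+1 <= base)%N -> (col + n < base)%N ->
  (forall i k, (i < N)%N -> (k < (2 * n).+1)%N ->
     h (p + i * (2 * n).+1 + k)%N = (dig (nth dflt hs i) k)%:Z) ->
  (forall j, (j < n)%N -> h (col + j)%N = colv j) -> h (col + n)%N = colT ->
  (forall a, bounded Z (h a)) ->
  tri p_trial (State r h j)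
    (ncells n * levels * 30 + N * (levels * (n * 52 + 250) + n * 200 + 1100) + 50) (fun s' =>
    [/\ forall a, (a < base)%N -> memory s' a = h a,
        forall a, bounded Z (memory s' a),
        vars s' vtp = (p + N * (2 * n).+1)%N%:Z,
        (vars s' vfound, vars s' vbest) = (r vfound, r vbest) \/
          vars s' vfound = 1 /\ valid D (vars s' vbest) &
        (r vfound = 1 -> vars s' vfound = 1) /\
        (good_box D -> twins hs -> vars s' vfound = 1)]).
Proof.
move=> C rp rD D0 DQ pb cb hd hc hT bh; have Q1 := Q16; have O0 := OFF_gt0.
have NZ : (N < 2 ^ Z)%N.
  by have := @bnd_Q N%:Z; rewrite /bounded /=; apply; move: baseQ pb; lia.
eapply tri_le.
  eapply tri_call; first exact: t_clear.
  move=> r0 h0 j0 /= h0E fr0 _.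
  have C0 : cst r0 := cst_frame fr0 isT C.
  have [rp0 rD0] : r0 vtp = p%:Z /\ r0 vD = D by rewrite !fr0.
  have [rf0 rb0] : r0 vfound = r vfound /\ r0 vbest = r vbest by rewrite !fr0.
  have st0 : stored h0.
    move=> l q ll qc; rewrite h0E (_ : (base <= _ < _)%N) //.
    by move: ll qc; nia.
  have stz : stored (fun=> 0) by move=> l q ll qc; rewrite ltxx.
  (* The table of the model, started from zero memory. The invariant keeps it equal to the program's
     table on the table addresses, so that [twins] speaks about the actual run. *)
  pose tb i := foldl step_table (fun=> 0) (take i hs).
  pose I (i : nat) (r1 h1 : nat -> int) := [/\ r1 vtp = (p + i * (2 * n).+1)%N%:Z,
     (forall a, (a < base)%N -> h1 a = h a) /\ (forall a, bounded Z (h1 a)),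
     [/\ stored h1, stored (tb i) & agree_table n levels base (tb i) h1],
     (r1 vfound, r1 vbest) = (r vfound, r vbest) \/ r1 vfound = 1 /\ valid D (r1 vbest) &
     (r vfound = 1 -> r1 vfound = 1) /\ (good_box D -> twins (take i hs) -> r1 vfound = 1)].
  eapply (tri_for (cnt := N) (I := I)) => //.
  + by rewrite C0 // c_N.
  + rewrite /I /tb take0 /= mul0n addn0; split=> //.
    * split=> a; first by move=> ab; rewrite h0E (_ : (base <= a < _)%N = false) //; lia.
      by rewrite h0E; case: ifP => // _; exact: bnd0.
    * split=> // a ab; by rewrite h0E ab.
    * by left; rewrite rf0 rb0.
    * by rewrite rf0.
  + move=> i r1 h1 j1 il ri fr _ _ [I1 [I2 I2'] [I3 I3' I3''] I4 [I5 I6]].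
    have C1 := cst_frame fr isT C0.
    have r1D : r1 vD = D by rewrite fr.
    pose hi : H := nth dflt hs i.
    have pi : (p + i * (2 * n).+1 + (2 * n).+1 <= base)%N by move: pb il; nia.
    eapply tri_post.
      eapply (@t_sample r1 h1 _ (p + i * (2 * n).+1) hi D) => //.
      * by move: baseQ pi; lia.
      * by move=> k kn; rewrite I2 ?hd //; lia.
      * by move=> k kn; rewrite I2 ?hc //; lia.
      * by rewrite I2.
    move=> r2 h2 j2 /= [m2 p2 fa] fr2 _.
    have tS : take i.+1 hs = rcons (take i hs) hi by rewrite (take_nth dflt) // size_tuple.
    have [S1 S2 S3] := sieve_of_spec Q0 PM0 RS RQ crQ s1 R0big hi I3.
    have [T1 T2 _] := sieve_of_spec Q0 PM0 RS RQ crQ s1 R0big hi I3'.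
    have [A1 A2] := sieve_agree Q0 PM0 RS RQ I3' I3'' (small_xv hi) (reduced_start Q R0big hi) (add0n levels).
    rewrite -!/(x_of hi) in A1 A2.
    have faE : (r2 vfound, r2 vbest) = (r1 vfound, r1 vbest) \/
        r2 vfound = 1 /\ valid D (r2 vbest).
      move: fa; rewrite /found_after; case E : (sieve _ _ _ _ _).2 => [y|]; last by left.
      case: ifP => [/andP[k0 ac]|_]; last by left.
      case=> -> ->; right; split=> //; apply: cand_valid ac => //; first exact: small_xv.
      exact: S2.
    split.
    * by rewrite p2; congr Posz; rewrite mulSn; lia.
    * rewrite m2; have : survives h1 hi \/ ~~ survives h1 hi by case: (survives _ _); [left|right].
      case=> [sv|/S3[a [v [ab _ v0 vO ->]]]].
        suff -> : step_table h1 hi = h1 by [].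
        move: sv; rewrite /TrialModel.survives /TrialModel.step_table; case E : (sieve _ _ _ _ _) => [t [y|]] //= _.
        by have [] := sieve_shift Q0 0 0 E.
      split=> b /=; first by case: eqP => [->|_ /I2 //]; move: ab; lia.
      case: eqP => [_|_]; last exact: I2'.
      by apply: bnd_OFF; move: (OFF) v v0 vO O0; clear; lia.
    * rewrite m2 /tb tS foldl_rcons; split=> //; exact: A2.
    * by case: faE => [[e1 e2]|v]; [rewrite e1 e2|right].
    * have mon : r1 vfound = 1 -> r2 vfound = 1 by case: faE => [[-> _]|[-> _]].
      split=> [/I5/mon //|gb]; rewrite tS wins_rcons => /orP[/(I6 gb)/mon //|/andP[]].
      rewrite -/(tb i) /TrialModel.survives /TrialModel.target_seen.
      case E : (sieve levels 0 (tb i) (y_of hi) (x_of hi)).2 => [y|] // _ k0.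
      move: fa; rewrite /found_after -A1 E k0 /= (cand_good D0 DQ gb (small_xv hi) (T2 _ E) k0).
      by case.
  + by move=> r' h' j' _ _ _ [J1 [J2 J2'] _ J4 [J5 J6]] /=; split=> //; split=> // gb; rewrite -{1}(take_oversize (n := N) (s := hs)) ?size_tuple //; exact: J6.
by rewrite /=; lia.
Qed.

End Inner.

End TrialProgram.
Import TrialProgram.

(** * The parameters and the size of all numbers *)

Module Magnitudes.
Local Open Scope ring_scope.

Fixpoint radius (PM : int) (l : nat) : int :=
  if l is l'.+1 then (radius PM l' %/ 2)%Z + PM else PM ^+ 4.

Section Params.
Variables (n e wd : nat) (num den : nat -> int).

(** The product clears the denominators; the factor 128 2^e makes every scaled distance a multiple
    of it, which fits the resolution of the integer search. *)
Definition Gz : int := 128 * (2 ^ e)%N%:Z * \prod_(a < n * n + n) den a.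
Definition entry (a : nat) : int := num a * (Gz %/ den a)%Z.
Definition Bz (i j : nat) : int := entry (i * n + j).
Definition Tz (i : nat) : int := entry (n * n + i).
Definition mz : nat := 5 * wd * n.
Definition M2z : nat := 2 ^ mz.-1.
Definition PMz : int := (2 * M2z)%N%:Z.
Definition Qz : int := PMz ^+ 6.
(** As 2^(3m) = PM^3, this number of halvings brings the initial radius PM^4 down to the order of
    PM. *)
Definition levelsz : nat := 3 * mz.
(** This is 2 D C in [card_wins], with D = 4^n for the flippable fraction and C the size of the
    table. In [repsz] the factor 4 4^n is the inverse of the resulting success probability. *)
Definition Nz : nat := 2 * 4 ^ n * (ncells n * levelsz).
Definition repsz : nat := 4 * 4 ^ n * (wd + n).
Definition colz : nat := 2 * (n * n + n) + 1.
Definition tapez : nat := colz + n + 1.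
Definition lenz : nat := repsz * Nz * (2 * n).+1.
Definition tabz : nat := tapez + lenz.
Definition MBz : nat := (128 * e.+1) ^ n.
(** 2^Zz = Q^(2n+4), two powers of Q more than [offset]. *)
Definition Zz : nat := 6 * mz * (2 * n + 4).
Definition Rz : nat -> int := radius PMz.
Definition cvz (x : nat) : int := nth 0 [:: n%:Z; Gz; wd%:Z; (2 ^ wd)%N%:Z; mz%:Z; PMz; Qz;
  Qz ^+ n; pack Qz n (fun=> 1); (ncells n)%:Z; MBz%:Z; levelsz%:Z; Nz%:Z; repsz%:Z;
  colz%:Z; tapez%:Z; tabz%:Z; offset n Qz; (ncells n * levelsz)%N%:Z; Rz 0; Qz ^+ n.+1;
  lenz%:Z; (4 ^ n)%N%:Z] x.

Hypotheses (n0 : (0 < n)%N) (wd9 : (9 <= wd)%N) (nw : (n < 2 ^ wd)%N)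
  (ew : (128 * 2 ^ e <= 2 ^ wd)%N).
Hypothesis entryb : forall a, (a < n * n + n)%N -> `|entry a| < (2 ^ wd)%N%:Z.

(** The unit of all estimates: PM = X^5, the initial radius is X^20 and Q = X^30. The exponent 5
    leaves room for the coefficients of a near lattice vector, which are bounded by X^3. *)
Definition Xn : nat := 2 ^ (wd * n).
Local Notation X := (Xn%:Z).

Lemma X512 : (512 <= Xn)%N.
Proof. by rewrite -[512%N]/(2 ^ 9)%N leq_exp2l //; move: n0 wd9; nia. Qed.

Lemma PW_X : (2 ^ wd <= Xn)%N. Proof. by rewrite leq_exp2l // leq_pmulr. Qed.

Lemma wd_X : (wd < Xn)%N. Proof. by apply: leq_trans PW_X; exact: ltn_expl. Qed.
Lemma n_X : (n < Xn)%N. Proof. exact: leq_trans nw PW_X. Qed.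

Lemma F4_X : (4 ^ n <= Xn)%N.
Proof. by rewrite -[4%N]/(2 ^ 2)%N -expnM leq_exp2l // leq_mul2r; apply/orP; right; lia. Qed.

Lemma MB_X : (MBz <= Xn)%N.
Proof.
rewrite /MBz /Xn expnM leq_exp2r //; apply: leq_trans ew.
by rewrite leq_mul2l /=; exact: ltn_expl.
Qed.

Lemma mz_gt0 : (0 < mz)%N. Proof. by rewrite /mz; move: n0 wd9; nia. Qed.

Lemma PM_nat : (2 * M2z)%N = (2 ^ mz)%N.
Proof. by rewrite /M2z -expnS prednK // mz_gt0. Qed.

Lemma PM_X : PMz = X ^+ 5.
Proof. by rewrite /PMz PM_nat /mz /Xn -PoszX -expnM; congr (Posz (_ ^ _)); ring. Qed.

Lemma Q_X : Qz = X ^+ 30. Proof. by rewrite /Qz PM_X -exprM. Qed.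

Lemma X_gt0 k : 0 < X ^+ k. Proof. by rewrite exprn_gt0 //; have := X512; lia. Qed.

(** Constants are absorbed into powers of X, since X is at least 512; this is where the bound 9 on
    [wd] comes from. *)
Lemma monoX c i k j : c <= 512 ^+ k -> (i + k <= j)%N -> c * X ^+ i <= X ^+ j.
Proof.
move=> ck ij; apply: (@le_trans _ _ (X ^+ k * X ^+ i)).
  rewrite ler_pM2r ?X_gt0 //; apply: le_trans ck _; rewrite lerXn2r // ?nnegrE //; have := X512; lia.
by rewrite -exprD ler_weXn2l //; [have := X512; lia|rewrite addnC].
Qed.

Lemma Qz_gt0 : 0 < Qz. Proof. by rewrite Q_X X_gt0. Qed.
Lemma PMz_gt0 : 0 < PMz. Proof. by rewrite PM_X X_gt0. Qed.

Lemma Rz_bound l : 0 <= Rz l <= PMz ^+ 4.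
Proof.
have P4 : 0 <= PMz ^+ 4 by apply/ltW/exprn_gt0/PMz_gt0.
rewrite /Rz; elim: l => [|l IH]; first by rewrite -[radius PMz 0]/(PMz ^+ 4) P4 lexx.
rewrite -[radius PMz l.+1]/((radius PMz l %/ 2)%Z + PMz).
have : 2 * PMz <= PMz ^+ 4 by rewrite PM_X -exprM; apply: (@monoX 2 5 1).
by have := PMz_gt0; move: (radius PMz l) PMz (PMz ^+ 4) IH; clear; lia.
Qed.

Lemma RSz l : (l < levelsz)%N -> Rz l.+1 = (Rz l %/ 2)%Z + PMz. Proof. by []. Qed.

Lemma RQz l : (l <= levelsz)%N -> 0 <= Rz l /\ 8 * (Rz l + PMz) <= Qz.
Proof.
move=> _; have /andP[R0 RP] := Rz_bound l; split=> //.
have : 16 * PMz ^+ 4 <= Qz by rewrite Q_X PM_X -exprM; apply: (@monoX 16 20 1).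
have : PMz <= PMz ^+ 4.
  by rewrite -{1}(expr1 PMz) ler_weXn2l //; have := PMz_gt0; clear; lia.
by move: (Rz l) (PMz ^+ 4) PMz Qz RP; clear; lia.
Qed.

(* Each level halves the distance to the fixed point 2 PM of R -> R/2 + PM. *)
Lemma Rz_last : Rz levelsz <= 3 * PMz.
Proof.
have H l : Rz l * 2 ^+ l <= PMz ^+ 4 + 2 * PMz * 2 ^+ l.
  rewrite /Rz; elim: l => [|l IH].
    by rewrite -[radius PMz 0]/(PMz ^+ 4) expr0 !mulr1 lerDl mulr_ge0 // ltW // PMz_gt0.
  rewrite -[radius PMz l.+1]/((radius PMz l %/ 2)%Z + PMz).
  have e0 : 0 < 2 ^+ l :> int by rewrite exprn_gt0.
  rewrite [2 ^+ l.+1]exprS; move: (PMz ^+ 4) (2 ^+ l : int) IH e0 => Y E IH e0.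
  move: (radius PMz l) PMz IH => R P IH.
  have : 2 * (R %/ 2)%Z <= R by clear; lia.
  by move: (R %/ 2)%Z => R2; nia.
have := H levelsz; have E : 2 ^+ levelsz = PMz ^+ 3 :> int.
  by rewrite /levelsz mulnC exprM /PMz PM_nat PoszX.
rewrite E; have -> : PMz ^+ 4 + 2 * PMz * PMz ^+ 3 = 3 * PMz * PMz ^+ 3 by ring.
by rewrite ler_pM2r // exprn_gt0 // PMz_gt0.
Qed.

Lemma baseQz : 8 * (tabz%:Z + (ncells n)%:Z * levelsz%:Z + (ncells n)%:Z) <= Qz.
Proof.
have F := F4_X; have x512 := X512; have nX := n_X; have wX := wd_X.
have lv : (levelsz <= 15 * Xn * Xn)%N by rewrite /levelsz /mz; move: wX nX; nia.
have nc : (ncells n <= 2 * Xn)%N by rewrite /ncells leq_mul2l.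
have nl : (ncells n * levelsz <= 30 * Xn ^ 3)%N.
  by apply: leq_trans (leq_mul nc lv) _; rewrite !expnS expn0; lia.
have Nb : (Nz <= 60 * Xn ^ 4)%N.
  apply: (@leq_trans (2 * Xn * (30 * Xn ^ 3))); last by rewrite !expnS; lia.
  by rewrite /Nz leq_mul // leq_mul2l.
have rb : (repsz <= 8 * Xn ^ 2)%N.
  apply: (@leq_trans (4 * Xn * (2 * Xn))); last by rewrite !expnS expn0; lia.
  by rewrite /repsz leq_mul // ?leq_mul2l //; lia.
have lb : (lenz <= 1440 * Xn ^ 7)%N.
  apply: (@leq_trans (8 * Xn ^ 2 * (60 * Xn ^ 4) * (3 * Xn))).
    by rewrite /lenz; apply: leq_mul; [exact: leq_mul rb Nb|move: nX; clear; lia].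
  by rewrite !expnS expn0; lia.
have cb : (tapez <= 7 * Xn ^ 2)%N.
  by rewrite /tapez /colz !expnS expn0; move: nX; nia.
have tot : (8 * (tabz + ncells n * levelsz + ncells n) <= 100 * 120 * Xn ^ 7)%N.
  have e2 : (Xn ^ 2 <= Xn ^ 7)%N by rewrite leq_exp2l //; lia.
  have e3 : (Xn ^ 3 <= Xn ^ 7)%N by rewrite leq_exp2l //; lia.
  have e1 : (Xn <= Xn ^ 7)%N by rewrite -{1}(expn1 Xn) leq_exp2l //; lia.
  rewrite /tabz; move: lb cb nl nc e1 e2 e3; clear.
  move: (Xn ^ 2)%N (Xn ^ 3)%N (Xn ^ 7)%N (ncells n * levelsz)%N => *; lia.
have {}tot : (8 * (tabz + ncells n * levelsz + ncells n) <= Xn ^ 9)%N.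
  apply: leq_trans tot _; rewrite [(Xn ^ 9)%N]expnS [(Xn ^ 8)%N]expnS mulnA.
  by rewrite !leq_mul //; move: x512; clear; lia.
rewrite Q_X; apply: (@le_trans _ _ (1 * X ^+ 9)); last exact: (@monoX 1 9 0).
by rewrite mul1r -PoszX; move: tot; rewrite -lez_nat PoszM PoszD PoszD PoszM.
Qed.

Lemma Q4z : 4 ^+ n <= Qz.
Proof.
rewrite Q_X; apply: (@le_trans _ _ (1 * X ^+ 1)); last exact: (@monoX 1 1 0).
by rewrite mul1r expr1 -PoszX; exact: F4_X.
Qed.

Lemma nPMz : n%:Z * PMz <= Qz.
Proof.
rewrite Q_X; apply: (@le_trans _ _ (1 * X ^+ 6)); last exact: (@monoX 1 6 0).
rewrite mul1r exprS PM_X ler_pM2r ?X_gt0 //; exact: ltnW n_X.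
Qed.

Lemma bndQz v : `|v| <= 8 * offset n Qz * Qz -> bounded Zz v.
Proof.
move=> vb; rewrite /bounded; have E : (2 ^ Zz)%N%:Z = offset n Qz * Qz * Qz.
  have QE : Qz = 2 ^+ (6 * mz) by rewrite /Qz /PMz PM_nat PoszX -exprM mulnC.
  by rewrite PoszX /offset QE -!exprM -!exprD; congr (_ ^+ _); rewrite /Zz; ring.
have Q1 : 16 <= Qz by rewrite Q_X; apply: (@monoX 16 0 1).
have O0 : 0 < offset n Qz * Qz.
  by rewrite /offset; apply: mulr_gt0; [apply: mulr_gt0; exact: expQ_gt0 Qz_gt0 _|exact: Qz_gt0].
have : `|v| < offset n Qz * Qz * Qz.
  apply: le_lt_trans vb _; rewrite -mulrA; move: (offset n Qz * Qz) Qz O0 Q1; clear; nia.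
by rewrite -E; move: (2 ^ Zz)%N; clear; lia.
Qed.

Lemma offset_ge : X ^+ 30 <= offset n Qz /\ Qz ^+ n <= offset n Qz /\ 0 < offset n Qz.
Proof.
have Q1 : 1 <= Qz by have := Qz_gt0; clear; lia.
rewrite -Q_X /offset -exprD -{1}(expr1 Qz); split; [|split].
- by rewrite ler_weXn2l.
- by rewrite ler_weXn2l //; lia.
- exact: expQ_gt0 Qz_gt0 _.
Qed.

Lemma bnd_offset v : `|v| <= 4 * offset n Qz -> bounded Zz v.
Proof.
move=> vb; apply: bndQz; apply: le_trans vb _; have [_ [_ o0]] := offset_ge.
have := Qz_gt0; move: (offset n Qz) Qz o0; clear; nia.
Qed.

Lemma bnd_X v k : (k <= 30)%N -> `|v| <= X ^+ k -> bounded Zz v.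
Proof.
move=> k30 vb; apply: bnd_offset; have [o1 [_ o0]] := offset_ge.
have : X ^+ k <= X ^+ 30 by rewrite ler_weXn2l //; have := X512; clear; lia.
by move: (X ^+ k) (X ^+ 30) (offset n Qz) vb o1 o0; clear; lia.
Qed.

Section Box.
Variables (r : int) (beta : nat).
Hypothesis r1 : 1 <= r < (2 ^ wd)%N%:Z.

Definition box_idx (i : nat) : nat := (beta %/ (128 * e.+1) ^ i) %% (128 * e.+1).
Definition boxh (i : nat) : int := box_h e (box_idx i).
Definition crz (i : nat) : int := box_c e (box_idx i) * r.
(** Stretches the half width h r of the box in this coordinate to at most PM/2, the largest shift
    that a random digit tolerates. *)
Definition sz (i : nat) : int := (PMz %/ (2 * boxh i * r))%Z.

Lemma box_idx_lt i : (box_idx i < 128 * e.+1)%N. Proof. by rewrite ltn_pmod. Qed.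

Lemma boxh_bound i : 1 <= boxh i <= 2 ^+ e.
Proof.
rewrite /boxh /box_h exprn_ege1 //= ler_weXn2l //; exact: leq_subr.
Qed.

Lemma PW_bounds : 128 * 2 ^+ e <= (2 ^ wd)%N%:Z /\ (2 ^ wd)%N%:Z <= X.
Proof.
have E : 2 ^+ e = (2 ^ e)%N%:Z by rewrite PoszX.
split; last by rewrite lez_nat; exact: PW_X.
by rewrite E; move: ew; rewrite -lez_nat PoszM.
Qed.

Lemma crz_bound i : `|crz i| <= X ^+ 2.
Proof.
rewrite /crz /box_c -/(boxh i); have /andP[h1 h2] := boxh_bound i; have [P1 P2] := PW_bounds.
have q64 : (box_idx i %/ 2 %% 64 < 64)%N by rewrite ltn_pmod.
have m2 : (box_idx i %% 2 < 2)%N by rewrite ltn_pmod.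
move: (_ %% 64)%N (_ %% 2)%N (boxh i) (2 ^+ e) q64 m2 h1 h2 P1 => q t h E q64 m2 h1 h2 P1.
have cb : `|(1 - 2 * t%:Z) * (64 * E - 64 * h + q%:Z * h)| <= X.
  have qh : 0 <= q%:Z * h <= 63 * h by nia.
  by have [->|->] : t = 0%N \/ t = 1%N; [lia|lia|lia].
rewrite normrM expr2 ler_pM //; move: r1 P2; lia.
Qed.

Lemma sz_bound i : 1 <= sz i <= PMz.
Proof.
have /andP[h1 h2] := boxh_bound i; have [P1 P2] := PW_bounds.
have hr : 1 <= 2 * boxh i * r <= X ^+ 2.
  have : 2 * boxh i <= X by lia.
  by rewrite expr2 => hX; apply/andP; split; [nia|apply: ler_pM; lia].
have XP : X ^+ 2 <= PMz by rewrite PM_X ler_weXn2l //; have := X512; lia.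
rewrite /sz; move: (2 * boxh i * r) (X ^+ 2) PMz hr XP => d Y P hr XP.
have d0 : d != 0 by lia.
have := divz_eq P d; have := modz_ge0 P d0; have := ltz_mod P d0.
by move: (P %/ d)%Z (P %% d)%Z => q m; nia.
Qed.

Lemma Bz_bound i j : (i < n)%N -> (j < n)%N -> `|Bz i j| <= X.
Proof.
move=> il jl; have : (i * n + j < n * n + n)%N by nia.
by move=> /entryb; have := PW_X; rewrite /Bz; move: (entry _) => z; clear; lia.
Qed.

Lemma Tz_bound i : (i < n)%N -> `|Tz i| <= X.
Proof.
move=> il; have : (n * n + i < n * n + n)%N by lia.
by move=> /entryb; have := PW_X; rewrite /Tz; move: (entry _) => z; clear; lia.
Qed.

Lemma crQz i : (i < n)%N -> 8 * `|crz i| <= Qz.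
Proof.
move=> _; rewrite Q_X; apply: le_trans (@monoX 8 2 1 30 _ _) => //.
by have := crz_bound i; clear; lia.
Qed.

Lemma s1z i : (i < n)%N -> 1 <= sz i. Proof. by have /andP[] := sz_bound i. Qed.

Lemma R0bigz uv (tau : bool) i : small n PMz uv -> (i < n)%N ->
  `|scaledv n Bz Tz crz sz uv (- tau%:Z) i| + PMz <= Rz 0.
Proof.
move=> su il; rewrite -[Rz 0]/(PMz ^+ 4); have cb := crz_bound i; have Tb := Tz_bound il.
have /andP[s0 sP] := sz_bound i.
have Sb : `|\sum_(j < n) Bz i j * uv j| <= X * (X * PMz).
  apply: (@le_trans _ _ (\sum_(j < n) X * PMz)).
    apply: le_trans (ler_norm_sum _ _ _) _; apply: ler_sum => j _.
    by rewrite normrM ler_pM // ?Bz_bound //; have := su j (ltn_ord j); lia.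
  rewrite sumr_const card_ord -mulr_natl ler_pM2r; last by rewrite mulr_gt0 ?PMz_gt0 //; have := X512; lia.
  by have := n_X; rewrite natz; lia.
have raw : `|rawv n Bz Tz uv (- tau%:Z) i + - tau%:Z * crz i| <= 4 * X ^+ 7.
  have X7 : X * (X * PMz) = X ^+ 7 by rewrite PM_X; ring.
  have X17 : X <= X ^+ 7 by rewrite -{1}(expr1 X) ler_weXn2l //; have := X512; lia.
  have X27 : X ^+ 2 <= X ^+ 7 by rewrite ler_weXn2l //; have := X512; lia.
  rewrite /rawv; move: (\sum_j _) (Tz i) (crz i) Sb Tb cb => S t c; rewrite X7.
  move: (X ^+ 7) (X ^+ 2) X X17 X27 => x7 x2 x; case: tau => /=; clear; lia.
rewrite /scaledv normrM; apply: (@le_trans _ _ (PMz * (4 * X ^+ 7) + PMz)).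
  rewrite lerD2r ler_pM //; lia.
rewrite PM_X -exprM; have -> : X ^+ 5 * (4 * X ^+ 7) + X ^+ 5 = 4 * X ^+ 12 + X ^+ 5 by ring.
have : 8 * X ^+ 12 <= X ^+ 20 by apply: (@monoX 8 12 1).
have : X ^+ 5 <= X ^+ 12 by rewrite ler_weXn2l //; have := X512; lia.
by have := X_gt0 12; rewrite (_ : (5 * 4)%N = 20%N) //; move: (X ^+ 5) (X ^+ 12) (X ^+ 20); clear; lia.
Qed.

Lemma col_bound k (f g : nat -> int) c : (k <= n)%N -> 0 <= c <= 1 ->
  (forall i, (i < n)%N -> `|f i| <= 2 * X ^+ 8) -> (forall i, (i < n)%N -> `|g i| <= X) ->
  `|pack Qz k f + c * Qz ^+ n + Qz ^+ n.+1 * pack Qz k g| <= offset n Qz.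
Proof.
move=> kn c1 fb gb; have Q0 := Qz_gt0.
have Q8 : 16 * X ^+ 8 <= Qz by rewrite Q_X; apply: (@monoX 16 8 1).
have X8 : X <= X ^+ 8 by rewrite -{1}(expr1 X) ler_weXn2l //; have := X512; lia.
have X0 := X_gt0 8.
have fp : - Qz ^+ k < pack Qz k f < Qz ^+ k.
  apply: (@pack_bound _ Q0 _ _ (2 * X ^+ 8)); first by move: (X ^+ 8) Qz Q8 X0; clear; lia.
  by move=> i ik; have := fb i (leq_trans ik kn); move: (f i) (X ^+ 8); clear; lia.
have gp : - Qz ^+ k < pack Qz k g < Qz ^+ k.
  apply: (@pack_bound _ Q0 _ _ X); first by move: (X ^+ 8) Qz Q8 X0 X8; clear; lia.
  by move=> i ik; have := gb i (leq_trans ik kn); move: (g i); clear; lia.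
have kk : Qz ^+ k <= Qz ^+ n by rewrite ler_weXn2l //; move: Q0; clear; lia.
rewrite /offset exprS; have e0 := expQ_gt0 Q0 n.
have Q16 : 16 <= Qz by move: (X ^+ 8) Qz Q8 X0; clear; lia.
move: Qz (Qz ^+ k) (Qz ^+ n) (pack _ _ f) (pack _ _ g) fp gp kk e0 Q16 => Q0' qk q a b fp gp kk e0 Q16.
have b1 : `|Q0' * q * b| <= Q0' * q * q.
  by rewrite normrM ger0_norm ?mulr_ge0 ?ler_pM2l ?mulr_gt0 //; lia.
have c2 : 0 <= c * q <= q by nia.
have : 16 * q <= Q0' * q by nia.
have c3 : 16 * (Q0' * q * q) <= Q0' * q * (Q0' * q).
  have -> : Q0' * q * (Q0' * q) = Q0' * (Q0' * q * q) by ring.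
  by rewrite ler_pM2r // !mulr_gt0 //; lia.
move: c3.
move: (Q0' * q * b) (Q0' * q * (Q0' * q)) (c * q) b1 c2 => A D C.
have : Q0' * q <= Q0' * q * q by nia.
move: (Q0' * q * q) (Q0' * q) => u v; move: fp kk; clear; lia.
Qed.

Lemma colvz_bound j : (j < n)%N -> `|colv n Qz Bz sz j| <= offset n Qz.
Proof.
move=> jn; have := @col_bound n (fun i => sz i * Bz i j) (fun i => Bz i j) 0 (leqnn n).
rewrite mul0r addr0; apply=> // i il; last exact: Bz_bound.
rewrite normrM; have /andP[s0 sP] := sz_bound i.
apply: (@le_trans _ _ (PMz * X)); first by apply: ler_pM; rewrite ?Bz_bound //; lia.
rewrite PM_X -exprSr; have : X ^+ 6 <= X ^+ 8 by rewrite ler_weXn2l //; have := X512; lia.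
by have := X_gt0 6; move: (X ^+ 6) (X ^+ 8); clear; lia.
Qed.

Lemma tgt_bound i : (i < n)%N -> `|sz i * (Tz i + crz i)| <= 2 * X ^+ 8.
Proof.
move=> il; rewrite normrM; have /andP[s0 sP] := sz_bound i.
apply: (@le_trans _ _ (PMz * (2 * X ^+ 2))).
  apply: ler_pM => //; first lia; have := crz_bound i; have := Tz_bound il.
  have : X <= X ^+ 2 by rewrite -{1}(expr1 X) ler_weXn2l //; have := X512; lia.
  by move: (X ^+ 2) (Tz i) (crz i); clear; lia.
rewrite PM_X mulrCA -exprD; have : X ^+ (5 + 2) <= X ^+ 8 by rewrite ler_weXn2l //; have := X512; lia.
by move: (X ^+ (5 + 2)) (X ^+ 8); clear; lia.
Qed.

Lemma colTz_bound : `|colT n Qz Tz crz sz| <= offset n Qz.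
Proof.
rewrite /colT; have := @col_bound n (fun i => sz i * (Tz i + crz i)) Tz 1 (leqnn n).
by rewrite mul1r; apply=> // i il; [exact: tgt_bound|exact: Tz_bound].
Qed.

End Box.
End Params.

End Magnitudes.
Import Magnitudes.

(** * Verification of the packed columns for one box *)

Module BoxProgram.
Local Open Scope ring_scope.

Lemma scale_bound (q c : int) (n i : nat) : 0 < q -> (i < n)%N -> 0 <= c <= q ->
  `|(c + q ^+ n.+1) * q ^+ i| <= 4 * offset n q.
Proof.
move=> q0 il /andP[c0 cq]; have q1 : 1 <= q by lia.
have e1 := exprn_gt0 n.+1 q0; have e2 := exprn_gt0 i q0.
have le1 : q ^+ i <= q ^+ n.+1 by rewrite ler_weXn2l //; lia.
have le2 : q <= q ^+ n.+1 by rewrite -{1}(expr1 q) ler_weXn2l.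
rewrite /offset; move: (q ^+ n.+1) (q ^+ i) e1 e2 le1 le2 => u v e1 e2 le1 le2.
rewrite normrM !ger0_norm; [|lia|lia].
apply: (@le_trans _ _ ((2 * u) * u)); first by apply: ler_pM; lia.
by nia.
Qed.

Section Main.
Variables (n e wd : nat) (num den : nat -> int) (w : nat -> bool).
Hypotheses (n0 : (0 < n)%N) (wd9 : (9 <= wd)%N) (nw : (n < 2 ^ wd)%N)
  (ew : (128 * 2 ^ e <= 2 ^ wd)%N).
Local Notation entry := (entry n e num den).
Hypothesis entryb : forall a, (a < n * n + n)%N -> `|entry a| < (2 ^ wd)%N%:Z.

Local Notation Gz := (Gz n e den).
Local Notation Bz := (Bz n e num den).
Local Notation Tz := (Tz n e num den).
Local Notation PM := (PMz n wd).
Local Notation M2 := (M2z n wd).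
Local Notation Q := (Qz n wd).
Local Notation levels := (levelsz n wd).
Local Notation N := (Nz n wd).
Local Notation reps := (repsz n wd).
Local Notation col := (colz n).
Local Notation tape := (tapez n).
Local Notation len := (lenz n wd).
Local Notation tab := (tabz n wd).
Local Notation MB := (MBz n e).
Local Notation Z := (Zz n wd).
Local Notation R := (Rz n wd).
Local Notation cv := (cvz n e wd den).
Local Notation X := ((Xn n wd)%:Z).
Local Notation OFF := (offset n Q).
Local Notation cst := (cst cv).
Local Notation tri := (tri false Z w).
Local Notation Mb := (128 * e.+1)%N.
Local Notation H := ((2 * n).+1.-tuple 'I_(2 * M2)).

Lemma cstz r : cst r -> (r vn = n%:Z) * (r vG = Gz) * (r vPM = PM) * (r vQ = Q) *
  (r vQN = Q ^+ n) * (r vcol = col%:Z) * (r vQR = Q ^+ n.+1) * (r vtape = tape%:Z).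
Proof. by move=> C; rewrite !C. Qed.

Lemma bndXz v k : (k <= 30)%N -> `|v| <= X ^+ k -> bounded Z v.
Proof. exact: (bnd_X n0 wd9 nw ew). Qed.
Lemma bofz v : `|v| <= 4 * OFF -> bounded Z v.
Proof. exact: (bnd_offset n0 wd9 nw ew). Qed.
Lemma bnd0z : bounded Z 0. Proof. by rewrite /bounded expn_gt0. Qed.
Lemma bnd1z : bounded Z 1.
Proof. by apply: (@bndXz 1 0). Qed.
Lemma natb (k : nat) : (k <= Xn n wd)%N -> bounded Z k%:Z.
Proof. by move=> kX; apply: (@bndXz _ 1) => //; rewrite expr1; lia. Qed.
Lemma n_ltZ : (n < 2 ^ Z)%N.
Proof. by have := natb (ltnW (n_X n0 nw)). Qed.

Lemma PM_le_Q : PM <= Q.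
Proof.
rewrite (Q_X n0 wd9 nw ew) (PM_X n0 wd9 nw ew); apply: ler_weXn2l => //.
by have := X512 n0 wd9 nw ew; lia.
Qed.

Definition input_at (h : nat -> int) := forall a, (a < n * n + n)%N ->
  h (1 + 2 * a)%N = num a /\ h (2 + 2 * a)%N = den a.

Lemma t_halve r h j kk : cst r -> r vkk = kk%:Z -> (kk <= e)%N -> r vh = (2 ^ e)%N%:Z ->
  tri p_halve (State r h j) (e * 30 + 11) (fun s' => vars s' vh = 2 ^+ (e - kk)).
Proof.
move=> C rk ke rh.
have eX : (2 ^ e <= Xn n wd)%N by apply: leq_trans (PW_X _ n0); apply: leq_trans ew; rewrite leq_pmull.
eapply tri_le.
  eapply (tri_for (cnt := kk) (I := fun i r1 h1 => r1 vh = 2 ^+ (e - i))) => //.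
  + have := @natb kk; rewrite /bounded /=; apply; apply: leq_trans eX; apply: leq_trans ke _.
    exact: ltnW (ltn_expl _ _).
  + by rewrite subn0 rh PoszX.
  + move=> i r1 h1 j1 il ri fr _ _ r1h.
    have E : (2 ^+ (e - i) %/ 2)%Z = 2 ^+ (e - i.+1) :> int.
      by rewrite (_ : (e - i)%N = (e - i.+1).+1) ?exprSr ?mulzK //; lia.
    eapply tri_asg => /=; rewrite r1h E //.
    rewrite -[2]/(2%N%:Z) -PoszX; apply: natb; apply: leq_trans eX; rewrite leq_exp2l //; lia.
by rewrite /=; move: ke; nia.
Qed.

Lemma t_col r h j i f : cst r -> r va = i%:Z -> (i < n)%N -> r vf = f -> input_at h ->
  (forall k, (k < n)%N -> bounded Z (h (col + k)%N + f * Bz i k)) ->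
  tri p_col (State r h j) (n * 80 + 11) (fun s' => forall a, memory s' a =
    if (col <= a < col + n)%N then h a + f * Bz i (a - col) else h a).
Proof.
move=> C ra il rf inp bd; eapply tri_le.
  eapply (tri_for (cnt := n) (I := fun k r1 h1 => forall a, h1 a =
     if (col <= a < col + k)%N then h a + f * Bz i (a - col) else h a)) => //.
  + by rewrite (cstz C).
  + exact: n_ltZ.
  + by move=> a; rewrite addn0; case: ifP => //; lia.
  + move=> k r1 h1 j1 kn rk fr _ _ Ik.
    have C1 := cst_frame fr isT C; have CE1 := cstz C1.
    have [r1a r1f] : r1 va = i%:Z /\ r1 vf = f by rewrite !fr.
    have [e1 e2] := inp (i * n + k)%N ltac:(nia).
    have lt1 b : (b < col)%N -> h1 b = h b.
      by move=> bc; rewrite Ik (_ : (col <= b < _)%N = false) //; lia.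
    have hk : h1 (col + k)%N = h (col + k)%N.
      by rewrite Ik (_ : (col <= _ < _)%N = false) //; lia.
    have E1 : h1 (absz (1 + 2 * (r1 va * r1 vn + r1 vb))) = num (i * n + k)%N.
      have -> : absz (1 + 2 * (r1 va * r1 vn + r1 vb)) = (1 + 2 * (i * n + k))%N by rewrite r1a rk !CE1; clear; lia.
      by rewrite lt1 // /colz; move: kn il; clear; nia.
    have E2 : h1 (absz (2 + 2 * (r1 va * r1 vn + r1 vb))) = den (i * n + k)%N.
      have -> : absz (2 + 2 * (r1 va * r1 vn + r1 vb)) = (2 + 2 * (i * n + k))%N by rewrite r1a rk !CE1; clear; lia.
      by rewrite lt1 // /colz; move: kn il; clear; nia.
    have E3 : h1 (absz (r1 vcol + r1 vb)) = h (col + k)%N.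
      by rewrite rk !CE1 -hk.
    have E4 : absz (r1 vcol + r1 vb) = (col + k)%N by rewrite rk !CE1; lia.
    eapply tri_put => /=; rewrite E1 E2 E3 r1f !CE1; first exact: bd.
    move=> a; have -> : `|(col%:Z + r1 vb)%R|%N = (col + k)%N by rewrite rk.
    case: eqP => [->|ne].
      by rewrite (_ : (col <= col + k < col + k.+1)%N) ?addKn //; lia.
    by rewrite Ik; have -> : (col <= a < col + k.+1)%N = (col <= a < col + k)%N by lia.
by rewrite /=; lia.
Qed.

Section Box.
Variables (r0 : int) (beta : nat).
Hypothesis r01 : 1 <= r0 < (2 ^ wd)%N%:Z.
Local Notation cr := (crz e r0 beta).
Local Notation sc := (sz n e wd r0 beta).
Local Notation bidx := (box_idx e beta).

Definition pcol (k j : nat) : int := pack Q k (fun i => sc i * Bz i j) +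
  Q ^+ n.+1 * pack Q k (fun i => Bz i j).
Definition pT (k : nat) : int := pack Q k (fun i => sc i * (Tz i + cr i)) + 1 * Q ^+ n +
  Q ^+ n.+1 * pack Q k Tz.

Lemma pcol_bound k j : (k <= n)%N -> (j < n)%N -> `|pcol k j| <= OFF.
Proof.
move=> kn jn; have := @col_bound n e wd n0 wd9 nw ew r0 r01 k (fun i => sc i * Bz i j) (fun i => Bz i j) 0 kn.
rewrite mul0r addr0; apply=> // i il; last exact: (Bz_bound n0 wd9 nw ew entryb r01).
rewrite normrM; have /andP[s0 sP] := sz_bound n0 wd9 nw ew beta r01 i.
apply: (@le_trans _ _ (PM * X)); first by apply: ler_pM; rewrite ?(Bz_bound n0 wd9 nw ew entryb r01) //; lia.
rewrite (PM_X n0 wd9 nw ew) -exprSr; have : X ^+ 6 <= X ^+ 8 by rewrite ler_weXn2l //; have := X512 n0 wd9 nw ew; lia.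
by have := X_gt0 n0 wd9 nw ew 6; move: (X ^+ 6) (X ^+ 8); clear; lia.
Qed.

Lemma pT_bound k : (k <= n)%N -> `|pT k| <= OFF.
Proof.
move=> kn; apply: (col_bound n0 wd9 nw ew r01) => // i il.
  exact: (tgt_bound n0 wd9 nw ew entryb beta r01 il).
exact: (Tz_bound n0 wd9 nw ew entryb r01 il).
Qed.

Lemma t_coord r h j i : cst r -> r va = i%:Z -> (i < n)%N -> r vr = r0 ->
  r vbb = (beta %/ Mb ^ i)%N%:Z -> r vP = Q ^+ i -> input_at h -> (beta < MB)%N ->
  (forall k, (k < n)%N -> h (col + k)%N = pcol i k) -> h (col + n)%N = pT i ->
  (forall a, bounded Z (h a)) ->
  tri (p_coord e) (State r h j) (n * 80 + e * 30 + 600) (fun s' =>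
    [/\ forall a, (a < col)%N || (col + n < a)%N -> memory s' a = h a,
        forall k, (k < n)%N -> memory s' (col + k)%N = pcol i.+1 k,
        memory s' (col + n)%N = pT i.+1, forall a, bounded Z (memory s' a) &
        vars s' vbb = (beta %/ Mb ^ i.+1)%N%:Z /\ vars s' vP = Q ^+ i.+1]).
Proof.
move=> C ra il rr rb rP inp bM hc hT bh; have CE := cstz C.
have x512 := X512 n0 wd9 nw ew.
have MbX : (Mb <= Xn n wd)%N.
  by apply: leq_trans (PW_X _ n0); apply: leq_trans ew; rewrite leq_mul2l /=; exact: ltn_expl.
have bX : (beta <= Xn n wd)%N by apply: leq_trans (MB_X n0 ew); exact: ltnW.
have ioE : (beta %/ Mb ^ i)%N%:Z - Mb%:Z * ((beta %/ Mb ^ i)%N%:Z %/ Mb%:Z)%Z = (bidx i)%:Z.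
  by rewrite subz_mulz_div modz_nat.
have bbE : ((beta %/ Mb ^ i)%N%:Z %/ Mb%:Z)%Z = (beta %/ Mb ^ i.+1)%N%:Z.
  by rewrite divz_nat -divnMA -expnSr.
have ioM := box_idx_lt e beta i.
have hb := boxh_bound e beta i.
have [P1 P2] := PW_bounds n0 ew.
have sb := sz_bound n0 wd9 nw ew beta r01 i; have cb := crz_bound n0 wd9 nw ew beta r01 i.
have Qi : 0 < Q ^+ i <= Q ^+ n.
  by rewrite exprn_gt0 ?(Qz_gt0 n0 wd9 nw ew) //= ler_weXn2l 1?ltnW //; have := Qz_gt0 n0 wd9 nw ew; lia.
have Qi1 : 0 < Q ^+ i.+1 <= Q ^+ n.
  by rewrite exprn_gt0 ?(Qz_gt0 n0 wd9 nw ew) //= ler_weXn2l //; have := Qz_gt0 n0 wd9 nw ew; lia.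
have [o1 [o2 o3]] := offset_ge n0 wd9 nw ew.
set f : int := (sc i + Q ^+ n.+1) * Q ^+ i.
have fB k : pcol i k + f * Bz i k = pcol i.+1 k by rewrite /pcol !packSr /f; ring.
have fT : pT i + f * Tz i + sc i * cr i * Q ^+ i = pT i.+1 by rewrite /pT !packSr /f; ring.
have fb : `|f| <= 4 * OFF.
  apply: scale_bound => //; first exact: (Qz_gt0 n0 wd9 nw ew).
  case/andP: sb => sb1 sb2; apply/andP; split; first by apply: le_trans sb1.
  by apply: le_trans sb2 _; exact: PM_le_Q.
eapply tri_le.
  eapply tri_asg_seq => /=; first by rewrite rb ioE; apply: natb; apply: leq_trans MbX; exact: ltnW.
  eapply tri_asg_seq => /=.
    by rewrite rb bbE; apply: natb; apply: leq_trans bX; exact: leq_div.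
  rewrite rb ioE bbE; eapply tri_asg_seq => /=.
    by rewrite divz_nat; apply: natb; apply: leq_trans MbX; apply: leq_trans (leq_div _ _) (ltnW ioM).
  rewrite divz_nat; eapply tri_asg_seq => /=.
    by apply: natb; apply: leq_trans (PW_X _ n0); apply: leq_trans ew; rewrite leq_pmull.
  eapply tri_call.
    eapply (@t_halve _ _ _ (bidx i %/ 128)%N) => //=.
    + by do 4!apply: cst_upd => //.
    + by rewrite -ltnS ltn_divLR // mulnC; exact: ioM.
  move=> r1 h1 j1 /= h1E fr1 /(_ isT) ->.
  have C1 : cst r1 by apply: cst_frame fr1 isT _; do 4!apply: cst_upd => //.
  have CE1 := cstz C1.
  have [io1 rr1 rP1] : [/\ r1 vio = (bidx i)%:Z, r1 vr = r0 & r1 vP = Q ^+ i] by rewrite !fr1.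
  have [ra1 rb1] : r1 va = i%:Z /\ r1 vbb = (beta %/ Mb ^ i.+1)%N%:Z by rewrite !fr1.
  have cE : (1 - 2 * (r1 vio - 2 * (r1 vio %/ 2)%Z)) *
     (64 * (2 ^ e)%N%:Z - 64 * r1 vh + ((r1 vio %/ 2)%Z - 64 * ((r1 vio %/ 2)%Z %/ 64)%Z) * r1 vh) *
     r1 vr = cr i.
    rewrite !subz_mulz_div io1 rr1 h1E divz_nat !modz_nat /crz /box_c /box_h.
    have -> : (2 ^ e)%N%:Z = 2 ^+ e by rewrite PoszX.
    by move: (2 ^+ e : int) (2 ^+ (e - _) : int) (_ %% 2)%N (_ %% 64)%N => E' h' q' t'; ring.
  have sE : (r1 vPM %/ (2 * r1 vh * r1 vr))%Z = sc i by rewrite !CE1 h1E rr1.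
  eapply tri_asg_seq => /=; first by rewrite cE; apply: (@bndXz _ 2).
  rewrite cE; eapply tri_asg_seq => /=.
    rewrite sE; apply: (@bndXz _ 5); first by [].
    by rewrite -(PM_X n0 wd9 nw ew); move: sb; move: (sc i) PM => a b; clear; lia.
  rewrite sE; eapply tri_asg_seq => /=; first by rewrite rP1 !CE1 -/f; apply: bofz.
  rewrite rP1 !CE1 -/f; eapply tri_call.
    eapply (@t_col _ _ _ i f) => //=.
    + by do 3!apply: cst_upd => //.
    + move=> k kn; rewrite hc // fB; apply: bofz.
      by have := pcol_bound il kn; move: OFF (pcol _ _) o3; clear; lia.
  move=> r2 h2 j2 /= h2E fr2 _.
  have C2 : cst r2 by apply: cst_frame fr2 isT _; do 3!apply: cst_upd => //.
  have CE2 := cstz C2.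
  have [f2 s2 c2] : [/\ r2 vf = f, r2 vs = sc i & r2 vc = cr i] by rewrite !fr2.
  have [ra2 P2' b2] : [/\ r2 va = i%:Z, r2 vP = Q ^+ i & r2 vbb = (beta %/ Mb ^ i.+1)%N%:Z].
    by rewrite !fr2.
  have [e1 e2] := inp (n * n + i)%N ltac:(lia).
  have lt2 b : (b < col)%N -> h2 b = h b.
    by move=> bc; rewrite h2E (_ : (col <= b < _)%N = false) //; lia.
  have h2n : h2 (col + n)%N = pT i.
    by rewrite h2E (_ : (col <= _ < _)%N = false) ?hT //; lia.
  have E1 : h2 (absz (1 + 2 * (r2 vn * r2 vn + r2 va))) = num (n * n + i)%N.
    have -> : absz (1 + 2 * (r2 vn * r2 vn + r2 va)) = (1 + 2 * (n * n + i))%N by rewrite ra2 !CE2; clear; lia.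
    by rewrite lt2 // /colz; move: il; clear; lia.
  have E2 : h2 (absz (2 + 2 * (r2 vn * r2 vn + r2 va))) = den (n * n + i)%N.
    have -> : absz (2 + 2 * (r2 vn * r2 vn + r2 va)) = (2 + 2 * (n * n + i))%N by rewrite ra2 !CE2; clear; lia.
    by rewrite lt2 // /colz; move: il; clear; lia.
  have E4 : absz (r2 vcol + r2 vn) = (col + n)%N by rewrite !CE2; clear; lia.
  apply: tri_seq; eapply tri_put => /=; rewrite E1 E2 E4 h2n f2 s2 c2 P2' !CE2 -/(Tz i) fT.
    by apply: bofz; have := pT_bound il; move: OFF (pT _) o3; clear; lia.
  eapply tri_asg => /=; rewrite P2' !CE2 -exprSr.
    by apply: bofz; move: (Q ^+ i.+1) (Q ^+ n) OFF Qi1 o2 o3; clear; lia.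
  split.
  + move=> a ac; have -> : (a == (col + n)%N) = false by move: ac; clear; lia.
    by rewrite h2E (_ : (col <= a < _)%N = false) //; move: ac; clear; lia.
  + move=> k kn; have -> : ((col + k)%N == (col + n)%N) = false by move: kn; clear; lia.
    rewrite h2E (_ : (col <= _ < _)%N = true); last by move: kn; clear; lia.
    by rewrite addKn hc // fB.
  + by rewrite eqxx.
  + move=> a; case: eqP => _.
      by apply: bofz; have := pT_bound il; move: OFF (pT _) o3; clear; lia.
    rewrite h2E; case: ifP => [ac|_]; last exact: bh.
    have aE : (a = col + (a - col))%N by move: ac; clear; lia.
    have an : (a - col < n)%N by move: ac; clear; lia.
    rewrite {1}aE hc // fB; apply: bofz.
    by have := pcol_bound il an; move: OFF (pcol _ _) o3; clear; lia.
  + by split; [exact: b2|].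
by rewrite /=; clear; lia.
Qed.

Lemma t_box r h j : cst r -> r vr = r0 -> r vbeta = beta%:Z -> (beta < MB)%N ->
  input_at h -> (forall a, bounded Z (h a)) ->
  tri (p_box e) (State r h j) (n * (n * 80 + e * 30 + 700) + 200) (fun s' =>
    [/\ forall a, (a < col)%N || (col + n < a)%N -> memory s' a = h a,
        forall k, (k < n)%N -> memory s' (col + k)%N = colv n Q Bz sc k,
        memory s' (col + n)%N = colT n Q Tz cr sc & forall a, bounded Z (memory s' a)]).
Proof.
move=> C rr rb bM inp bh; have CE := cstz C; have [o1 [o2 o3]] := offset_ge n0 wd9 nw ew.
have bX : (beta <= Xn n wd)%N by apply: leq_trans (MB_X n0 ew); exact: ltnW.
have QN0 : 0 < Q ^+ n by rewrite exprn_gt0 ?(Qz_gt0 n0 wd9 nw ew).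
eapply tri_le.
  eapply (@tri_call _ _ _ _ _ _ _ (fun s' => forall a, memory s' a =
     if (col <= a < col + n)%N then 0 else h a)).
    eapply (tri_for (cnt := n) (I := fun k r1 h1 => forall a, h1 a =
       if (col <= a < col + k)%N then 0 else h a)) => //.
    + by rewrite CE.
    + exact: n_ltZ.
    + by move=> a; rewrite addn0; case: ifP => //; lia.
    + move=> k r1 h1 j1 kn rk fr _ _ Ik.
      have CE1 := cstz (cst_frame fr isT C).
      eapply tri_put => /=; first exact: bnd0z.
      move=> a; rewrite rk !CE1 /=; case: eqP => [->|ne].
        by rewrite (_ : (col <= col + k < col + k.+1)%N) //; lia.
      by rewrite Ik; have -> : (col <= a < col + k.+1)%N = (col <= a < col + k)%N by lia.
  move=> r1 h1 j1 /= h1E fr1 _.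
  have C1 : cst r1 := cst_frame fr1 isT C; have CE1 := cstz C1.
  have [rr1 rb1] : r1 vr = r0 /\ r1 vbeta = beta%:Z by rewrite !fr1.
  apply: tri_seq; eapply tri_put => /=.
    by rewrite CE1; apply: bofz; move: (Q ^+ n) OFF o2 o3 QN0; clear; lia.
  have E4 : absz (r1 vcol + r1 vn) = (col + n)%N by rewrite !CE1; lia.
  rewrite E4 CE1; eapply tri_asg_seq => /=; first by rewrite rb1; apply: natb.
  rewrite rb1; eapply tri_asg_seq => /=; first exact: bnd1z.
  pose I (i : nat) (r2 h2 : nat -> int) := [/\
     forall a, (a < col)%N || (col + n < a)%N -> h2 a = h a,
     forall k, (k < n)%N -> h2 (col + k)%N = pcol i k,
     h2 (col + n)%N = pT i, forall a, bounded Z (h2 a) &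
     r2 vbb = (beta %/ Mb ^ i)%N%:Z /\ r2 vP = Q ^+ i].
  eapply (tri_for (cnt := n) (I := I)) => //.
  + by rewrite /= CE1.
  + exact: n_ltZ.
  + split=> /=.
    * move=> a ac; have -> : (a == (col + n)%N) = false by lia.
      by rewrite h1E (_ : (col <= a < _)%N = false) //; lia.
    * move=> k kn; have -> : ((col + k)%N == (col + n)%N) = false by lia.
      rewrite h1E (_ : (col <= _ < _)%N = true); last lia.
      by rewrite /pcol /pack !big_ord0 mulr0 addr0.
    * by rewrite eqxx /pT /pack !big_ord0 mulr0 addr0 add0r mul1r.
    * move=> a; case: eqP => _.
        by apply: bofz; move: (Q ^+ n) OFF o2 o3 QN0; clear; lia.
      by rewrite h1E; case: ifP => // _; exact: bnd0z.
    * by rewrite expn0 divn1.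
  + move=> i r2 h2 j2 il ri fr2 _ _ [I1 I2 I3 I4 [I5 I6]].
    have C2 : cst r2 by apply: cst_frame fr2 isT _; do 2!apply: cst_upd => //.
    have rr2 : r2 vr = r0 by rewrite fr2 //= rr1.
    eapply tri_post.
      eapply (@t_coord r2 h2 _ i) => //.
      by move=> a aa; rewrite !I1; [exact: inp|rewrite /colz; lia|rewrite /colz; lia].
    move=> r3 h3 j3 /= [J1 J2 J3 J4 J5] _ _; split=> // a ac; by rewrite J1 // I1.
  + move=> r' h' j' _ _ _ [I1 I2 I3 I4 _]; split=> //=.
    by rewrite I3 /pT /colT mul1r.
by rewrite /=; lia.
Qed.

End Box.
End Main.

End BoxProgram.
Import BoxProgram.

(** * Verification of the search over radii and of the output *)

Module SearchProgram.
Local Open Scope ring_scope.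

Section Main.
Variables (n e wd : nat) (num den : nat -> int) (w : nat -> bool).
Hypotheses (n0 : (0 < n)%N) (wd9 : (9 <= wd)%N) (nw : (n < 2 ^ wd)%N)
  (ew : (128 * 2 ^ e <= 2 ^ wd)%N).
Local Notation entry := (entry n e num den).
Hypothesis entryb : forall a, (a < n * n + n)%N -> `|entry a| < (2 ^ wd)%N%:Z.

Local Notation Gz := (Gz n e den).
Local Notation Bz := (Bz n e num den).
Local Notation Tz := (Tz n e num den).
Local Notation PM := (PMz n wd).
Local Notation M2 := (M2z n wd).
Local Notation Q := (Qz n wd).
Local Notation levels := (levelsz n wd).
Local Notation N := (Nz n wd).
Local Notation reps := (repsz n wd).
Local Notation col := (colz n).
Local Notation tape := (tapez n).
Local Notation len := (lenz n wd).
Local Notation tab := (tabz n wd).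
Local Notation MB := (MBz n e).
Local Notation Z := (Zz n wd).
Local Notation R := (Rz n wd).
Local Notation cv := (cvz n e wd den).
Local Notation X := ((Xn n wd)%:Z).
Local Notation OFF := (offset n Q).
Local Notation cst := (cst cv).
Local Notation tri := (tri false Z w).
Local Notation Mb := (128 * e.+1)%N.
Local Notation H := ((2 * n).+1.-tuple 'I_(2 * M2)).

Local Notation bnd0z := (@bnd0z n wd).
Local Notation input_at := (input_at n num den).

Definition tape_at (h : nat -> int) (dflt : H) (om : nat -> N.-tuple H) :=
  forall p i k, (p < reps)%N -> (i < N)%N -> (k < (2 * n).+1)%N ->
    h (tape + p * (N * (2 * n).+1) + i * (2 * n).+1 + k)%N = (dig (nth dflt (om p) i) k)%:Z.

(** Depends on the random digits of one trial and not on the history of the search, so that it can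
    be counted. *)
Definition hit_box (r0 : int) (beta : nat) (t : N.-tuple H) : Prop :=
  good_box n M2 R levels Bz Tz (crz e r0 beta) (sz n e wd r0 beta) (64 * ((2 ^ e)%N%:Z + 1) * r0) /\
  wins (step_table Q R levels tab Bz Tz (crz e r0 beta) (sz n e wd r0 beta))
       (survives Q R levels tab Bz Tz (crz e r0 beta) (sz n e wd r0 beta))
       (target_seen Q R levels tab Bz Tz (crz e r0 beta) (sz n e wd r0 beta)) (fun=> 0) t.

Definition K_trial : nat :=
  ncells n * levels * 30 + N * (levels * (n * 52 + 250) + n * 200 + 1100) + 50.
Definition K_box : nat := n * (n * 80 + e * 30 + 700) + 200.
Definition K_round : nat := MB * (K_box + (reps * (K_trial + 14) + 11) + 40) + 11.

Local Notation valid := (valid n Q Bz Tz).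

Lemma mixed_radix_lt (u v c p i k : nat) : (p < c)%N -> (i < u)%N -> (k < v)%N ->
  (p * (u * v) + i * v + k < c * u * v)%N.
Proof.
move=> pc iu kv; have h1 : (i * v + k < u * v)%N by move: iu kv; clear; nia.
by rewrite -mulnA; move: pc h1; move: (u * v)%N (i * v)%N => a b; clear; nia.
Qed.

Lemma tape_end p i k : (p < reps)%N -> (i < N)%N -> (k < (2 * n).+1)%N ->
  (col + n < tape + p * (N * (2 * n).+1) + i * (2 * n).+1 + k < tab)%N.
Proof.
move=> pr iN kn; rewrite /tabz /lenz {1}/tapez.
have := mixed_radix_lt pr iN kn.
move: (p * (N * (2 * n).+1))%N (i * (2 * n).+1)%N (reps * N * (2 * n).+1)%N => x y z.
by rewrite /tapez; clear; lia.
Qed.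

Lemma N_gt0 : (0 < N)%N.
Proof.
have m0 := mz_gt0 n0 wd9 nw ew; rewrite /Nz /ncells /levelsz; move: (mz n wd) m0 => m m0.
by rewrite !muln_gt0 !expn_gt0 m0.
Qed.

Lemma reps_gt0 : (0 < reps)%N.
Proof.
rewrite /repsz; have : (0 < 4 ^ n)%N by rewrite expn_gt0.
by move: (4 ^ n)%N n0 => f n1 f0; rewrite !muln_gt0 f0 addn_gt0 n1 orbT.
Qed.

Lemma Z_gt0 : (0 < Z)%N.
Proof.
rewrite /Zz; have := mz_gt0 n0 wd9 nw ew; move: (mz n wd) => m m0.
by rewrite !muln_gt0 m0 addn_gt0 orbT.
Qed.

Lemma t_trialz r0 b : 1 <= r0 < (2 ^ wd)%N%:Z ->
  forall r h j p (dflt : H) (hs : N.-tuple H) D, cst r -> r vtp = p%:Z -> r vD = D ->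
  0 <= D -> 8 * D <= Q -> (p + N * (2 * n).+1 <= tab)%N -> (col + n < tab)%N ->
  (forall i k, (i < N)%N -> (k < (2 * n).+1)%N ->
     h (p + i * (2 * n).+1 + k)%N = (dig (nth dflt hs i) k)%:Z) ->
  (forall j, (j < n)%N -> h (col + j)%N = colv n Q Bz (sz n e wd r0 b) j) ->
  h (col + n)%N = colT n Q Tz (crz e r0 b) (sz n e wd r0 b) ->
  (forall a, bounded Z (h a)) ->
  tri p_trial (State r h j) K_trial (fun s' =>
    [/\ forall a, (a < tab)%N -> memory s' a = h a,
        forall a, bounded Z (memory s' a),
        vars s' vtp = (p + N * (2 * n).+1)%N%:Z,
        (vars s' vfound, vars s' vbest) = (r vfound, r vbest) \/
          vars s' vfound = 1 /\ valid D (vars s' vbest) &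
        (r vfound = 1 -> vars s' vfound = 1) /\
        (good_box n M2 R levels Bz Tz (crz e r0 b) (sz n e wd r0 b) D ->
         wins (step_table Q R levels tab Bz Tz (crz e r0 b) (sz n e wd r0 b))
           (survives Q R levels tab Bz Tz (crz e r0 b) (sz n e wd r0 b))
           (target_seen Q R levels tab Bz Tz (crz e r0 b) (sz n e wd r0 b)) (fun=> 0) hs ->
         vars s' vfound = 1)]).
Proof.
move=> r01; exact: (@t_trial Z w cv n Q M2 R levels tab erefl erefl erefl erefl erefl erefl erefl
  erefl erefl erefl n0 (Qz_gt0 n0 wd9 nw ew) (PMz_gt0 n0 wd9 nw ew) Z_gt0 (bndQz n0 wd9 nw ew)
  (@RSz n wd) (RQz n0 wd9 nw ew) (baseQz n0 wd9 nw ew) Bz Tz (crz e r0 b) (sz n e wd r0 b)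
  (crQz n0 wd9 nw ew b r01) (s1z n0 wd9 nw ew b r01) (Q4z n0 wd9 nw ew) col erefl
  (colvz_bound n0 wd9 nw ew entryb b r01) (colTz_bound n0 wd9 nw ew entryb b r01)
  (nPMz n0 wd9 nw ew) (R0bigz n0 wd9 nw ew entryb b r01) N erefl erefl).
Qed.

Lemma bQ' v : `|v| <= Q -> bounded Z v.
Proof.
move=> vQ; apply: (bofz n0 wd9 nw ew); have [o1 [_ o3]] := offset_ge n0 wd9 nw ew.
rewrite -(Q_X n0 wd9 nw ew) in o1.
by move: OFF Q vQ o1 o3; clear; lia.
Qed.
Lemma t_round r h j r0 D dflt om E0 : cst r -> r vr = r0 -> 1 <= r0 < (2 ^ wd)%N%:Z ->
  r vD = D -> D = 64 * ((2 ^ e)%N%:Z + 1) * r0 -> 8 * D <= Q ->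
  r vfound = 0 -> r vbest = E0 -> input_at h -> tape_at h dflt om ->
  (forall a, bounded Z (h a)) ->
  tri (p_round e) (State r h j) K_round (fun s' =>
    [/\ input_at (memory s'), tape_at (memory s') dflt om,
        forall a, bounded Z (memory s' a),
        (vars s' vfound = 0 /\ vars s' vbest = E0) \/
          (vars s' vfound = 1 /\ valid D (vars s' vbest)) &
        forall beta p, (beta < MB)%N -> (p < reps)%N -> hit_box r0 beta (om p) ->
          vars s' vfound = 1]).
Proof.
move=> C rr r01 rD DE DQ rf rb inp tp bh.
have D0 : 0 <= D by rewrite DE; move: r01; nia.
have baseQ := baseQz n0 wd9 nw ew.
have c1 : (col + n < tab)%N by rewrite /tabz /tapez; clear; lia.
have MX := MB_X n0 ew.
have rX : (reps <= tab)%N.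
  rewrite /tabz /lenz; have := N_gt0; move: reps N => a b b0.
  apply: (@leq_trans (a * b)%N); first by rewrite leq_pmulr.
  by apply: leq_trans (leq_addl _ _); rewrite leq_pmulr.
have tabX : (tab < 2 ^ Z)%N.
  have := @bQ' tab%:Z; rewrite /bounded /=; apply.
  by move: baseQ; rewrite -PoszM; move: (ncells n * levels)%N (ncells n) Q tab; clear; lia.
pose V (r1 : nat -> int) := (r1 vfound = 0 /\ r1 vbest = E0) \/
          (r1 vfound = 1 /\ valid D (r1 vbest)).
pose I (b : nat) (r1 h1 : nat -> int) := [/\ input_at h1, tape_at h1 dflt om,
   forall a, bounded Z (h1 a), V r1 &
   forall beta p, (beta < b)%N -> (p < reps)%N -> hit_box r0 beta (om p) -> r1 vfound = 1].
eapply tri_le.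
  eapply (tri_for (cnt := MB) (I := I)) => //.
  + by rewrite C.
  + by have := natb n0 wd9 nw ew MX.
  + by split=> //; left.
  + move=> b r1 h1 j1 bM rb1 fr _ _ [I1 I2 I3 I4 I5].
    have C1 := cst_frame fr isT C.
    have [rr1 rD1] : r1 vr = r0 /\ r1 vD = D by rewrite !fr.
    eapply tri_call; first by eapply (@t_box n e wd num den w n0 wd9 nw ew entryb r0 b r01 r1 h1).
    move=> r2 h2 j2 /= [J1 J2 J3 J4] fr2 _.
    have C2 : cst r2 := cst_frame fr2 isT C1.
    have [rf2 rb2 rD2] : [/\ r2 vfound = r1 vfound, r2 vbest = r1 vbest & r2 vD = D] by rewrite !fr2.
    have inp2 : input_at h2.
      by move=> a aa; rewrite !J1; [exact: I1| |]; rewrite /colz; move: aa; clear; lia.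
    have tp2 : tape_at h2 dflt om.
      move=> p i k pr iN kn; rewrite J1; first exact: I2.
      by have := tape_end pr iN kn; clear; lia.
    eapply tri_asg_seq => /=.
      rewrite (C2 vtape) // /=; have : (tape <= tab)%N by rewrite /tabz leq_addr.
      by move=> tt; rewrite /bounded /=; apply: leq_ltn_trans tabX.
    rewrite (C2 vtape) //=.
    pose I' (p : nat) (r3 h3 : nat -> int) := [/\ r3 vtp = (tape + p * (N * (2 * n).+1))%N%:Z,
       forall a, (a < tab)%N -> h3 a = h2 a, forall a, bounded Z (h3 a), V r3 &
       (r1 vfound = 1 -> r3 vfound = 1) /\
       forall p', (p' < p)%N -> hit_box r0 b (om p') -> r3 vfound = 1].
    eapply (tri_for (cnt := reps) (I := I')) => //.
    * by rewrite /= C2.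
    * exact: leq_ltn_trans rX tabX.
    * split=> //=; [by rewrite mul0n addn0|by move: I4; rewrite /V /= rf2 rb2|].
      by split=> //; rewrite rf2.
    * move=> p r3 h3 j3 pr rp fr3 _ _ [K1 K2 K3 K4 [K5 K6]].
      have C3 : cst r3 by apply: cst_frame fr3 isT _; apply: cst_upd.
      have rD3 : r3 vD = D by rewrite fr3.
      have pb : (tape + p * (N * (2 * n).+1) + N * (2 * n).+1 <= tab)%N.
        rewrite /tabz /lenz -addnA leq_add2l -mulnA addnC -mulSn leq_mul2r pr.
        by rewrite orbT.
      have c2 : (col + n < tab)%N := c1.
      eapply tri_post.
        apply: (@t_trialz r0 b r01 r3 h3 j3 (tape + p * (N * (2 * n).+1))%N dflt (om p) D C3 K1 rD3 D0 DQ pb c1).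
        -- move=> i k iN kn; rewrite K2; first exact: tp2.
           by have := tape_end pr iN kn; clear; lia.
        -- by move=> k kn; rewrite K2; [exact: J2|move: c1 kn; clear; lia].
        -- by rewrite K2.
        -- exact: K3.
      move=> r4 h4 j4 /= [L1 L2 L3 L4 [L5 L6]] _ _; split=> //.
      -- by rewrite L3; congr Posz; rewrite mulSn -addnA; congr addn; rewrite addnC.
      -- by move=> a ab; rewrite L1 // K2.
      -- case: L4 => [[e1 e2]|v]; last by right.
         by rewrite /V e1 e2.
      -- split=> [/K5/L5 //|p']; rewrite ltnS leq_eqVlt => /orP[/eqP->|pp].
           by move=> [g1 g2]; apply: L6 => //; rewrite DE.
         by move=> hb; apply: L5; exact: K6 hb.
    * move=> r' h' j' _ _ _ [K1 K2 K3 K4 [K5 K6]]; split=> //=.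
      -- move=> a aa; rewrite !K2; first exact: inp2.
           by move: c1; rewrite /colz; move: aa; clear; lia.
         by move: c1; rewrite /colz; move: aa; clear; lia.
      -- move=> p i k pr iN kn; rewrite K2; first exact: tp2.
         by have := tape_end pr iN kn; clear; lia.
      -- move=> beta p; rewrite ltnS leq_eqVlt => /orP[/eqP->|bb] pr hb; first exact: K6 hb.
         by apply: K5; exact: I5 hb.
rewrite /K_round /K_box leq_add2r leq_mul2l; apply/orP; right.
by move: (reps * _)%N => kk /=; clear; lia.
Qed.

Definition D_of (k : nat) : int := 64 * ((2 ^ e)%N%:Z + 1) * k%:Z.
Definition no_hit (om : nat -> N.-tuple H) (k : nat) :=
  forall beta p, (beta < MB)%N -> (p < reps)%N -> ~ hit_box k%:Z beta (om p).

Lemma D_of_le k : (k <= 2 ^ wd)%N -> 0 <= D_of k <= X ^+ 2.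
Proof.
move=> kw; have [P1 P2] := PW_bounds n0 ew; rewrite /D_of.
have e1 : 1 <= (2 ^ e)%N%:Z :> int by rewrite lez_nat expn_gt0.
have E : 2 ^+ e = (2 ^ e)%N%:Z :> int by rewrite PoszX.
rewrite E in P1; have kw' : k%:Z <= (2 ^ wd)%N%:Z by [].
move: (2 ^ e)%N%:Z (2 ^ wd)%N%:Z k%:Z X e1 P1 P2 kw' (le0z_nat k) => a b c x e1 P1 P2 kw' c0.
apply/andP; split; first by apply: mulr_ge0; lia.
by rewrite expr2; apply: ler_pM; lia.
Qed.

Lemma X2Q x : 0 <= x <= X ^+ 2 -> 8 * x <= Q.
Proof.
move=> xb; have := @monoX n e wd n0 wd9 nw ew 8 2 1 30 isT isT; rewrite -(Q_X n0 wd9 nw ew).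
by move: (X ^+ 2) Q xb; clear; lia.
Qed.

Definition K_search : nat := wd * (K_round + 100) + 100.

(** The upper end of the search interval is lo + step. The invariant only says that lo is 0 or
    missed by all trials, and that the upper end has produced [vbest] unless it is still the initial
    one; no monotonicity between radii is involved. *)
Lemma t_search r h j dflt om : cst r -> input_at h -> tape_at h dflt om ->
  (forall a, bounded Z (h a)) ->
  tri (p_search e) (State r h j) K_search (fun s' => [/\ input_at (memory s'),
    forall a, bounded Z (memory s' a) & exists lo : nat,
   [/\ (lo < 2 ^ wd)%N, lo = 0%N \/ no_hit om lo & lo.+1 = (2 ^ wd)%N /\ vars s' vbest = 0 \/
       (lo.+1 < 2 ^ wd)%N /\ valid (D_of lo.+1) (vars s' vbest)]]).
Proof.
move=> C inp tp bh.
have PWX := PW_X wd n0; have w0 : (0 < 2 ^ wd)%N by rewrite expn_gt0.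
have bX (k : nat) : (k <= 2 ^ wd)%N -> bounded Z k%:Z.
  by move=> kw; apply: (natb n0 wd9 nw ew); apply: leq_trans kw PWX.
pose I (k : nat) (r1 h1 : nat -> int) := [/\ input_at h1, tape_at h1 dflt om,
   forall a, bounded Z (h1 a) & exists lo : nat, [/\ r1 vlo = lo%:Z,
   r1 vstep = (2 ^ (wd - k))%N%:Z, (lo + 2 ^ (wd - k) <= 2 ^ wd)%N, lo = 0%N \/ no_hit om lo &
   (lo + 2 ^ (wd - k) = 2 ^ wd)%N /\ r1 vbest = 0 \/ (lo + 2 ^ (wd - k) < 2 ^ wd)%N /\
     valid (D_of (lo + 2 ^ (wd - k))) (r1 vbest)]].
eapply tri_le.
  eapply tri_asg_seq => /=; first exact: bnd0z.
  eapply tri_asg_seq => /=; first by rewrite C //=; exact: bX.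
  rewrite (C vPW) //=; eapply tri_asg_seq => /=; first exact: bnd0z.
  eapply (tri_for (cnt := wd) (I := I)) => //.
  + by rewrite /= C.
  + by have := natb n0 wd9 nw ew (ltnW (wd_X wd n0)).
  + split=> //; exists 0%N; rewrite subn0 add0n; split=> //; by left.
  + move=> k r1 h1 j1 kw rk fr _ _ [I1 I2 I3 [lo [L1 L2 L3 L4 L5]]].
    have C1 : cst r1 by apply: cst_frame fr isT _; do 3!apply: cst_upd => //.
    pose st := (2 ^ (wd - k.+1))%N.
    have stE : (2 ^ (wd - k) = 2 * st)%N by rewrite /st -expnS; congr expn; move: kw; clear; lia.
    have st0 : (0 < st)%N by rewrite /st expn_gt0.
    rewrite stE in L2 L3 L5.
    have rlt : (lo + st < 2 ^ wd)%N by move: L3 st0; clear; lia.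
    have hE : ((2 * st)%N%:Z %/ 2)%Z = st%:Z by rewrite divz_nat mulKn.
    have Db := D_of_le (ltnW rlt).
    have DE : ((2 ^ e)%N%:Z + 1) * 64 * (lo + st)%N%:Z = D_of (lo + st) by rewrite /D_of; ring.
    eapply tri_asg_seq => /=; first by rewrite L2 hE; apply: bX; move: rlt; clear; lia.
    rewrite L2 hE; eapply tri_asg_seq => /=; first by rewrite L1 -PoszD; apply: bX; exact: ltnW.
    rewrite L1 -PoszD; eapply tri_asg_seq => /=; first exact: bnd0z.
    eapply tri_asg_seq => /=.
      rewrite DE; apply: (@bndXz n e wd n0 wd9 nw ew _ 2); first by [].
      by move: (D_of _) (X ^+ 2) Db; clear; lia.
    rewrite DE; eapply tri_call.
      eapply (@t_round _ _ _ (lo + st)%N%:Z (D_of (lo + st)) dflt om (r1 vbest)) => //=.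
      * by do 4!apply: cst_upd => //.
      * by rewrite ltz_nat rlt andbT lez_nat addn_gt0 st0 orbT.
      * exact: X2Q.
    move=> r2 h2 j2 /= [J1 J2 J3 J4 J5] fr2 _.
    have [lo2 st2 rr2] : [/\ r2 vlo = lo%:Z, r2 vstep = st%:Z & r2 vr = (lo + st)%N%:Z].
      by rewrite !fr2.
    eapply (tri_if (K := 4)) => /= pos.
      eapply tri_le; first (eapply tri_skip => kk /=; split=> //; exists lo; rewrite -/st; split=> //).
      * by move: rlt; clear; lia.
      * right; split=> //; case: J4 => [[f0 _]|[_ //]]; by rewrite f0 in pos.
      by [].
    eapply tri_asg => /=; first by rewrite rr2; apply: bX; exact: ltnW.
    move=> kk; split=> //; exists (lo + st)%N; rewrite -/st.
    have ll : (lo + st + st = lo + 2 * st)%N by clear; lia.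
    case: J4 => [[f0 b0]|[f1 _]]; last by rewrite f1 in pos.
    split=> //=; rewrite ?ll //.
    * by right=> beta p bM pr hb; have := J5 beta p bM pr hb; rewrite f0.
    * by rewrite b0.
  + move=> r' h' j' _ _ _ [I1 I2 I3 [lo [L1 L2]]]; rewrite subnn expn0 addn1 => L3 L4 L5.
    by split=> //; exists lo.
by rewrite /K_search /=; clear; lia.
Qed.

Lemma t_output r h j (v : nat -> int) : cst r -> 0 <= Gz < (2 ^ wd)%N%:Z -> r vbest = pack Q n v ->
  (forall i, (i < n)%N -> `|v i| <= X ^+ 2) -> input_at h -> (forall a, bounded Z (h a)) ->
  tri p_output (State r h j) (n * 120 + 60) (fun s' => forall i, (i < n)%N ->
    memory s' (2 * i)%N = v i + Tz i /\ memory s' (2 * i).+1 = Gz).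
Proof.
move=> C Gb rb vb inp bh; have CE := cstz C; have Q0 := Qz_gt0 n0 wd9 nw ew.
have [o1 [o2 o3]] := offset_ge n0 wd9 nw ew; have x512 := X512 n0 wd9 nw ew.
have P2 : PM * PM = X ^+ 10 by rewrite (PM_X n0 wd9 nw ew) -exprD.
have PQ : 8 * (PM * PM) <= Q.
  by rewrite P2 (Q_X n0 wd9 nw ew); apply: (@monoX n e wd n0 wd9 nw ew 8 10 1 30).
have x2P : 2 * X ^+ 2 <= PM * PM.
  by rewrite P2; apply: (@monoX n e wd n0 wd9 nw ew 2 2 1 10).
pose u (i : nat) : int := v i + PM * PM.
have ub i : (i < n)%N -> 0 <= u i < Q.
  move=> /vb; rewrite /u; move: (PM * PM) (X ^+ 2) Q (v i) PQ x2P Q0; clear; lia.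
have uE : pack Q n v + PM * PM * pack Q n (fun=> 1) = pack Q n u.
  by rewrite /pack mulr_sumr -big_split /=; apply: eq_bigr => i _; rewrite /u; ring.
have uO : `|pack Q n u| <= OFF.
  have : - Q ^+ n < pack Q n u < Q ^+ n.
    apply: (@pack_bound Q Q0 n _ (PM * PM + X ^+ 2)).
      by move: (PM * PM) (X ^+ 2) Q PQ x2P Q0; clear; lia.
    move=> i /vb; rewrite /u; move: (PM * PM) (X ^+ 2) (v i) x2P; clear; lia.
  by move: (pack Q n u) (Q ^+ n) OFF o2; clear; lia.
have Yd i : bounded Z (pack Q n u %/ Q ^+ i)%Z.
  apply: (bofz n0 wd9 nw ew); have := absz_divz_le (pack Q n u) (Q ^+ i).
  move: (pack Q n u %/ Q ^+ i)%Z => z; move: (pack Q n u) OFF uO o3; clear; lia.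
have dgE i : (i < n)%N -> digit Q (pack Q n u) i = u i.
  by move=> il; have := @digit_pack Q Q0 n u 0 i ub il; rewrite mulr0 addr0.
have GX : bounded Z Gz.
  apply: (@bndXz n e wd n0 wd9 nw ew _ 1); first by [].
  rewrite expr1; have := PW_X wd n0; rewrite -lez_nat.
  by move: Gz (2 ^ wd)%N%:Z X Gb; clear; lia.
eapply tri_le.
  eapply tri_asg_seq => /=.
    rewrite rb !CE (C vones) //= uE; have := Yd 0%N; by rewrite expr0 divz1.
  rewrite rb !CE (C vones) //= uE.
  pose I (i : nat) (r1 h1 : nat -> int) := [/\ r1 vY = (pack Q n u %/ Q ^+ i)%Z,
     forall a, (2 * i <= a)%N -> h1 a = h a & forall k, (k < i)%N ->
      h1 (2 * k)%N = v k + Tz k /\ h1 (2 * k).+1 = Gz].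
  eapply (tri_for (cnt := n) (I := I)) => //.
  + by rewrite /= CE.
  + exact: (n_ltZ n0 wd9 nw ew).
  + by split=> //=; rewrite expr0 divz1.
  + move=> i r1 h1 j1 il ri fr _ _ [I1 I2 I3].
    have C1 : cst r1 by apply: cst_frame fr isT _; apply: cst_upd.
    have CE1 := cstz C1.
    have [e1 e2] := inp (n * n + i)%N ltac:(move: il; clear; lia).
    have ni : (i <= n * n)%N by move: il n0; clear; nia.
    eapply tri_asg_seq => /=.
      rewrite I1 !CE1 subz_mulz_div -/(digit Q (pack Q n u) i) dgE //.
      apply: (@bQ' _); move: (ub i il); move: (u i) Q; clear; lia.
    rewrite I1 !CE1 subz_mulz_div -/(digit Q (pack Q n u) i) dgE //.
    eapply tri_asg_seq => /=; first by rewrite I1 !CE1 divX_succ //; exact: Yd.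
    rewrite I1 !CE1 divX_succ //.
    have A1 : h1 (absz (1 + 2 * (r1 vn * r1 vn + r1 va))) = num (n * n + i)%N.
      have -> : absz (1 + 2 * (r1 vn * r1 vn + r1 va)) = (1 + 2 * (n * n + i))%N by rewrite ri !CE1; clear; lia.
      by rewrite I2 //; move: ni; clear; lia.
    have A2 : h1 (absz (2 + 2 * (r1 vn * r1 vn + r1 va))) = den (n * n + i)%N.
      have -> : absz (2 + 2 * (r1 vn * r1 vn + r1 va)) = (2 + 2 * (n * n + i))%N by rewrite ri !CE1; clear; lia.
      by rewrite I2 //; move: ni; clear; lia.
    have vE : u i - PM * PM + num (n * n + i)%N * (Gz %/ den (n * n + i)%N)%Z = v i + Tz i.
      by rewrite /u addrK.
    have A3 : absz (2 * r1 va) = (2 * i)%N by rewrite ri; clear; lia.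
    have A4 : absz (2 * r1 va + 1) = (2 * i).+1 by rewrite ri; clear; lia.
    apply: tri_seq; eapply tri_put => /=; rewrite A1 A2 !CE1 vE.
      apply: (@bndXz n e wd n0 wd9 nw ew _ 3); first by [].
      have := @monoX n e wd n0 wd9 nw ew 2 2 1 3 isT isT.
      have := vb i il; have := Tz_bound n0 wd9 nw ew entryb (r := 1) _ il.
      have xx : X <= X ^+ 2 by rewrite -{1}(expr1 X) ler_weXn2l //; move: x512; clear; lia.
      move=> TT; have {TT} := TT _; rewrite ltz_nat.
      have -> : (1 < 2 ^ wd)%N by apply: (@leq_trans (2 ^ 1)); [|rewrite leq_exp2l //; move: wd9; clear; lia].
      move=> /(_ isT); move: (v i) (Tz i) X (X ^+ 2) (X ^+ 3) xx; clear; lia.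
    rewrite A3; eapply tri_put => /=; rewrite !CE1 ?A4 //.
    split=> //=.
    * move=> a ai; have -> : (a == (2 * i).+1) = false by move: ai; clear; lia.
      have -> : (a == (2 * i)%N) = false by move: ai; clear; lia.
      by apply: I2; move: ai; clear; lia.
    * move=> k; rewrite ltnS leq_eqVlt => /orP[/eqP->|ki].
        by rewrite !eqxx (_ : ((2 * i)%N == (2 * i).+1) = false) //; clear; lia.
      have -> : ((2 * k)%N == (2 * i).+1) = false by clear; lia.
      have -> : ((2 * k)%N == (2 * i)%N) = false by move: ki; clear; lia.
      have -> : ((2 * k).+1 == (2 * i).+1) = false by move: ki; clear; lia.
      have -> : ((2 * k).+1 == (2 * i)%N) = false by clear; lia.
      exact: I3.
  + by move=> r' h' j' _ _ _ [].
by rewrite /=; clear; lia.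
Qed.

End Main.

End SearchProgram.
Import SearchProgram.

(** * A box that fits the closest vector *)

Module BoxChoice.
Local Open Scope ring_scope.

Section Main.
Variables (n e wd : nat) (num den : nat -> int) (w : nat -> bool).
Hypotheses (n0 : (0 < n)%N) (wd9 : (9 <= wd)%N) (nw : (n < 2 ^ wd)%N)
  (ew : (128 * 2 ^ e <= 2 ^ wd)%N).
Local Notation entry := (entry n e num den).
Hypothesis entryb : forall a, (a < n * n + n)%N -> `|entry a| < (2 ^ wd)%N%:Z.

Local Notation Gz := (Gz n e den).
Local Notation Bz := (Bz n e num den).
Local Notation Tz := (Tz n e num den).
Local Notation PM := (PMz n wd).
Local Notation M2 := (M2z n wd).
Local Notation Q := (Qz n wd).
Local Notation levels := (levelsz n wd).
Local Notation N := (Nz n wd).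
Local Notation reps := (repsz n wd).
Local Notation col := (colz n).
Local Notation tape := (tapez n).
Local Notation len := (lenz n wd).
Local Notation tab := (tabz n wd).
Local Notation MB := (MBz n e).
Local Notation Z := (Zz n wd).
Local Notation R := (Rz n wd).
Local Notation cv := (cvz n e wd den).
Local Notation X := ((Xn n wd)%:Z).
Local Notation OFF := (offset n Q).
Local Notation cst := (cst cv).
Local Notation tri := (tri false Z w).
Local Notation Mb := (128 * e.+1)%N.
Local Notation H := ((2 * n).+1.-tuple 'I_(2 * M2)).

Local Notation valid := (valid n Q Bz Tz).
Local Notation raw := (rawv n Bz Tz).

Lemma pack_digits (M : nat) (f : nat -> nat) k : (forall i, (i < k)%N -> (f i < M)%N) ->
  exists2 b, (b < M ^ k)%N & forall i, (i < k)%N -> ((b %/ M ^ i) %% M)%N = f i.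
Proof.
elim: k f => [|k IH] f fM; first by exists 0%N.
have [b bM bE] := IH (fun i => f i.+1) (fun i ik => fM i.+1 ik).
have f0 := fM 0%N isT; exists (f 0%N + M * b)%N.
  rewrite expnS; apply: (@leq_trans (M * b.+1)); first by rewrite mulnS ltn_add2r.
  by rewrite leq_mul2l bM orbT.
move=> [|i] ik; first by rewrite expn0 divn1 addnC mulnC modnMDl modn_small.
rewrite expnS divnMA -bE //; congr ((_ %/ _) %% _)%N.
by rewrite addnC mulnC divnMDl ?divn_small ?addn0 //; apply: leq_ltn_trans f0.
Qed.

(** From s (2 h r) <= PM < (s + 1) (2 h r) two facts follow. Differences within h r of the centre
    scale to at most PM/2. A survivor has scaled size at most 3 PM + PM < 8 (s + 1) h r <= 16 s h r,
    hence lies in the 16 times larger box, which [interval_cover] keeps within the acceptance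
    bound. *)
Lemma exists_box (r0 : int) (us : nat -> int) : 1 <= r0 < (2 ^ wd)%N%:Z ->
  (forall i, (i < n)%N -> `|raw us (-1) i| <= 64 * 2 ^+ e * r0) ->
  exists2 beta, (beta < MB)%N &
    good_box n M2 R levels Bz Tz (crz e r0 beta) (sz n e wd r0 beta) (64 * ((2 ^ e)%N%:Z + 1) * r0) /\
    forall i, (i < n)%N -> (absz (scaledv n Bz Tz (crz e r0 beta) (sz n e wd r0 beta) us (-1) i) <= M2)%N.
Proof.
move=> r01 ub; have r1 : 1 <= r0 by case/andP: r01.
pose ok i k := (k < Mb)%N /\ `|raw us (-1) i - box_c e k * r0| <= box_h e k * r0 /\
   forall x', `|x' - box_c e k * r0| <= 16 * box_h e k * r0 -> `|x'| <= (2 ^+ e + 1) * 64 * r0.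
have [f fP] : exists f : nat -> nat, forall i, (i < n)%N -> ok i (f i).
  have : forall k, (k <= n)%N -> exists f : nat -> nat, forall i, (i < k)%N -> ok i (f i).
    elim=> [|k IH] kn; first by exists (fun=> 0%N).
    have [f fk] := IH (ltnW kn); have [x x1 x2] := interval_cover r1 (ub k kn).
    exists (fun i => if i == k then x else f i) => i; rewrite ltnS leq_eqVlt.
    by case: eqP => [->|_ /= /fk].
  by move/(_ n (leqnn n)).
have [beta bM bE] := @pack_digits Mb f n (fun i il => (fP i il).1).
exists beta => //.
have sE i : (i < n)%N -> exists (h c s : int), [/\ 1 <= h, crz e r0 beta i = c,
    sz n e wd r0 beta i = s, 1 <= s & [/\ s * (2 * h * r0) <= PM, PM < (s + 1) * (2 * h * r0),
    `|raw us (-1) i - c| <= h * r0 &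
    forall x', `|x' - c| <= 16 * h * r0 -> `|x'| <= (2 ^+ e + 1) * 64 * r0]].
  move=> il; have [f1 [f2 f3]] := fP i il; have E : box_idx e beta i = f i by rewrite /box_idx bE.
  have hb := boxh_bound e beta i; have /andP[s1 _] := sz_bound n0 wd9 nw ew beta r01 i.
  rewrite /boxh E in hb; exists (box_h e (f i)), (box_c e (f i) * r0), (sz n e wd r0 beta i).
  case/andP: hb => h1 _; have hr : 0 < 2 * box_h e (f i) * r0.
    by rewrite !mulr_gt0 //; move: r1 h1; move: (box_h _ _); clear; lia.
  have SE : sz n e wd r0 beta i = (PM %/ (2 * box_h e (f i) * r0))%Z by rewrite /sz /boxh E.
  split=> //; first by rewrite /crz E.
  split=> //; rewrite SE; move: (2 * box_h e (f i) * r0) PM hr => q p q0.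
    by have := divz_eq p q; have := modz_ge0 p (lt0r_neq0 q0); move: (p %/ q)%Z (p %% q)%Z; clear; lia.
  by have := divz_eq p q; have := ltz_pmod p q0; move: (p %/ q)%Z (p %% q)%Z; clear; lia.
split=> [U Ub i il|i il]; have [h [c [s [h1 cE sE' s1 [k1 k2 k3 k4]]]]] := sE i il.
  have := k4 (raw U (-1) i) _; rewrite (_ : (2 ^+ e + 1) * 64 * r0 = 64 * ((2 ^ e)%N%:Z + 1) * r0); last first.
    by rewrite PoszX; ring.
  apply; have := Ub i il; rewrite /scaledv cE sE'; have := Rz_last n0 wd9 nw ew.
  rewrite mulN1r normrM (ger0_norm (le_trans _ s1)) // -/PM => R3 sx.
  have {sx}sx : s * `|raw U (-1) i - c| <= 4 * PM.
    by apply: le_trans sx _; move: (R levels) PM R3; rewrite /PMz; move=> a; clear; lia.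
  rewrite leNgt; apply/negP => big.
  have : s * (16 * h * r0) < s * `|raw U (-1) i - c| by rewrite ltr_pM2l //; move: s1; clear; lia.
  have : 0 < h * r0 by rewrite mulr_gt0.
  have -> : s * (16 * h * r0) = 16 * (s * (h * r0)) by ring.
  have : (s + 1) * (2 * h * r0) = 2 * (s * (h * r0)) + 2 * (h * r0) by ring.
  have : h * r0 <= s * (h * r0).
    by rewrite ler_peMl //; apply: mulr_ge0; [move: h1|move: r1]; clear; lia.
  move: sx k2; move: ((s + 1) * (2 * h * r0)) (s * `|raw U (-1) i - c|) PM (h * r0) (s * (h * r0)).
  by clear; lia.
rewrite -lez_nat abszE /scaledv cE sE' mulN1r normrM (ger0_norm (le_trans _ s1)) //.
have : s * `|raw us (-1) i - c| <= s * (h * r0).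
  by rewrite ler_pM2l //; move: s1; clear; lia.
have : s * (2 * h * r0) = 2 * (s * (h * r0)) by ring.
move: k1; rewrite /PMz; move: (s * (h * r0)) (s * `|_|) (s * (2 * _ * _)) M2; clear; lia.
Qed.

(** The coefficients must be at most half the digit range, otherwise the flip would leave the range
    too often. *)
Lemma bounded_coefficients (us : nat -> int) :
  (forall i, (i < n)%N -> `|raw us (-1) i| < (2 ^ wd)%N%:Z) ->
  exists us', (forall i, (i < n)%N -> raw us' (-1) i = raw us (-1) i) /\
    forall j, (j < n)%N -> (absz (us' j) <= M2)%N.
Proof.
move=> ub; pose P := (2 ^ wd)%N.
(* The base of the bound in [small_coefficients]; its n-th power is at most 2^(3 wd n), below M2. *)
have aux (p : nat) : (n < p)%N -> (512 <= p)%N -> (2 * (2 * p + n * p) + 1 <= p ^ 3)%N.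
  move=> np p5; rewrite !expnS expn0 muln1; apply: (@leq_trans (p * (p * 4))%N); first by move: np p5; clear; nia.
  by rewrite !leq_mul2l; move: p5; clear; lia.
have bb a : (a < n * n + n)%N -> (absz (entry a) <= P)%N.
  by move=> /entryb; rewrite -/P; move: (entry a); clear; lia.
have [|||U' [U1 U2]] := @small_coefficients n (fun i j => Bz i j) (fun i => \sum_(j < n) Bz i j * us j) (fun j => us j) P (2 * P).
- by move=> i j; apply: bb; have := ltn_ord i; have := ltn_ord j; clear; nia.
- move=> i; have := ub i (ltn_ord i); rewrite /rawv -/P.
  have : (absz (Tz i) <= P)%N by apply: bb; have := ltn_ord i; clear; lia.
  by move: (Tz i) (\sum_(j < n) _); clear; lia.
- by [].
exists (fun j => if insub j is Some k then U' k else 0); split=> [i il|j jn].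
  rewrite /rawv; congr (_ + _); rewrite -[RHS](U1 (Ordinal il)).
  by apply: eq_bigr => j _; rewrite valK.
rewrite insubT; apply: leq_trans (U2 _) _.
apply: (@leq_trans ((P ^ 3) ^ n)).
  rewrite leq_exp2r //; have : (512 <= P)%N by rewrite /P -[512%N]/(2 ^ 9)%N leq_exp2l.
  exact: aux.
rewrite /P -!expnM /M2z leq_exp2l // /mz; move: n0 wd9; clear.
rewrite (_ : 5 * wd * n = 5 * (wd * n))%N; last by ring.
rewrite (_ : wd * (3 * n) = 3 * (wd * n))%N; last by ring.
by move=> n0 w9; have : (0 < wd * n)%N; [rewrite muln_gt0 n0 andbT; lia|move: (wd * n)%N; lia].
Qed.

Lemma card_hits (r0 : int) (us : nat -> int) : 1 <= r0 < (2 ^ wd)%N%:Z ->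
  (forall j, (j < n)%N -> (absz (us j) <= M2)%N) ->
  (forall i, (i < n)%N -> `|raw us (-1) i| <= 64 * 2 ^+ e * r0) ->
  exists2 P : pred (N.-tuple H), (#|{: N.-tuple H}| <= 4 * 4 ^ n * #|P|)%N &
   forall t, P t -> exists2 beta, (beta < MB)%N & hit_box e num den r0 beta t.
Proof.
move=> r01 ubd ub; have [beta bM [gb sb]] := exists_box r01 ub.
exists [pred t : N.-tuple H | wins (step_table Q R levels tab Bz Tz (crz e r0 beta) (sz n e wd r0 beta))
       (survives Q R levels tab Bz Tz (crz e r0 beta) (sz n e wd r0 beta))
       (target_seen Q R levels tab Bz Tz (crz e r0 beta) (sz n e wd r0 beta)) (fun=> 0) t].
  rewrite card_tuple; apply: (@card_trial_wins n Q M2 R levels tab Bz Tz (crz e r0 beta) (sz n e wd r0 beta)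
    (Qz_gt0 n0 wd9 nw ew) (PMz_gt0 n0 wd9 nw ew) (@RSz n wd) (RQz n0 wd9 nw ew)
    (crQz n0 wd9 nw ew beta r01) (s1z n0 wd9 nw ew beta r01) (R0bigz n0 wd9 nw ew entryb beta r01) us ubd sb).
  - by move=> l q ll qc; rewrite ltxx.
  - by rewrite /M2z expn_gt0.
  - exact: (N_gt0 n0 wd9 nw ew).
  - exact: leqnn.
by move=> t wt; exists beta.
Qed.

End Main.

End BoxChoice.
Import BoxChoice.

(** * The coin tape, and verification of the parameters *)

Module SetupProgram.
Local Open Scope ring_scope.

Section Main.
Variables (n e wd : nat) (num den : nat -> int) (w : nat -> bool).
Hypotheses (n0 : (0 < n)%N) (wd9 : (9 <= wd)%N) (nw : (n < 2 ^ wd)%N)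
  (ew : (128 * 2 ^ e <= 2 ^ wd)%N).
Local Notation entry := (entry n e num den).
Hypothesis entryb : forall a, (a < n * n + n)%N -> `|entry a| < (2 ^ wd)%N%:Z.

Local Notation Gz := (Gz n e den).
Local Notation Bz := (Bz n e num den).
Local Notation Tz := (Tz n e num den).
Local Notation PM := (PMz n wd).
Local Notation M2 := (M2z n wd).
Local Notation Q := (Qz n wd).
Local Notation levels := (levelsz n wd).
Local Notation N := (Nz n wd).
Local Notation reps := (repsz n wd).
Local Notation col := (colz n).
Local Notation tape := (tapez n).
Local Notation len := (lenz n wd).
Local Notation tab := (tabz n wd).
Local Notation MB := (MBz n e).
Local Notation Z := (Zz n wd).
Local Notation R := (Rz n wd).
Local Notation cv := (cvz n e wd den).
Local Notation X := ((Xn n wd)%:Z).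
Local Notation OFF := (offset n Q).
Local Notation cst := (cst cv).
Local Notation tri := (tri false Z w).
Local Notation Mb := (128 * e.+1)%N.
Local Notation H := ((2 * n).+1.-tuple 'I_(2 * M2)).

(** Step at which bit [b] of digit [a] is drawn when the tape phase starts at step [j]. One bit
    takes 24 steps and one digit 24 m + 36, loop control included; the first flip of a digit comes
    after 21 steps. *)
Definition coin_pos (j a b : nat) : nat := j + a * (mz n wd * 24 + 36) + 21 + b * 24.

Definition digit_of (j a k : nat) : nat := dval (fun b => w (coin_pos j a b)) k.

Lemma digit_of_lt j a k : (digit_of j a k < 2 ^ k)%N.
Proof. exact: dval_lt. Qed.

Lemma bQz v : `|v| <= Q -> bounded Z v.
Proof.
move=> vQ; apply: (bofz n0 wd9 nw ew); have [o1 [_ o3]] := offset_ge n0 wd9 nw ew.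
rewrite -(Q_X n0 wd9 nw ew) in o1.
by move: OFF Q vQ o1 o3; clear; lia.
Qed.

Lemma natQ (k : nat) : (k <= tab + ncells n * levels + ncells n)%N -> bounded Z k%:Z.
Proof.
move=> kt; apply: bQz; have := baseQz n0 wd9 nw ew.
by move: Q kt (ncells n * levels)%N => q kt; rewrite -PoszM; move: (ncells n * levels)%N kt; clear; lia.
Qed.

Lemma m_le : (mz n wd <= ncells n * levels)%N.
Proof.
rewrite /levelsz; have : (0 < ncells n)%N by rewrite muln_gt0 expn_gt0.
by move: (ncells n) (mz n wd); clear; nia.
Qed.

Lemma t_tape r h j : cst r ->
  Triples.tri true Z w p_tape (State r h j) (len * (mz n wd * 24 + 36) + 11) (fun s' =>
    (forall a, (a < tape)%N || (tab <= a)%N -> memory s' a = h a) /\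
    (forall a, (a < len)%N -> memory s' (tape + a)%N = (digit_of j a (mz n wd))%:Z) /\
    forall x, (x < 23)%N -> vars s' x = r x).
Proof.
move=> C; set m := mz n wd.
have lb : bounded Z len%:Z by apply: natQ; rewrite /tabz; lia.
have mb : bounded Z m%:Z by apply: natQ; have := m_le; rewrite -/m; lia.
have -> : (len * (m * 24 + 36) + 11 = len * ((1 + 2 + (m * (1 + (7 + 2) + 14) + 11 + (5 + 2 + 1))) + 14) + 11)%N by ring.
eapply (@tri_for true _ _ _ _ _ _ _ _ _ len (fun i r1 h1 =>
    (forall a, (a < tape)%N || (tape + i <= a)%N -> h1 a = h a) /\
    (forall a, (a < i)%N -> h1 (tape + a)%N = (digit_of j a m)%:Z))) => //.
- by rewrite C.
- move=> i r1 h1 j1 il ri fr _ /eqP rj [I1 I2].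
  have C1 := cst_frame fr isT C.
  apply: tri_seq; apply: tri_asg => /=; first exact: bnd0z.
  apply: tri_seq; eapply (@tri_for true _ _ _ _ _ _ _ _ _ m (fun k r2 h2 =>
      r2 vacc = (digit_of j i k)%:Z)) => //=.
  + by rewrite C1.
  + move=> k r2 h2 j2 km rk fr2 _ /eqP rj2 Ik.
    apply: tri_seq; apply: tri_rnd; apply: tri_asg => /=.
      rewrite Ik; have -> : j2 = coin_pos j i k by rewrite rj2 rj /coin_pos -/m; ring.
      have := digit_of_lt j i k.+1; rewrite /= => dl; rewrite /bounded.
      rewrite -PoszM -PoszD; apply: leq_trans dl _; rewrite leq_exp2l //.
      by rewrite /Zz -/m; move: km; clear; nia.
    by rewrite Ik; have -> : j2 = coin_pos j i k by rewrite rj2 rj /coin_pos -/m; ring.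
  + move=> r2 h2 j2 fr2 /(_ isT) -> _ dE; apply: tri_put => /=.
      rewrite dE; have := digit_of_lt j i m; rewrite /bounded => dl; apply: leq_trans dl _.
      by rewrite leq_exp2l // /Zz -/m; clear; nia.
    have t2 : absz (r2 vtape + r2 va) = (tape + i)%N by rewrite !fr2 //= ri (C1 vtape) //=; clear; lia.
    rewrite t2 dE; split=> a ai.
      by have -> : (a == (tape + i)%N) = false; [move: ai; clear; lia|apply: I1; move: ai; clear; lia].
    case: eqP => [/addnI->//|ne]; apply: I2; move: ne ai; clear; lia.
- move=> r' h' j' fr _ _ [I1 I2] /=; split=> //; split=> // x x23; rewrite fr // !inE.
  by move: x23; clear; lia.
Qed.

End Main.

Fixpoint coinfree (c : cmd) : bool :=
  match c with
  | Rnd _ => false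
  | Seq a b | If _ a b => coinfree a && coinfree b
  | While _ a => coinfree a
  | _ => true
  end.

(** Applied to the setup, it makes the starting step of the tape phase the same for all coin
    sequences. *)
Lemma ev_coinfree Z w w' c s s' : coinfree c -> ev Z w c s s' -> ev Z w' c s s'.
Proof.
move=> + E; elim: E => {c s s'} //=; try by constructor.
- by move=> a b s1 s2 s3 _ IH1 _ IH2 /andP[/IH1 e1 /IH2 e2]; exact: EvSeq e1 e2.
- by move=> e a s s1 s2 pe _ IH1 _ IH2 cf; apply: EvWhileT (IH1 cf) (IH2 cf).
- by move=> e a b s s1 pe _ IH /andP[/IH ca _]; apply: EvIfT.
- by move=> e a b s s1 pe _ IH /andP[_ /IH cb]; apply: EvIfF.
Qed.

Section Setup.
Variables (n e : nat) (num den : nat -> int) (w : nat -> bool).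
Hypotheses (n0 : (0 < n)%N) (e0 : (0 < e)%N).
Hypothesis den1 : forall a, (a < n * n + n)%N -> 1 <= den a.
Local Notation Gz := (Gz n e den).

(** A sum of squares stands in for the largest absolute value of a numerator; as numerators are
    integers, it dominates each of them. *)
Definition X0 : nat := absz ((n%:Z + 2 + \sum_(a < n * n + n) num a * num a) * Gz).
Definition wdz : nat := (trunc_log 2 X0).+1.
Local Notation wd := wdz.

Lemma prod_den i : (i <= n * n + n)%N -> 1 <= \prod_(a < i) den a.
Proof.
elim: i => [|i IH] il; first by rewrite big_ord0.
rewrite big_ord_recr /=; have := IH (ltnW il); have := den1 il.
by move: (den i) (\prod_(a < i) _); clear; nia.
Qed.

Lemma G_ge : 128 * (2 ^ e)%N%:Z <= Gz /\ 256 <= Gz.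
Proof.
have := prod_den (leqnn _); rewrite /Magnitudes.Gz; have : (2 <= 2 ^ e)%N by rewrite -{1}(expn1 2) leq_exp2l.
by move: (2 ^ e)%N (\prod_(a < _) _) => p q; clear; nia.
Qed.

Lemma sq_ge0 i : 0 <= \sum_(a < i) num a * num a.
Proof. by apply: sumr_ge0 => a _; rewrite -expr2 sqr_ge0. Qed.

Lemma X0E : X0%:Z = (n%:Z + 2 + \sum_(a < n * n + n) num a * num a) * Gz.
Proof.
rewrite /X0; have [_ g] := G_ge; have := sq_ge0 (n * n + n).
by move: (\sum_(a < _) _) Gz g => s G g s0; rewrite gez0_abs //; move: g s0; clear; nia.
Qed.

Lemma X0_bounds : (2 ^ wd.-1 <= X0 < 2 ^ wd)%N.
Proof.
have X00 : (0 < X0)%N.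
  rewrite -ltz_nat X0E; have [_ g] := G_ge; have := sq_ge0 (n * n + n).
  by move: (\sum_(a < _) _) Gz g; clear; nia.
by rewrite /wdz /= trunc_logP // trunc_log_ltn.
Qed.

Lemma setup_hyps : [/\ (9 <= wd)%N, (n < 2 ^ wd)%N, (128 * 2 ^ e <= 2 ^ wd)%N &
  forall a, (a < n * n + n)%N -> `|entry n e num den a| < (2 ^ wd)%N%:Z].
Proof.
have /andP[x1 x2] := X0_bounds; have E := X0E; have [g1 g2] := G_ge.
have s0 := sq_ge0 (n * n + n).
have xb : X0%:Z < (2 ^ wd)%N%:Z by rewrite ltz_nat.
split.
- rewrite -(@leq_exp2l 2) //; rewrite -lez_nat; apply: ltW; apply: le_lt_trans xb.
  rewrite E -[(2 ^ 9)%N%:Z]/(512 : int).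
  by move: (\sum_(a < _) _) Gz g2 s0 n0; clear; nia.
- rewrite -ltz_nat; apply: le_lt_trans xb; rewrite E.
  by move: (\sum_(a < _) _) Gz g2 s0 n0; clear; nia.
- rewrite -lez_nat; apply: ltW; apply: le_lt_trans xb; rewrite E PoszM.
  by move: (2 ^ e)%N (\sum_(a < _) _) Gz g1 g2 s0 n0; clear; nia.
- move=> a aa; apply: le_lt_trans xb; rewrite E /entry normrM.
  have d0 := den1 aa.
  have gd : `|(Gz %/ den a)%Z| <= Gz.
    by have := absz_divz_le Gz (den a); move: (Gz %/ den a)%Z Gz g2; clear; lia.
  have na : `|num a| <= \sum_(a < n * n + n) num a * num a.
    rewrite (bigD1 (Ordinal aa)) //=; have : 0 <= \sum_(i < n * n + n | i != Ordinal aa) num i * num i.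
      by apply: sumr_ge0 => b _; rewrite -expr2 sqr_ge0.
    by move: (\sum_(i < _ | _) _) (num a); clear; nia.
  apply: (@le_trans _ _ ((\sum_(a < n * n + n) num a * num a) * Gz)).
    by apply: ler_pM.
  by move: (\sum_(a < _) _) Gz g2 s0 n0; clear; nia.
Qed.

Lemma prod_mono i k : (i + k <= n * n + n)%N -> \prod_(a < i) den a <= \prod_(a < i + k) den a.
Proof.
elim: k => [|k IH] ik; first by rewrite addn0.
rewrite addnS in ik *; apply: le_trans (IH (ltnW ik)) _.
rewrite big_ord_recr /=; have := prod_den (ltnW ik); have := den1 ik.
by move: (den _) (\prod_(a < _) _); clear; nia.
Qed.

Lemma sum_mono i k : \sum_(a < i) num a * num a <= \sum_(a < i + k) num a * num a.
Proof.
elim: k => [|k IH]; first by rewrite addn0.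
by rewrite addnS big_ord_recr /=; apply: le_trans IH _; rewrite lerDl -expr2 sqr_ge0.
Qed.

Local Notation tot := (n * n + n)%N.

Lemma G_part i : (i <= tot)%N -> 0 <= 128 * (2 ^ e)%N%:Z * \prod_(a < i) den a <= Gz.
Proof.
move=> il; have := prod_den il; have := @prod_mono i (tot - i); rewrite subnKC // => /(_ (leqnn _)).
rewrite /Magnitudes.Gz; move: (\prod_(a < i) _) (\prod_(a < tot) _) => u v uv u1.
have e1 : 0 <= (2 ^ e)%N%:Z by []; move: ((2 ^ e)%N%:Z) e1 => p p0.
by apply/andP; split; [nia|rewrite ler_wpM2l //; nia].
Qed.

Lemma S_part i : (i <= tot)%N -> 0 <= n%:Z + 2 + \sum_(a < i) num a * num a <= X0%:Z.
Proof.
move=> il; have := sq_ge0 i; have := @sum_mono i (tot - i); rewrite subnKC //.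
rewrite X0E; have [_ g2] := G_ge.
by move: (\sum_(a < i) _) (\sum_(a < tot) _) Gz g2 => u v g g2 uv u0; nia.
Qed.

Lemma G_le_X0 : 0 <= Gz <= X0%:Z.
Proof.
rewrite X0E; have [_ g2] := G_ge; have := sq_ge0 tot.
by move: (\sum_(a < tot) _) Gz g2 => v g g2 u0; clear -g2 u0; nia.
Qed.

Definition K_setup : nat := tot * 100 + wd * 100 + n * 200 + 1000.

Lemma t_setup (h : nat -> int) : h 0%N = n%:Z -> input_at n num den h ->
  Triples.tri false (Zz n wd) w (p_setup e) (State (fun=> 0) h 0) K_setup (fun s' =>
    cst (cvz n e wd den) (vars s')).
Proof.
move=> h0 inp; have [w9 nw ew eb] := setup_hyps.
have /andP[x1 x2] := X0_bounds.
have PX := PW_X wd n0.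
have bP (v : int) : 0 <= v <= X0%:Z -> bounded (Zz n wd) v.
  move=> v0; apply: (@bndXz n e wd n0 w9 nw ew _ 1); first by [].
  by rewrite expr1; move: x2 PX v0; move: (2 ^ wd)%N (Xn n wd); clear; lia.
have bN := natQ n0 w9 nw ew; have bq := bQz n0 w9 nw ew.
have bo := bofz n0 w9 nw ew; have bX := bndXz n0 w9 nw ew.
have b0 : bounded (Zz n wd) 0 := @bnd0z n wd.
have b1 : bounded (Zz n wd) 1 := bnd1z n0 w9 nw ew.
have nb : bounded (Zz n wd) n%:Z by apply: (natb n0 w9 nw ew); exact: ltnW (n_X n0 nw).
have totb : (tot < 2 ^ Zz n wd)%N.
  by have := bN tot; rewrite /bounded /=; apply; rewrite /tabz /tapez /colz; clear; lia.
have Q0 := Qz_gt0 n0 w9 nw ew; have P0 := PMz_gt0 n0 w9 nw ew; have PQ := PM_le_Q n0 w9 nw ew.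
have [o1 [o2 o3]] := offset_ge n0 w9 nw ew.
have Q1 : 1 <= Qz n wd by move: (Qz n wd) Q0; clear; lia.
pose I1 (i : nat) (r h : nat -> int) := r vG = 128 * (2 ^ e)%N%:Z * \prod_(a < i) den a /\
  r vX = n%:Z + 2 + \sum_(a < i) num a * num a.
pose I2 (i : nat) (r h : nat -> int) := [/\ r vX = (X0 %/ 2 ^ i)%N%:Z, r vPW = (2 ^ i)%N%:Z &
  r vw = i%:Z].
pose I3 (i : nat) (r h : nat -> int) := r vPM = ((2 ^ wd) ^ (5 * i))%N%:Z.
pose I4 (i : nat) (r h : nat -> int) := [/\ r vones = pack (Qz n wd) i (fun=> 1),
  r vQN = Qz n wd ^+ i, r vF4 = (4 ^ i)%N%:Z & r vMB = ((128 * e.+1) ^ i)%N%:Z].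
eapply tri_le.
  eapply tri_asg_seq => /=; first by rewrite h0.
  rewrite h0; eapply tri_asg_seq => /=.
    by rewrite -PoszM -PoszD; exact: totb.
  rewrite -PoszM -PoszD; eapply tri_asg_seq => /=.
    by apply: bP; have := G_part (leq0n tot); rewrite big_ord0 mulr1; have := G_le_X0; move: Gz X0 (_ * _); clear; lia.
  eapply tri_asg_seq => /=.
    by apply: bP; have := S_part (leq0n tot); rewrite big_ord0 addr0.
  eapply (@tri_call _ _ _ _ _ _ _ (fun s' => I1 tot (vars s') (memory s'))).
    eapply (tri_for (cnt := tot) (I := I1)) => //.
    + by rewrite /I1 /= !big_ord0 mulr1 addr0.
    + move=> i r1 h1 j1 il ri fr fh _ [g1 g2].
      have {fh} hE : h1 = h by apply: fh.
      have [d1 d2] := inp i il.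
      have A1 : h1 (absz (2 * r1 va + 2)) = den i.
        by rewrite hE -d2 ri; congr h; clear; lia.
      have A2 : h1 (absz (2 * r1 va + 1)) = num i.
        by rewrite hE -d1 ri; congr h; clear; lia.
      have E1 : r1 vG * den i = 128 * (2 ^ e)%N%:Z * \prod_(a < i.+1) den a.
        by rewrite g1 big_ord_recr /= mulrA.
      have E2 : r1 vX + num i * num i = n%:Z + 2 + \sum_(a < i.+1) num a * num a.
        by rewrite g2 big_ord_recr /=; ring.
      eapply tri_asg_seq => /=.
        rewrite A1 E1; apply: bP; have := G_part il; have := G_le_X0.
        by move: Gz X0 (_ * \prod_(a < _) _); clear; lia.
      eapply tri_asg => /=; rewrite A2 E2; first by apply: bP; exact: S_part.
      by rewrite A1 E1.
  move=> r1 h1 j1 [/= g1 g2] /= fr1 _.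
  have n1 : r1 vn = n%:Z by rewrite fr1.
  have GE : r1 vG = Gz by [].
  eapply tri_asg_seq => /=; first by rewrite g2 GE -X0E; apply: bP; rewrite lexx.
  rewrite g2 GE -X0E; eapply tri_asg_seq => /=; first exact: b0.
  eapply tri_asg_seq => /=; first exact: b1.
  eapply (@tri_call _ _ _ _ _ _ _ (fun s' => I2 wd (vars s') (memory s'))).
    eapply (tri_while (cnt := wd) (I := I2)) => //.
    + by rewrite /I2 /= expn0 divn1.
    + move=> i r2 h2 il [i1 _ _] /=; rewrite i1 ltz_nat divn_gt0 ?expn_gt0 //.
      apply/idP/idP => [le|lt].
        by have := leq_ltn_trans le x2; rewrite ltn_exp2l.
      by apply: leq_trans x1; rewrite leq_exp2l //; move: lt; rewrite /wdz; clear; lia.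
    + move=> i r2 h2 j2 il fr2 _ _ [e1 e2 e3].
      have iX : (2 ^ i.+1 <= 2 ^ wd)%N by rewrite leq_exp2l.
      have E1 : ((X0 %/ 2 ^ i)%N%:Z %/ 2)%Z = (X0 %/ 2 ^ i.+1)%N%:Z.
        by rewrite divz_nat -divnMA -expnSr.
      have E2 : (2 ^ i)%N%:Z * 2 = (2 ^ i.+1)%N%:Z by rewrite expnSr PoszM.
      have E3 : i%:Z + 1 = i.+1%:Z by rewrite -addn1 PoszD.
      eapply tri_asg_seq => /=.
        by rewrite e1 E1; apply: bP; rewrite lez_nat leq_div.
      rewrite e1 E1; eapply tri_asg_seq => /=.
        by rewrite e2 E2; apply: (natb n0 w9 nw ew); apply: leq_trans iX PX.
      rewrite e2 E2; eapply tri_asg => /=; rewrite e3 E3 //.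
      by apply: (natb n0 w9 nw ew); apply: leq_trans il (ltnW (wd_X wd n0)).
  move=> r2 h2 j2 [/= e1 e2 e3] /= fr2 _.
  have [n2 G2] : r2 vn = n%:Z /\ r2 vG = Gz by rewrite !fr2.
  eapply tri_asg_seq => /=.
    by rewrite e3 n2 -!PoszM; apply: bN; have := m_le n wd; rewrite /mz; move: (5 * wd * n)%N (ncells n * _)%N; clear; lia.
  rewrite e3 n2 -!PoszM; eapply tri_asg_seq => /=; first exact: b1.
  eapply (@tri_call _ _ _ _ _ _ _ (fun s' => I3 n (vars s') (memory s'))).
    eapply (tri_for (cnt := n) (I := I3)) => //.
    + move=> i r3 h3 j3 il ri fr3 _ _; rewrite /I3 => i3.
      have r3P : r3 vPW = (2 ^ wd)%N%:Z by rewrite fr3 //= fr2 // e2.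
      have E : ((2 ^ wd) ^ (5 * i))%N%:Z * (2 ^ wd)%N%:Z * (2 ^ wd)%N%:Z * (2 ^ wd)%N%:Z *
         (2 ^ wd)%N%:Z * (2 ^ wd)%N%:Z = ((2 ^ wd) ^ (5 * i.+1))%N%:Z.
        rewrite mulnS expnD -!PoszM; congr Posz; move: (2 ^ wd)%N => p.
        by rewrite !expnS expn0; move: (p ^ _)%N => q; ring.
      eapply tri_asg => /=; rewrite i3 r3P E //; apply: bq.
      apply: le_trans PQ; rewrite /PMz (PM_nat n0 w9 nw ew) /mz -expnM ger0_norm // lez_nat leq_exp2l //.
      by rewrite -mulnA mulnCA leq_mul2l /= leq_mul2l il orbT.
  move=> r3 h3 j3; rewrite /I3 /= => i3 fr3 _.
  have r3PM : r3 vPM = PMz n wd.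
    rewrite i3 /PMz (PM_nat n0 w9 nw ew) /mz -expnM; congr (Posz (_ ^ _)); ring.
  have [n3 G3 w3] : [/\ r3 vn = n%:Z, r3 vG = Gz & r3 vw = wd%:Z] by rewrite !fr3.
  have [P3 m3] : r3 vPW = (2 ^ wd)%N%:Z /\ r3 vm = (mz n wd)%:Z by rewrite !fr3.
  have QE : PMz n wd * PMz n wd * PMz n wd * PMz n wd * PMz n wd * PMz n wd = Qz n wd.
    by rewrite /Qz; move: (PMz n wd) => p; ring.
  have RE : PMz n wd * PMz n wd * PMz n wd * PMz n wd = Rz n wd 0.
    by rewrite -[Rz n wd 0]/(PMz n wd ^+ 4); move: (PMz n wd) => p; ring.
  eapply tri_asg_seq => /=; first by rewrite r3PM QE; apply: bq; rewrite ger0_norm // ltW.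
  rewrite r3PM QE; eapply tri_asg_seq => /=.
    rewrite r3PM RE; apply: bq; have [q1 q2] := RQz n0 w9 nw ew (leq0n _).
    by move: (Rz n wd 0) (PMz n wd) (Qz n wd) P0 q1 q2; clear; lia.
  rewrite r3PM RE; eapply tri_asg_seq => /=; first exact: b1.
  eapply tri_asg_seq => /=; first exact: b0.
  eapply tri_asg_seq => /=; first exact: b1.
  eapply tri_asg_seq => /=; first exact: b1.
  eapply (@tri_call _ _ _ _ _ _ _ (fun s' => I4 n (vars s') (memory s'))).
    eapply (tri_for (cnt := n) (I := I4)) => //.
    + by rewrite /I4 /= /pack big_ord0.
    + move=> i r4 h4 j4 il ri fr4 _ _ [k1 k2 k3 k4].
      have r4Q : r4 vQ = Qz n wd by rewrite fr4.
      have E1 : pack (Qz n wd) i (fun=> 1) + Qz n wd ^+ i = pack (Qz n wd) i.+1 (fun=> 1).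
        by rewrite packSr mul1r.
      have qi : Qz n wd ^+ i.+1 <= Qz n wd ^+ n by rewrite ler_weXn2l.
      have q0 := exprn_gt0 i.+1 Q0.
      eapply tri_asg_seq => /=.
        rewrite k1 k2 E1; apply: bo.
        have : - Qz n wd ^+ i.+1 < pack (Qz n wd) i.+1 (fun=> 1) < Qz n wd ^+ i.+1.
          apply: (@pack_bound _ Q0 i.+1 _ 1) => //.
          have [q1 q2] := RQz n0 w9 nw ew (leq0n _).
          by move: (Rz n wd 0) (PMz n wd) (Qz n wd) P0 q1 q2; clear; lia.
        by move: (pack _ _ _) (Qz n wd ^+ i.+1) (Qz n wd ^+ n) (offset _ _) qi q0 o2 o3; clear; lia.
      rewrite k1 k2 E1; eapply tri_asg_seq => /=.
        rewrite k2 r4Q -exprSr; apply: bo.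
        by move: (Qz n wd ^+ i.+1) (Qz n wd ^+ n) (offset _ _) qi q0 o2 o3; clear; lia.
      rewrite k2 r4Q -exprSr; eapply tri_asg_seq => /=.
        rewrite k3 -PoszM -expnSr; apply: bq.
        have F4 : (4 ^ n)%N%:Z <= Qz n wd by rewrite PoszX; exact: (Q4z n0 w9 nw ew).
        by apply: le_trans F4; rewrite ger0_norm // lez_nat leq_exp2l.
      rewrite k3 -PoszM -expnSr; eapply tri_asg => /=; rewrite k4 -PoszM -expnSr //.
      apply: (natb n0 w9 nw ew); apply: leq_trans (MB_X n0 ew).
      by rewrite /MBz; apply: leq_pexp2l.
  move=> r4 h4 j4 [/= k1 k2 k3 k4] /= fr4 _.
  have [n4 G4 w4] : [/\ r4 vn = n%:Z, r4 vG = Gz & r4 vw = wd%:Z] by rewrite !fr4.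
  have [P4 m4 PM4] : [/\ r4 vPW = (2 ^ wd)%N%:Z, r4 vm = (mz n wd)%:Z & r4 vPM = PMz n wd] by rewrite !fr4.
  have [Q4 R4] : r4 vQ = Qz n wd /\ r4 vR0 = Rz n wd 0 by rewrite !fr4.
  have cl : (levelsz n wd <= ncells n * levelsz n wd)%N by rewrite leq_pmull // muln_gt0 expn_gt0.
  have rn := reps_gt0 wd n0; have N0 := N_gt0 n0 w9 nw ew.
  have lN : (Nz n wd <= lenz n wd)%N.
    rewrite /lenz; apply: (@leq_trans (repsz n wd * Nz n wd)); first by rewrite leq_pmull // rn.
    by rewrite leq_pmulr.
  have lr : (repsz n wd <= lenz n wd)%N.
    rewrite /lenz; apply: (@leq_trans (repsz n wd * Nz n wd)); first by rewrite leq_pmulr.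
    by rewrite leq_pmulr.
  have big (k : nat) : (k <= tabz n wd)%N -> bounded (Zz n wd) k%:Z.
    by move=> kt; apply: bN; apply: leq_trans kt _; rewrite -addnA leq_addr.
  have lt : (lenz n wd <= tabz n wd)%N by rewrite /tabz leq_addl.
  have tt : (tapez n <= tabz n wd)%N by rewrite /tabz leq_addr.
  have ct : (colz n <= tapez n)%N by rewrite /tapez -addnA leq_addr.
  eapply tri_asg_seq => /=.
    by rewrite k3 -PoszM; apply: bN; rewrite -/(ncells n) leq_addl.
  rewrite k3 -PoszM -/(ncells n); eapply tri_asg_seq => /=.
    rewrite m4 -PoszM -/(levelsz n wd); apply: bN; apply: leq_trans cl _; rewrite -addnA.
    by apply: leq_trans (leq_addl _ _); rewrite leq_addr.
  rewrite m4 -PoszM -/(levelsz n wd); eapply tri_asg_seq => /=.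
    by rewrite -PoszM; apply: bN; rewrite -addnA; apply: leq_trans (leq_addl _ _); rewrite leq_addr.
  rewrite -PoszM; eapply tri_asg_seq => /=.
    by rewrite k3 -!PoszM -/(Nz n wd); apply: big; apply: leq_trans lN lt.
  rewrite k3 -!PoszM -/(Nz n wd); eapply tri_asg_seq => /=.
    by rewrite k3 w4 n4 -PoszM -PoszD -PoszM -/(repsz n wd); apply: big; apply: leq_trans lr lt.
  rewrite k3 w4 n4 -PoszM -PoszD -PoszM -/(repsz n wd); eapply tri_asg_seq => /=.
    by rewrite n4 -PoszM -PoszD -PoszM -PoszD -/(colz n); apply: big; apply: leq_trans ct tt.
  rewrite n4 -PoszM -PoszD -PoszM -PoszD -/(colz n); eapply tri_asg_seq => /=.
    by rewrite n4 -!PoszD -/(tapez n); apply: big.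
  rewrite n4 -!PoszD -/(tapez n).
  have lE : (repsz n wd)%:Z * (Nz n wd)%:Z * (2 * n%:Z + 1) = (lenz n wd)%:Z.
    exact: (congr1 Posz (congr1 (muln (repsz n wd * Nz n wd)) (addn1 (2 * n)))).
  eapply tri_asg_seq => /=; first by rewrite n4 lE; apply: big.
  rewrite n4 lE; eapply tri_asg_seq => /=.
    by rewrite -PoszD -/(tabz n wd); apply: big.
  rewrite -PoszD -/(tabz n wd).
  have QRE : Qz n wd ^+ n * Qz n wd = Qz n wd ^+ n.+1 by rewrite exprSr.
  have QR0 := exprn_gt0 n.+1 Q0.
  eapply tri_asg_seq => /=.
    rewrite k2 Q4 QRE; apply: bo; rewrite /offset; move: (Qz n wd ^+ n.+1) QR0 => q; clear; nia.
  rewrite k2 Q4 QRE; eapply tri_asg => /=.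
    rewrite -/(offset n (Qz n wd)); apply: bo; move: (offset _ _) o3; clear; lia.
  rewrite -/(offset n (Qz n wd)).
  by move=> x; do 23?[case: x => [|x] //=].
by rewrite /K_setup /=; clear; lia.
Qed.

End Setup.

End SetupProgram.
Import SetupProgram.

(** * Polynomial form of the running time *)

Module RunningTime.
Local Open Scope ring_scope.

Section Growth.
Variable q : nat.
Hypothesis q2 : (256 <= q)%N.

Lemma grow_add x y i j : (x <= q ^ i)%N -> (y <= q ^ j)%N -> (x + y <= q ^ (i + j).+1)%N.
Proof.
move=> xi yj; have q1 : (0 < q)%N by lia.
have h1 : (q ^ i <= q ^ (i + j))%N by rewrite leq_pexp2l // leq_addr.
have h2 : (q ^ j <= q ^ (i + j))%N by rewrite leq_pexp2l // leq_addl.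
rewrite expnS; apply: (@leq_trans (2 * q ^ (i + j))%N); first by lia.
by rewrite leq_mul2r; lia.
Qed.

Lemma grow_mul x y i j : (x <= q ^ i)%N -> (y <= q ^ j)%N -> (x * y <= q ^ (i + j))%N.
Proof. by move=> xi yj; rewrite expnD leq_mul. Qed.

Lemma grow_succ x i : (x <= q ^ i)%N -> (x.+1 <= q ^ i.+1)%N.
Proof.
move=> xi; have h1 : (0 < q ^ i)%N by rewrite expn_gt0; apply/orP; left; lia.
by rewrite expnS; move: (q ^ i)%N xi h1 => y; nia.
Qed.

Lemma grow_const x : (x <= 256)%N -> (x <= q ^ 1)%N.
Proof. by move=> xq; rewrite expn1; lia. Qed.

Lemma grow_const2 x : (x <= 65536)%N -> (x <= q ^ 2)%N.
Proof. by move=> xq; apply: leq_trans xq _; rewrite -[65536%N]/(256 ^ 2)%N leq_exp2r. Qed.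
End Growth.

Definition K_total (n e wd : nat) : nat :=
  (n * n + n) * 100 + wd * 100 + n * 200 + 1000 + (lenz n wd * (mz n wd * 24 + 36) + 11) +
  K_search n e wd + (n * 120 + 60).

Definition T_total (n e wd : nat) : nat :=
  K_total n e wd * (2 * (Zz n wd * max_esize (cvp_program e) + 2)).

Lemma max_esize_program e : (max_esize (cvp_program e) <= 256)%N.
Proof. by []. Qed.

(** The running time is a fixed polynomial in quantities at most [q]. The exponent stays an
    existential variable and is computed while the expression is taken apart, so it cannot depend on
    the instance. *)
Lemma T_total_bound : exists k : nat, forall n e wd q, (256 <= q)%N -> (n <= q)%N -> (e <= q)%N ->
  (wd <= q)%N -> (4 ^ n <= q)%N -> (MBz n e <= q)%N -> (T_total n e wd <= q ^ k)%N.
Proof.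
eexists => n e wd q q2 nq eq wq fq mq.
have g1 x : (x <= q)%N -> (x <= q ^ 1)%N by rewrite expn1.
have mq' := max_esize_program e.
rewrite /T_total /K_total /K_search /K_round /K_box /K_trial /Zz /lenz /Nz /repsz /ncells /levelsz /mz.
move: (max_esize _) mq' => me mq'; move: (MBz n e) mq => MB mq; move: (4 ^ n)%N fq => F fq.
repeat match goal with
| |- is_true (addn _ _ <= _)%N => apply: (grow_add q2)
| |- is_true (muln _ _ <= _)%N => apply: (grow_mul (q := q))
| |- is_true ((muln _ _).+1 <= _)%N => apply: (grow_succ q2)
| |- is_true (n <= _)%N => exact: (g1 _ nq)
| |- is_true (e <= _)%N => exact: (g1 _ eq)
| |- is_true (wd <= _)%N => exact: (g1 _ wq)
| |- is_true (F <= _)%N => exact: (g1 _ fq)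
| |- is_true (MB <= _)%N => exact: (g1 _ mq)
| |- is_true (me <= _)%N => exact: (grow_const q2 mq')
| |- _ => by apply: (grow_const2 q2)
end.
Qed.

End RunningTime.
Import RunningTime.

(** * The complete run *)

Module Execution.
Local Open Scope ring_scope.

Lemma econsts_program Z e : (2 ^ e < 2 ^ Z)%N -> (128 * e.+1 < 2 ^ Z)%N -> (128 < 2 ^ Z)%N ->
  consts Z (cvp_program e).
Proof.
move=> h1 h2 h3.
have b0 : (0 < 2 ^ Z)%N by move: h3; clear; lia.
have b1 : (1 < 2 ^ Z)%N by move: h3; clear; lia.
have b2 : (2 < 2 ^ Z)%N by move: h3; clear; lia.
have b4 : (4 < 2 ^ Z)%N by move: h3; clear; lia.
have b3 : (3 < 2 ^ Z)%N by move: h3; clear; lia.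
have b5 : (5 < 2 ^ Z)%N by move: h3; clear; lia.
have b64 : (64 < 2 ^ Z)%N by move: h3; clear; lia.
rewrite /=; move: (2 ^ Z)%N (2 ^ e)%N (128 * e.+1)%N h1 h2 h3 b0 b1 b2 b3 b4 b5 b64 => z p q.
by move=> -> -> -> -> -> -> -> -> -> ->.
Qed.

Section Run.
Variables (n e : nat) (num den : nat -> int) (code : seq int).
Hypotheses (n0 : (0 < n)%N) (e0 : (0 < e)%N).
Hypothesis den1 : forall a, (a < n * n + n)%N -> 1 <= den a.
Local Notation wd := (wdz n e num den).
Local Notation h := (fun i => nth 0 code i).
Hypotheses (h0 : h 0%N = n%:Z) (inp : input_at n num den h).
Hypothesis hX : forall i, (absz (h i) <= X0 n e num den)%N.
Local Notation N := (Nz n wd).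
Local Notation reps := (repsz n wd).
Local Notation s := (2 * n).+1.
Local Notation T := (T_total n e wd).
Local Notation Bz := (Bz n e num den).
Local Notation Tz := (Tz n e num den).
Local Notation raw := (rawv n Bz Tz).

Lemma ME : (2 * M2z n wd = 2 ^ mz n wd)%N.
Proof. have [w9 nw ew _] := setup_hyps num n0 e0 den1; exact: (PM_nat n0 w9 nw ew). Qed.

Definition omega (w : nat -> bool) (j0 p : nat) : N.-tuple (s.-tuple 'I_(2 * M2z n wd)) :=
  block s N ME (fun a => dval (fun b => w (coin_pos n wd j0 a b)) (mz n wd)) p.

Lemma t_main : exists2 j0, (j0 <= K_setup n e num den)%N & forall w : nat -> bool,
  exists s', [/\ ev (Zz n wd) w (cvp_program e) (State (fun=> 0) h 0) s',
    (clock s' <= K_total n e wd)%N & exists (lo : nat) (v : nat -> int),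
    [/\ lo = 0%N \/ no_hit e num den (omega w j0) lo,
        forall i, (i < n)%N -> memory s' (2 * i)%N = v i + Tz i /\ memory s' (2 * i).+1 = Gz n e den &
        lo.+1 = (2 ^ wd)%N \/ (lo.+1 < 2 ^ wd)%N /\ exists U, forall i, (i < n)%N ->
          v i = raw U (-1) i /\ `|v i| <= D_of e lo.+1]].
Proof.
have [w9 nw ew eb] := setup_hyps num n0 e0 den1.
have /andP[x1 x2] := X0_bounds num e0 den1.
(* Running the setup on constant coins fixes the starting step of the tape phase before the actual
   coins [w] are given. *)
have [s1 [E1 l1 C1]] := @t_setup n e num den (fun=> false) n0 e0 den1 h h0 inp.
rewrite /= add0n in l1; exists (clock s1) => // w.
have {}E1 : ev (Zz n wd) w (p_setup e) (State (fun=> 0) h 0) s1 by apply: ev_coinfree E1.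
have m1 : memory s1 = h by apply: (ev_mem E1).
case: s1 E1 l1 C1 m1 => r1 h1 j0 /= E1 l1 C1 m1; rewrite {}m1 in E1 *.
have bh a : bounded (Zz n wd) (h a).
  have : bounded (Zz n wd) (X0 n e num den)%:Z.
    apply: (natb n0 w9 nw ew); apply: leq_trans (ltnW x2) (PW_X wd n0).
  by rewrite /bounded /=; apply: leq_ltn_trans; exact: hX.
have [s2 [E2 /eqP l2 [M1 [M2 F2]]]] := @t_tape n e wd den w n0 w9 nw ew r1 h j0 C1.
case: s2 E2 l2 M1 M2 F2 => r2 h2 j2 /= E2 l2 M1 M2 F2.
have C2 : cst (cvz n e wd den) r2 by move=> x x23; rewrite F2 // C1.
have inp2 : input_at n num den h2.
  move=> a aa; rewrite !M1; first exact: inp.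
    by rewrite /tapez /colz; move: aa; clear; lia.
  by rewrite /tapez /colz; move: aa; clear; lia.
have tb : (tabz n wd = tapez n + lenz n wd)%N by [].
pose dflt : s.-tuple 'I_(2 * M2z n wd) := [tuple symbol ME 0 | i < s].
have tp2 : tape_at h2 dflt (omega w j0).
  move=> p i k pr iN kn.
  have -> : (tapez n + p * (N * s) + i * s + k = tapez n + (p * (N * s) + i * s + k))%N.
    by rewrite !addnA.
  rewrite M2; last by rewrite /lenz; exact: (mixed_radix_lt pr iN kn).
  congr Posz; rewrite /dig /omega; symmetry; apply: nth_block => //; exact: dval_lt.
have bh2 a : bounded (Zz n wd) (h2 a).
  case: (boolP ((a < tapez n)%N || (tabz n wd <= a)%N)) => [o|no].
    by rewrite M1 //; exact: bh.
  have [a1 a2] : (tapez n <= a)%N /\ (a < tabz n wd)%N.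
    by move: no; move: (tapez n) (tabz n wd); clear; lia.
  have al : (a - tapez n < lenz n wd)%N.
    by move: a1 a2; rewrite tb; move: (tapez n) (lenz n wd); clear; lia.
  rewrite -(subnKC a1) M2 // /bounded; apply: leq_trans (dval_lt _ _) _.
  by rewrite leq_exp2l // /Zz; clear; nia.
have [s3 [E3 l3 [inp3 bh3 [lo [lo1 lo2 lo3]]]]] := @t_search n e wd num den w n0 w9 nw ew eb r2 h2 j2 dflt (omega w j0) C2 inp2 tp2 bh2.
have C3 : cst (cvz n e wd den) (vars s3).
  have fr y : y \notin writes (p_search e) -> vars s3 y = r2 y.
    by move=> ny; apply: (ev_vars E3).
  exact: (cst_frame fr isT C2).
case: s3 E3 l3 inp3 bh3 lo3 C3 => r3 h3 j3 /= E3 l3 inp3 bh3 lo3 C3.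
have Gb : 0 <= Gz n e den < (2 ^ wd)%N%:Z.
  by have := G_le_X0 num e0 den1; move: x2; move: (Gz n e den) (X0 n e num den) (2 ^ wd)%N; clear; lia.
have [v [vb vX v3]] : exists v : nat -> int, [/\ r3 vbest = pack (Qz n wd) n v,
    forall i, (i < n)%N -> `|v i| <= (Xn n wd)%:Z ^+ 2 &
    lo.+1 = (2 ^ wd)%N \/ (lo.+1 < 2 ^ wd)%N /\ exists U, forall i, (i < n)%N ->
          v i = raw U (-1) i /\ `|v i| <= D_of e lo.+1].
  case: lo3 => [[l4 b0]|[l4 [U [U1 U2]]]].
    exists (fun=> 0); split; last by left.
      by rewrite b0 /pack big1 // => i _; rewrite mul0r.
    by move=> i _; rewrite normr0 exprn_ge0.
  exists (raw U (-1)); split=> //.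
    move=> i il; apply: le_trans (U1 i il) _.
    have /andP[//] : 0 <= D_of e lo.+1 <= (Xn n wd)%:Z ^+ 2 by apply: D_of_le.
  by right; split=> //; exists U => i il; split=> //; exact: U1.
have [s4 [E4 l4 mem]] := @t_output n e wd num den w n0 w9 nw ew eb r3 h3 j3 v C3 Gb vb vX inp3 bh3.
exists s4; split.
- exact: EvSeq E1 (EvSeq E2 (EvSeq E3 E4)).
- move: l1 l3 l4; rewrite /= l2 /K_total /K_setup; move: (lenz n wd * _)%N (K_search n e wd); clear; lia.
- by exists lo, v.
Qed.

Lemma run_main : exists2 j0, (j0 <= K_setup n e num den)%N & forall coins : T.-tuple bool,
  let c := run (compile (cvp_program e) 0) code coins in
  [/\ halted (compile (cvp_program e) 0) c, (cost c <= T)%N & exists (lo : nat) (v : nat -> int),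
    [/\ lo = 0%N \/ no_hit e num den (omega (nth false coins) j0) lo,
        forall i, (i < n)%N -> heap c (2 * i)%N = v i + Tz i /\ heap c (2 * i).+1 = Gz n e den &
        lo.+1 = (2 ^ wd)%N \/ (lo.+1 < 2 ^ wd)%N /\ exists U, forall i, (i < n)%N ->
          v i = raw U (-1) i /\ `|v i| <= D_of e lo.+1]].
Proof.
have [w9 nw ew eb] := setup_hyps num n0 e0 den1.
have /andP[x1 x2] := X0_bounds num e0 den1.
have PX := PW_X wd n0.
have [j0 jl M] := t_main; exists j0 => // coins c.
have [s' [E cl [lo [v [l1 l2 l3]]]]] := M (nth false coins).
have bN k : (k <= 2 ^ wd)%N -> (k < 2 ^ Zz n wd)%N.
  by move=> kw; have := natb n0 w9 nw ew (leq_trans kw PX).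
have [||||H1 H2 H3] := @run_of_ev (Zz n wd) (cvp_program e) code T coins s' _ _ _ E.
- exact: (Z_gt0 n0 w9 nw ew).
- apply: econsts_program.
  + by apply: bN; apply: leq_trans ew; rewrite leq_pmull.
  + by apply: bN; apply: leq_trans ew; rewrite leq_mul2l /=; exact: ltn_expl.
  + by apply: bN; apply: leq_trans ew; rewrite leq_pmulr // expn_gt0.
- move=> i; apply: leq_ltn_trans (hX i) (bN _ (ltnW x2)).
- by rewrite /T_total leq_mul2r cl orbT.
by split=> //; exists lo, v; rewrite H3.
Qed.

End Run.

End Execution.
Import Execution.

From mathcomp Require Import boolp.

(** * The probability of an unlucky tape *)

Module Luck.
Local Open Scope ring_scope.

Section Luck.
Variables (n e : nat) (num den : nat -> int).
Hypotheses (n0 : (0 < n)%N) (e0 : (0 < e)%N).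
Hypothesis den1 : forall a, (a < n * n + n)%N -> 1 <= den a.
Local Notation wd := (wdz n e num den).
Local Notation N := (Nz n wd).
Local Notation reps := (repsz n wd).
Local Notation s := (2 * n).+1.
Local Notation T := (T_total n e wd).
Local Notation m := (mz n wd).
Local Notation len := (reps * N * s)%N.
Local Notation H := (s.-tuple 'I_(2 * M2z n wd)).
Local Notation raw := (rawv n (Bz n e num den) (Tz n e num den)).
Local Notation ME := (@ME n e num den n0 e0 den1).
Local Notation omega := (@omega n e num den n0 e0 den1).

Variables (d : nat) (us : nat -> int).
Hypotheses (dw : (d < 2 ^ wd)%N) (ub : forall i, (i < n)%N -> `|raw us (-1) i| <= d%:Z).

(** All sufficiently large radii are included, because the radii that the search visits depend on
    the tape. With [d] the scaled minimum distance, the second condition says that the closest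
    vector lies in the box of radius [r]. *)
Definition good_omega (om : nat -> N.-tuple H) := forall r : nat, (0 < r < 2 ^ wd)%N ->
  (d <= 64 * 2 ^ e * r)%N -> exists2 p, (p < reps)%N &
  exists2 beta, (beta < MBz n e)%N & hit_box e num den r%:Z beta (om p).

Lemma coin_pos_lt j0 a b : (j0 <= K_setup n e num den)%N -> (a < len)%N -> (b < m)%N ->
  (coin_pos n wd j0 a b < T)%N.
Proof.
move=> jk al bm; apply: (@leq_trans (K_total n e wd)); last by rewrite /T_total leq_pmulr // muln_gt0 addn_gt0 orbT.
rewrite -/(lenz n wd) in al; rewrite /K_total /coin_pos.
have : (a * (m * 24 + 36) + 21 + b * 24 < lenz n wd * (m * 24 + 36))%N.
  apply: (@leq_trans (a.+1 * (m * 24 + 36))%N); first by rewrite mulSn; move: bm; move: (a * _)%N; clear; lia.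
  by rewrite leq_mul2r al orbT.
move: jk; rewrite /K_setup; move: (lenz n wd * _)%N (a * _)%N (K_search _ _ _); clear; lia.
Qed.

Lemma coin_pos_inj j0 a b a' b' : (b < m)%N -> (b' < m)%N ->
  coin_pos n wd j0 a b = coin_pos n wd j0 a' b' -> a = a' /\ b = b'.
Proof.
move=> bm bm'; rewrite /coin_pos -!addnA => /addnI E.
have u (x y : nat) : (y < m)%N -> ((x * (m * 24 + 36) + (21 + y * 24)) %/ (m * 24 + 36) = x)%N.
  move=> ym; rewrite divnMDl; last by rewrite addn_gt0 orbT.
  by rewrite divn_small ?addn0 //; move: ym; clear; lia.
have aa : a = a' by rewrite -(u a b bm) E u.
by rewrite aa in E *; split=> //; move: E => /addnI; clear; lia.
Qed.

(** The positions of the tape bits are distinct, so these bits are uniform ([card_fiber_inj]), and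
    so are the digits decoded from them ([card_decode]); [union_bound] then applies to the
    repetitions. *)
Lemma card_unlucky j0 : (j0 <= K_setup n e num den)%N ->
  (2 ^ n * #|[pred coins : T.-tuple bool | ~~ `[< good_omega (omega (nth false coins) j0) >] ]|
   <= 2 ^ T)%N.
Proof.
move=> jk; have [w9 nw ew eb] := setup_hyps num n0 e0 den1.
have [vs [v1 v2]] : exists us', (forall i, (i < n)%N -> raw us' (-1) i = raw us (-1) i) /\
    forall j, (j < n)%N -> (absz (us' j) <= M2z n wd)%N.
  apply: bounded_coefficients => // i il; apply: le_lt_trans (ub il) _.
  by rewrite ltz_nat.
have [P PP] : exists P : nat -> pred (N.-tuple H), forall r,
    (#|{: N.-tuple H}| <= 4 * 4 ^ n * #|P r|)%N /\ ((0 < r < 2 ^ wd)%N ->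
    (d <= 64 * 2 ^ e * r)%N -> forall t, P r t ->
    exists2 beta, (beta < MBz n e)%N & hit_box e num den r%:Z beta t).
  have /choice[P PP] : forall r : nat, exists P : pred (N.-tuple H),
    (#|{: N.-tuple H}| <= 4 * 4 ^ n * #|P|)%N /\ ((0 < r < 2 ^ wd)%N ->
    (d <= 64 * 2 ^ e * r)%N -> forall t, P t ->
    exists2 beta, (beta < MBz n e)%N & hit_box e num den r%:Z beta t); last by exists P.
  move=> r; case: (boolP ((0 < r < 2 ^ wd)%N && (d <= 64 * 2 ^ e * r)%N)) => [/andP[r1 dr]|no].
    have [||Pr Pc Ph] := @card_hits n e wd num den n0 w9 nw ew eb r%:Z vs _ v2.
    - by move: r1; clear; lia.
    - move=> i il; rewrite v1 //; apply: le_trans (ub il) _.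
      by rewrite -[2 ^+ e]/(2%N%:Z ^+ e) -PoszX -!PoszM lez_nat.
    by exists Pr; split.
  (* For radii about which nothing is claimed every trial counts as a success, so that the union
     bound can run over all r below 2^wd. *)
  exists predT; split; last by move=> r1 dr; rewrite r1 dr in no.
  by rewrite leq_pmull // muln_gt0 expn_gt0.
pose bad := [pred om : reps.-tuple (N.-tuple H) | [exists r : 'I_(2 ^ wd), all (predC (P r)) om]].
have UB : (2 ^ n * #|bad| <= #|{: N.-tuple H}| ^ reps)%N.
  apply: (@union_bound _ (2 ^ wd) P (4 * 4 ^ n) wd n) => //.
    by rewrite muln_gt0 expn_gt0.
  by move=> r _; have [] := PP r.
have lt (ab : 'I_len * 'I_m) : (coin_pos n wd j0 ab.1 ab.2 < T)%N.
  by apply: coin_pos_lt.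
pose f ab : 'I_T := Ordinal (lt ab).
have fi : injective f.
  move=> [a b] [a' b'] /(congr1 val) /= E.
  have [/val_inj-> /val_inj->] := coin_pos_inj (ltn_ord b) (ltn_ord b') E; by [].
have N0 := N_gt0 n0 w9 nw ew.
pose dec := @decode m s N reps _ ME.
have F := card_fiber_inj fi [pred g | bad (dec g)].
rewrite (@card_decode m s N reps _ ME isT N0 bad) in F.
have cK : (#|{: N.-tuple H}| ^ reps = 2 ^ #|{: 'I_len * 'I_m}|)%N.
  rewrite !card_tuple card_ord card_prod !card_ord ME -!expnM; congr expn; ring.
have sub : (#|[pred coins : T.-tuple bool | ~~ `[< good_omega (omega (nth false coins) j0) >] ]| <=
   #|[pred c : T.-tuple bool | [pred g | bad (dec g)] [ffun i => tnth c (f i)] ]|)%N.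
  apply: subset_leq_card; apply/subsetP => c; rewrite inE => ng; rewrite inE.
  set g := [ffun i => tnth c (f i)]; change (is_true (bad (dec g))).
  case: (boolP (bad (dec g))) => // nb; exfalso; move/negP: ng; apply; apply/asboolP => r r1 dr.
  have rl : (r < 2 ^ wd)%N by case/andP: r1.
  have [p Pt] : exists p : 'I_reps, P r (tnth (dec g) p).
    apply/existsP; apply: contraR nb; rewrite negb_exists => /forallP h.
    by apply/existsP; exists (Ordinal rl); apply/all_tnthP => p; exact: h.
  have E : tnth (dec g) p = omega (nth false c) j0 p.
    rewrite /dec /decode tnth_mktuple; apply: eq_block => // a al; apply: eq_dval => b bm.
    by rewrite /lookup !insubT /= ffunE /= (tnth_nth false).
  exists (nat_of_ord p); first exact: ltn_ord.
  by rewrite -E; exact: ((PP r).2 r1 dr _ Pt).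
rewrite cK in UB; have I0 : (0 < 2 ^ #|{: 'I_len * 'I_m}|)%N by rewrite expn_gt0.
rewrite -(leq_pmul2r I0) -mulnA; apply: leq_trans (leq_mul (leqnn _) (leq_mul sub (leqnn _))) _.
by rewrite F mulnCA leq_mul2l UB orbT.
Qed.

End Luck.

End Luck.
Import Luck.

From mathcomp Require Import classical_sets reals normedtype exp.

(** * Rational instances and their integer scaling *)

Module Instances.
Local Open Scope ring_scope.
Local Open Scope ring_scope.

Lemma nth_allpairs (S T U : Type) (f : S -> T -> U) xs ys x0 y0 z0 i j :
  (i < size xs)%N -> (j < size ys)%N ->
  nth z0 [seq f x y | x <- xs, y <- ys] (i * size ys + j) = f (nth x0 xs i) (nth y0 ys j).
Proof.
elim: xs i => // x xs IH [|i] ix jy; rewrite /= nth_cat size_map.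
  by rewrite mul0n add0n jy (nth_map y0).
have -> : (i.+1 * size ys + j < size ys)%N = false by rewrite mulSn; move: (i * _)%N; clear; lia.
by rewrite mulSn -addnA addKn IH.
Qed.

Lemma nth_flatten_pairs (qs : seq rat) a : (a < size qs)%N ->
  nth 0 (flatten [seq [:: numq q; denq q] | q <- qs]) (2 * a)%N = numq (nth 0 qs a) /\
  nth 0 (flatten [seq [:: numq q; denq q] | q <- qs]) (2 * a).+1 = denq (nth 0 qs a).
Proof.
elim: qs a => // q qs IH [|a] al //.
by have := IH a al; rewrite mulnS.
Qed.

Lemma size_flatten_pairs (qs : seq rat) :
  size (flatten [seq [:: numq q; denq q] | q <- qs]) = (2 * size qs)%N.
Proof. by elim: qs => //= q qs ->; rewrite mulnS. Qed.

Lemma dist_infP (n : nat) (v w : 'cV[rat]_n) c : 0 <= c ->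
  dist_inf v w <= c <-> forall i, `|v i ord0 - w i ord0| <= c.
Proof.
move=> c0; rewrite /dist_inf mx_normrE; split=> [/bigmax_leP[_ H] i|H].
  by have := H (i, ord0) isT; rewrite !mxE.
by apply/bigmax_leP; split=> // -[i j] _; rewrite !mxE /= ord1.
Qed.

Lemma dist_inf_ge0 (n : nat) (v w : 'cV[rat]_n) : 0 <= dist_inf v w.
Proof. by rewrite /dist_inf mx_normrE; elim/big_ind: _ => // x y x0 y0; rewrite le_max x0. Qed.

Section Instance.
Variables (n e : nat) (A : 'M[rat]_n) (t : 'cV[rat]_n).
Hypotheses (n0 : (0 < n)%N) (e0 : (0 < e)%N).
Local Notation tot := (n * n + n)%N.
Local Notation qs := (entries A ++ entries t).
Definition numer (a : nat) : int := numq (nth 0 qs a).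
Definition denom (a : nat) : int := denq (nth 0 qs a).
Local Notation code := (instance_code A t).

Lemma size_qs : size qs = tot.
Proof. by rewrite size_cat /entries !size_allpairs !size_enum_ord muln1. Qed.

Lemma nth_A (i j : 'I_n) : nth 0 qs (i * n + j)%N = A i j.
Proof.
rewrite nth_cat /entries size_allpairs !size_enum_ord.
have -> : (i * n + j < n * n)%N by have := ltn_ord i; have := ltn_ord j; move: (val i) (val j); clear; nia.
have := @nth_allpairs _ _ _ (fun i j => A i j) (enum 'I_n) (enum 'I_n) i j 0 i j.
by rewrite !size_enum_ord !nth_ord_enum; apply.
Qed.

Lemma nth_t (i : 'I_n) : nth 0 qs (n * n + i)%N = t i ord0.
Proof.
rewrite nth_cat /entries size_allpairs !size_enum_ord ltnNge leq_addr /= addKn.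
have := @nth_allpairs _ _ _ (fun i j => t i j) (enum 'I_n) (enum 'I_1) i ord0 0 i 0%N.
rewrite !size_enum_ord muln1 addn0 nth_ord_enum (ord1 (nth _ _ _)); by apply.
Qed.

Lemma denom1 a : (a < tot)%N -> 1 <= denom a.
Proof. by move=> _; exact: denq_gt0. Qed.

Lemma input_code : input_at n numer denom (fun i => nth 0 code i).
Proof.
move=> a aa; have [] := @nth_flatten_pairs qs a; first by rewrite size_qs.
by rewrite /numer /denom => <- <-.
Qed.

Local Notation Gz := (Gz n e denom).
Local Notation X0 := (X0 n e numer denom).
Local Notation Bz := (Bz n e numer denom).
Local Notation Tz := (Tz n e numer denom).
Local Notation raw := (rawv n Bz Tz).
Local Notation entry := (entry n e numer denom).
Local Notation unit_ := (128 * (2 ^ e)%N%:Z).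

Lemma G_dvd a : (a < tot)%N -> exists k, Gz = denom a * (unit_ * k).
Proof.
move=> aa; exists (\prod_(b < tot | b != Ordinal aa) denom b).
by rewrite /Magnitudes.Gz (bigD1 (Ordinal aa)) //=; ring.
Qed.

Lemma entry_dvd a : (a < tot)%N -> exists k, entry a = unit_ * k.
Proof.
move=> aa; have [k Gk] := G_dvd aa; exists (numer a * k).
by rewrite /Magnitudes.entry Gk mulKz; [ring|rewrite gt_eqF // denq_gt0].
Qed.

Lemma entryE a : (a < tot)%N -> (entry a)%:~R = Gz%:~R * nth 0 qs a :> rat.
Proof.
move=> aa; have [k Gk] := G_dvd aa; rewrite /Magnitudes.entry Gk mulKz; last by rewrite gt_eqF // denq_gt0.
rewrite -[nth 0 qs a]divq_num_den -/(numer a) -/(denom a) !intrM.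
have d0 : (denom a)%:~R != 0 :> rat by rewrite intr_eq0 gt_eqF // denq_gt0.
by move: ((denom a)%:~R : rat) d0 (unit_%:~R : rat) (k%:~R : rat) => x x0 y z; field.
Qed.

Lemma G_gt0 : 0 < Gz.
Proof using e0.
by have [_] := G_ge e0 denom1; apply: lt_le_trans.
Qed.

Lemma code_le i : (absz (nth 0%R code i) <= X0)%N.
Proof using n0 e0.
have [G1 G2] := andP (G_le_X0 numer e0 denom1).
rewrite -lez_nat; case: i => [|i].
  rewrite abszE /= (X0E numer e0 denom1); have := sq_ge0 numer tot; have [_ g2] := G_ge e0 denom1.
  by move: (\sum_(a < tot) _) Gz g2; clear; nia.
have [i2|i2] := ltnP i (2 * tot); last first.
  by rewrite -[code]/(n%:Z :: flatten [seq [:: numq q; denq q] | q <- qs]) /= nth_default // size_flatten_pairs size_qs.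
have a2 : (i %/ 2 < tot)%N by rewrite ltn_divLR // mulnC.
have [E1 E2] := @nth_flatten_pairs qs (i %/ 2) ltac:(by rewrite size_qs).
have iE := divn_eq i 2; have : (i %% 2 < 2)%N by rewrite ltn_pmod.
case: (i %% 2)%N iE => [|[|//]] iE _.
  rewrite /= iE addn0 mulnC E1 -/(numer (i %/ 2)).
  have : numer (i %/ 2) * numer (i %/ 2) <= \sum_(a < tot) numer a * numer a.
    rewrite (bigD1 (Ordinal a2)) //= lerDl; apply: sumr_ge0 => b _; by rewrite -expr2 sqr_ge0.
  rewrite abszE (X0E numer e0 denom1); have := sq_ge0 numer tot; have [_ g2] := G_ge e0 denom1.
  move: (\sum_(a < tot) _) (numer (i %/ 2)) Gz g2 => S x g g2 S0 xS.
  by apply: (@le_trans _ _ S); [nia|nia].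
rewrite /= iE addn1 mulnC E2 -/(denom (i %/ 2)); apply: le_trans G2.
have [k Gk] := G_dvd a2; have := G_gt0; rewrite Gk abszE.
have := denom1 a2; move: (denom _) (unit_ * k) => x y x1 xy0.
have y1 : 0 < y by rewrite -(pmulr_rgt0 _ (x1 : 0 < x)).
by rewrite (ger0_norm (le_trans ler01 x1)); apply: ler_peMr => //; exact: le_trans ler01 x1.
Qed.

Definition vec (U : nat -> int) : 'cV[rat]_n := A *m map_mx intr (\col_i U i).

Lemma rawE U (i : 'I_n) : (raw U (-1) i)%:~R = Gz%:~R * (vec U i ord0 - t i ord0).
Proof.
have ti : (n * n + i < tot)%N by rewrite ltn_add2l.
rewrite /rawv intrD intrM /Tz entryE // nth_t mulrBr mxE mulr_sumr (rmorph_sum intr) /=.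
rewrite mulN1r; congr (_ - _); apply: eq_bigr => j _; rewrite !mxE intrM /Bz entryE ?nth_A ?mulrA //.
by have := ltn_ord i; have := ltn_ord j; move: (val i) (val j); clear; nia.
Qed.

(** The distance between lattice vector and target, multiplied by [Gz]. *)
Definition dU (U : nat -> int) : nat := \max_(i < n) absz (raw U (-1) i).

Lemma dU_attained U : exists i : 'I_n, dU U = absz (raw U (-1) i).
Proof.
have [|i _ E] := @eq_bigmax_cond _ [pred i : 'I_n | true] (fun i : 'I_n => absz (raw U (-1) i)).
  by rewrite (eq_card (B := predT)) // card_ord.
by exists i.
Qed.

Lemma dU_dist U : (dU U)%:R <= Gz%:~R * dist_inf (vec U) t.
Proof using n0 e0.
have [i ->] := dU_attained U; rewrite -[_%:R]/((absz (raw U (-1) i))%:Z%:~R) abszE intr_norm rawE.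
rewrite normrM gtr0_norm ?ltr0z ?G_gt0 // ler_pM2l ?ltr0z ?G_gt0 //.
by have /(dist_infP _ _ (dist_inf_ge0 _ _)) := lexx (dist_inf (vec U) t); apply.
Qed.

(** Scaled distances are natural numbers, so a minimum exists even when [A] is singular. *)
Lemma exists_min : exists us, forall U, (dU us <= dU U)%N.
Proof.
have ex : exists k, `[< exists U, dU U = k >] by exists (dU (fun=> 0)); apply/asboolP; exists (fun=> 0).
case: (ex_minnP ex) => k /asboolP[us <-] H; exists us => U; apply: H; apply/asboolP; by exists U.
Qed.

Lemma closest_min us : (forall U, (dU us <= dU U)%N) -> closest A t (vec us).
Proof using n0 e0.
move=> H; split=> [|w' [x ->]]; first by exists (\col_i us i).
pose U (j : nat) : int := if insub j is Some k then x k ord0 else 0.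
have -> : A *m map_mx intr x = vec U.
  congr (_ *m map_mx intr _); apply/colP => i; by rewrite !mxE /U valK.
have G0 : 0 < Gz%:~R :> rat by rewrite ltr0z G_gt0.
apply/(dist_infP _ _ (dist_inf_ge0 _ _)) => i.
rewrite -(ler_pM2l G0) -{1}(gtr0_norm G0) -normrM -rawE -intr_norm; apply: le_trans (dU_dist U).
rewrite -[_%:R]/((dU U)%:Z%:~R) ler_int -abszE lez_nat; apply: leq_trans (H U).
exact: (leq_bigmax i).
Qed.

(** Comparison with the lattice vector 0, whose scaled distance is the largest entry of the
    target. *)
Lemma min_lt us : (forall U, (dU us <= dU U)%N) -> (dU us < 2 ^ wdz n e numer denom)%N.
Proof using n0 e0.
move=> H; apply: leq_ltn_trans (H (fun=> 0)) _; have [i ->] := dU_attained (fun=> 0).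
have [_ _ _ eb] := setup_hyps numer n0 e0 denom1.
have := eb (n * n + i)%N; rewrite ltn_add2l => /(_ (ltn_ord i)); rewrite -/(Tz i).
rewrite /rawv big1 => [|j _]; last by rewrite mulr0.
by move: (Tz i); clear; lia.
Qed.

Lemma raw_dvd U i : (i < n)%N -> exists k, raw U (-1) i = unit_ * k.
Proof.
move=> il; have [k kE] := @entry_dvd (n * n + i)%N ltac:(by rewrite ltn_add2l).
have [f fE] : exists f : 'I_n -> int, forall j : 'I_n, Bz i j = unit_ * f j.
  have /choice[f fE] : forall j : 'I_n, exists k, Bz i j = unit_ * k; last by exists f.
  by move=> j; apply: entry_dvd; have := ltn_ord j; move: il; move: (val j); clear; nia.
exists (\sum_(j < n) f j * U j - k); rewrite /rawv /Tz kE mulrBr mulr_sumr mulN1r; congr (_ - _).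
by apply: eq_bigr => j _; rewrite fE mulrA.
Qed.

(* Distances are multiples of 128 2^e, twice the resolution 64 2^e of the search. *)
Lemma search_gap us U lo : (lo = 0 \/ 64 * 2 ^ e * lo < dU us)%N ->
  (forall i, (i < n)%N -> `|raw U (-1) i| <= D_of e lo.+1) ->
  (2 ^ e * dU U <= (2 ^ e + 1) * dU us)%N.
Proof using n0 e0.
move=> lo1 UD; have [i Ei] := dU_attained U; have [k kE] := raw_dvd U (ltn_ord i).
have [i' Ei'] := dU_attained us; have [k' kE'] := raw_dvd us (ltn_ord i').
have := UD i (ltn_ord i); rewrite /D_of kE => Dk.
rewrite Ei Ei' kE kE' in lo1 *; have p2 : (2 <= 2 ^ e)%N by rewrite -{1}(expn1 2) leq_exp2l.
rewrite !abszM; rewrite !abszM in lo1; move: (2 ^ e)%N p2 Dk lo1 => p p2 Dk.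
rewrite !normrM -!abszE in Dk; rewrite -[`|128|%N]/128%N /= in Dk *.
move: (absz k) (absz k') Dk => x y Dk; clear UD; case: lo Dk => [|lo] Dk.
  (* For lo = 0 the accepted distance is at most 64 (2^e + 1), which is below the unit 128 2^e since
     e is positive; being a multiple of the unit, it is 0. *)
  move=> _; have -> : x = 0%N; last by rewrite !muln0.
  by case: x Dk => // x; move: p2; clear; nia.
case=> [//|lt].
(* With the failed radius written as [lo.+1], the minimum 128 2^e y exceeds 64 2^e times it, hence 2
   y exceeds it and is at least the accepted radius [lo.+2]. *)
have yl : (lo.+2 <= 2 * y)%N.
  have p0 : (0 < 64 * p)%N by move: p2; clear; lia.
  by rewrite -(ltn_pmul2l p0) (_ : 64 * p * (2 * y) = 128 * p * y)%N //; clear; ring.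
have xl : (128 * p * x <= 64 * (p + 1) * lo.+2)%N by move: Dk; clear; nia.
apply: (@leq_trans (p * (64 * (p + 1) * lo.+2))); first by rewrite leq_mul2l xl orbT.
rewrite (_ : p * (64 * (p + 1) * lo.+2) = 64 * p * (p + 1) * lo.+2)%N; last by clear; ring.
rewrite (_ : (p + 1) * (128 * p * y) = 64 * p * (p + 1) * (2 * y))%N; last by clear; ring.
by rewrite leq_mul2l yl orbT.
Qed.

End Instance.

End Instances.
Import Instances.

Local Open Scope ring_scope.
Local Open Scope ring_scope.

(** * The running time in terms of the encoding length *)

Section Size.
Variables (n e : nat) (A : 'M[rat]_n) (t : 'cV[rat]_n).
Hypotheses (n0 : (0 < n)%N) (e0 : (0 < e)%N).
Local Notation tot := (n * n + n)%N.
Local Notation num := (numer A t).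
Local Notation den := (denom A t).
Local Notation b := (encoding_length A t).

Lemma bitlen_gt z : (absz z < 2 ^ (bitlen z).-1)%N.
Proof. by rewrite /bitlen /= trunc_log_ltn. Qed.

Lemma encoding_lengthE :
  b = (bitlen n%:Z + \sum_(a < tot) (bitlen (num a) + bitlen (den a)))%N.
Proof.
rewrite /encoding_length /instance_code big_cons; congr addn.
rewrite big_flatten /= big_map (big_nth 0) size_qs big_mkord; apply: eq_bigr => a _.
by rewrite !big_cons big_nil addn0.
Qed.

Lemma n_le_b : (0 < n <= b)%N.
Proof.
rewrite n0 encoding_lengthE; apply: leq_trans (leq_addl _ _).
apply: (@leq_trans (\sum_(a < tot) 1)%N); last by apply: leq_sum => a _.
by rewrite sum_nat_const card_ord muln1 leq_addl.
Qed.

Lemma sqr_bitlen z : z * z + 1 <= (2 ^ (2 * bitlen z))%N%:Z.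
Proof.
have := bitlen_gt z; have : (2 ^ (bitlen z).-1 <= 2 ^ bitlen z)%N by rewrite leq_exp2l // leq_pred.
move=> h1 h2; have h3 := leq_trans h2 h1; rewrite mulnC expnM.
move: (2 ^ bitlen z)%N h3 => p zp; rewrite !expnS expn0 muln1 PoszM.
have : `|z| < p%:Z by rewrite -abszE ltz_nat.
have : z * z = `|z| * `|z| by rewrite -normrM ger0_norm // -expr2 sqr_ge0.
move=> ->; have : 0 <= `|z| by []; move: `|z| p%:Z; clear; nia.
Qed.

(** Sums and products are bounded by powers of two whose exponents are sums of bit lengths. This
    gives wd <= 2 b + 8 + e, and all three terms are multiples of at most b e. *)
Lemma wd_le : (wdz n e num den <= 11 * b * e)%N.
Proof.
pose sn i := (bitlen n%:Z + \sum_(a < i) bitlen (num a))%N.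
pose sd i := (\sum_(a < i) bitlen (den a))%N.
have S i : n%:Z + 2 + \sum_(a < i) num a * num a <= (2 ^ (2 * sn i))%N%:Z.
  elim: i => [|i IH].
    rewrite big_ord0 addr0 /sn big_ord0 addn0; have := sqr_bitlen n%:Z.
    have := bitlen_gt n%:Z; rewrite /= => h1.
    have : (2 ^ (trunc_log 2 n).+1 * 4 <= 2 ^ (2 * bitlen n%:Z))%N.
      by rewrite -[4%N]/(2 ^ 2)%N -expnD leq_exp2l // /bitlen /=; clear; lia.
    by move: h1; rewrite /bitlen /=; move: (2 ^ (trunc_log 2 n).+1)%N (2 ^ _)%N; clear; lia.
  rewrite big_ord_recr /= /sn big_ord_recr /= addnA -/(sn i) mulnDr expnD PoszM.
  have := sqr_bitlen (num i); have s0 := sq_ge0 num i.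
  have : 0 <= num i * num i by rewrite -expr2 sqr_ge0.
  move: (num i * num i) (2 ^ (2 * bitlen (num i)))%N%:Z (2 ^ (2 * sn i))%N%:Z IH s0 (le0z_nat n).
  move: (\sum_(a < i) _) n%:Z; clear; nia.
have D i : (i <= tot)%N -> \prod_(a < i) den a <= (2 ^ sd i)%N%:Z.
  elim: i => [|i IH] il; first by rewrite big_ord0 /sd big_ord0.
  rewrite big_ord_recr /= /sd big_ord_recr /= -/(sd i) expnD PoszM; apply: ler_pM.
  - by apply: prodr_ge0 => a _; rewrite ltW // denq_gt0.
  - by rewrite ltW // denq_gt0.
  - exact: IH (ltnW il).
  have := bitlen_gt (den i); have : (2 ^ (bitlen (den i)).-1 <= 2 ^ bitlen (den i))%N by rewrite leq_exp2l // leq_pred.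
  by move: (den i) (2 ^ _)%N (2 ^ bitlen _)%N => z p q; clear; lia.
have bE : b = (sn tot + sd tot)%N.
  by rewrite encoding_lengthE big_split /= /sn /sd addnA.
have /andP[x1 _] := X0_bounds num e0 (@denom1 n A t).
have X : (X0 n e num den <= 2 ^ (2 * b + 7 + e))%N.
  rewrite -lez_nat (X0E num e0 (@denom1 n A t)).
  apply: (@le_trans _ _ ((2 ^ (2 * sn tot))%N%:Z * ((128 * 2 ^ e)%N%:Z * (2 ^ sd tot)%N%:Z))).
    apply: ler_pM; [| |exact: S|].
    - by have := sq_ge0 num tot; move: (\sum_(a < tot) _); clear; lia.
    - by have [_] := G_ge e0 (@denom1 n A t); apply: le_trans.
    by rewrite /Gz PoszM ler_wpM2l // D.
  rewrite -!PoszM lez_nat -[128%N]/(2 ^ 7)%N -!expnD leq_exp2l // bE; clear; lia.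
have : ((wdz n e num den).-1 <= 2 * b + 7 + e)%N.
  by rewrite -(@leq_exp2l 2) //; apply: leq_trans x1 X.
have /andP[_ nb] := n_le_b; have b0 := leq_trans n0 nb.
have h1 : (b <= b * e)%N by rewrite leq_pmulr.
have h2 : (e <= b * e)%N by rewrite leq_pmull.
by rewrite -mulnA; move: h1 h2 b0; move: (b * e)%N b (wdz n e num den); clear; lia.
Qed.

(** A product that dominates every quantity in [T_total_bound] at once. *)
Definition qbase : nat := 256 * 4 ^ n * (11 * b * e) * MBz n e.

Lemma T_le_qbase k :
  (forall n e wd q, (256 <= q)%N -> (n <= q)%N -> (e <= q)%N ->
    (wd <= q)%N -> (4 ^ n <= q)%N -> (MBz n e <= q)%N -> (T_total n e wd <= q ^ k)%N) ->
  (T_total n e (wdz n e num den) <= qbase ^ k)%N.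
Proof.
move=> H; have w1 := wd_le; have /andP[_ nb] := n_le_b; have b0 : (0 < b)%N by apply: leq_trans nb.
have F0 : (0 < 4 ^ n)%N by rewrite expn_gt0.
have M0 : (0 < MBz n e)%N by rewrite /MBz expn_gt0.
have S0 : (0 < 11 * b * e)%N by rewrite !muln_gt0 b0.
have nS : (n <= 11 * b * e)%N.
  by apply: (leq_trans nb); rewrite -mulnA mulnCA leq_pmulr // muln_gt0.
have eS : (e <= 11 * b * e)%N by rewrite leq_pmull // muln_gt0.
have q1 : (256 <= qbase)%N by rewrite /qbase -!mulnA leq_pmulr // !muln_gt0 F0 M0 b0 e0.
have q2 : (4 ^ n <= qbase)%N.
  by rewrite /qbase -mulnA mulnAC leq_pmull // !muln_gt0 M0 b0 e0.
have q3 : (11 * b * e <= qbase)%N.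
  have -> : qbase = (256 * 4 ^ n * MBz n e * (11 * b * e))%N.
    by rewrite /qbase; move: (4 ^ n)%N (MBz n e) b => x y z; ring.
  by rewrite leq_pmull // !muln_gt0 F0 M0.
have q4 : (MBz n e <= qbase)%N by rewrite /qbase leq_pmull // !muln_gt0 F0 b0 e0.
by apply: H => //; apply: leq_trans q3.
Qed.

Lemma qbase_le : (qbase <= 2 ^ (22 * n) * (b * e ^ (2 * n)))%N.
Proof.
have h1 : (MBz n e <= 256 ^ n * e ^ n)%N.
  rewrite /MBz -expnMn leq_exp2r //; move: e0; clear; lia.
have h2 : (e * e ^ n <= e ^ (2 * n))%N.
  by rewrite -expnS leq_pexp2l //; move: n0; clear; lia.
have h3 : (256 * 11 * 4 ^ n * 256 ^ n <= 2 ^ (22 * n))%N.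
  apply: (@leq_trans (2 ^ 12 * 4 ^ n * 256 ^ n)); first by rewrite !leq_mul2r; apply/orP; right; apply/orP; right.
  rewrite (_ : 4 ^ n = 2 ^ (2 * n))%N; last by rewrite expnM.
  rewrite (_ : 256 ^ n = 2 ^ (8 * n))%N; last by rewrite expnM.
  rewrite -!expnD leq_exp2l //.
  by move: n0; clear; lia.
rewrite /qbase; apply: leq_trans (leq_mul (leqnn _) h1) _.
have -> : (256 * 4 ^ n * (11 * b * e) * (256 ^ n * e ^ n) =
   256 * 11 * 4 ^ n * 256 ^ n * (b * (e * e ^ n)))%N.
  by move: (4 ^ n)%N (256 ^ n)%N (e ^ n)%N b => x y z w; ring.
by apply: leq_mul => //; rewrite leq_mul2l h2 orbT.
Qed.

End Size.

(** Take e one more than the integer part of log 1/eps. The maximum with 1 covers eps above 1/2,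
    where the logarithm is less than 1 but e is still 1. *)
Lemma exists_exponent (R : realType) (eps : R) : 0 < eps < 1 ->
  exists e : nat, [/\ (0 < e)%N, 1 <= eps * 2 ^+ e & e%:R <= 2 * Num.max 1 (log2 eps^-1)].
Proof.
move=> /andP[e0 e1]; set L := log2 eps^-1.
have l2 : 0 < ln 2 :> R by apply: ln_gt0; rewrite ltr1n.
have ei : 1 <= eps^-1 by rewrite invf_ge1 // ltW.
have L0 : 0 <= L by rewrite /L /log2; apply: divr_ge0; [exact: ln_ge0|exact: ltW].
have [k /andP[t1 t2]] : exists k : nat, k%:R <= L < k.+1%:R.
  by eexists; exact: (Num.Theory.truncn_itv L0).
exists k.+1; split=> //; last first.
  rewrite -natr1; have : 1 <= Num.max 1 L by rewrite le_max lexx.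
  have : L <= Num.max 1 L by rewrite le_max lexx orbT.
  by move: (Num.max 1 L) t1 => M t1 h1 h2; rewrite mulr2n mulrDl mul1r lerD // (le_trans t1).
rewrite -ler_pdivrMl // mulr1 -ler_ln ?posrE ?invr_gt0 ?exprn_gt0 // lnXn //.
by rewrite -[ln 2 *+ _]mulr_natl -ler_pdivrMr //; exact: ltW.
Qed.

Lemma ratio_bound (R : realType) (eps : R) e (x y : rat) : 0 <= y -> 1 <= eps * 2 ^+ e ->
  2 ^+ e * x <= (2 ^+ e + 1) * y -> ratr x <= (1 + eps) * ratr y.
Proof.
move=> y0 ee; rewrite -(ler_rat R) !rmorphM rmorphD rmorph1 !rmorphXn /= ratr_nat => H.
have yr : 0 <= ratr y :> R by rewrite ler0q.
have p0 : 0 < 2 ^+ e :> R by rewrite exprn_gt0.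
move: (ratr x : R) (ratr y : R) H yr => X Y H yr.
rewrite -(ler_pM2l p0); apply: le_trans H _; rewrite mulrA; apply: ler_wpM2r => //.
by rewrite mulrDr mulr1 lerD2l mulrC.
Qed.

(** * Approximation, success probability and the final bounds *)

Section Final.
Variables (R : realType) (n e : nat) (A : 'M[rat]_n) (t : 'cV[rat]_n) (eps : R).
Hypotheses (n0 : (0 < n)%N) (e0 : (0 < e)%N) (ee : 1 <= eps * 2 ^+ e).
Local Notation num := (numer A t).
Local Notation den := (denom A t).
Local Notation wd := (wdz n e num den).
Local Notation T := (T_total n e wd).
Local Notation P := (compile (cvp_program e) 0).
Local Notation raw := (rawv n (Bz n e num den) (Tz n e num den)).
Local Notation den1 := (@denom1 n A t).
Local Notation dU := (@dU n e A t).

Lemma dist_le_dU U : (Gz n e den)%:~R * dist_inf (vec A U) t <= (dU U)%:R.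
Proof.
have G0 : 0 < (Gz n e den)%:~R :> rat by rewrite ltr0z G_gt0.
rewrite mulrC -ler_pdivlMr //; apply/dist_infP => [|i]; first by rewrite divr_ge0 // ltW.
rewrite ler_pdivlMr // mulrC.
have -> : (Gz n e den)%:~R * `|vec A U i ord0 - t i ord0| = `|(raw U (-1) i)%:~R : rat|.
  by rewrite rawE normrM (gtr0_norm G0).
rewrite -intr_norm.
rewrite -[_%:R]/((dU U)%:Z%:~R) ler_int -abszE lez_nat.
exact: (leq_bigmax i).
Qed.

Lemma success us j0 (coins : T.-tuple bool) lo (v : nat -> int) (c : config) :
  (forall U, (dU us <= dU U)%N) ->
  good_omega (dU us) (@omega n e num den n0 e0 den1 (nth false coins) j0) ->
  lo = 0%N \/ no_hit e num den (@omega n e num den n0 e0 den1 (nth false coins) j0) lo ->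
  (forall i, (i < n)%N -> heap c (2 * i)%N = v i + Tz n e num den i /\ heap c (2 * i).+1 = Gz n e den) ->
  lo.+1 = (2 ^ wd)%N \/ (lo.+1 < 2 ^ wd)%N /\ (exists U, forall i, (i < n)%N ->
     v i = raw U (-1) i /\ `|v i| <= D_of e lo.+1) ->
  approx_closest eps A t (output n c).
Proof.
move=> min good lo1 mem lo2.
have [w9 _ _ _] := setup_hyps num n0 e0 den1.
have dw := min_lt n0 e0 min.
have w1 : (1 < 2 ^ wd)%N by apply: (@leq_trans (2 ^ 1)); [|rewrite leq_exp2l //; move: w9; clear; lia].
have lo3 : lo = 0%N \/ (64 * 2 ^ e * lo < dU us)%N.
  case: lo1 => [->|nh]; first by left.
  case: (posnP lo) => [->|l0]; [by left|right]; rewrite ltnNge; apply/negP => le.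
  have [p pr [beta bM hb]] := good lo ltac:(by rewrite l0; move: lo2; clear; case=> [|[]]; lia) le.
  exact: (nh beta p bM pr hb).
case: lo2 => [l2|[l2 [U UE]]].
  (* If no radius was accepted, then lo = 2^wd - 1 was missed, so the minimum distance would exceed
     64 2^e lo, contrary to [min_lt]. *)
  exfalso; case: lo3 => [l0|lt]; first by move: w1; rewrite -l2 l0.
  have : (0 < 2 ^ e)%N by rewrite expn_gt0.
  by move: lt dw; rewrite -l2; move: (2 ^ e)%N (dU us); clear; nia.
have G0 : (Gz n e den)%:~R != 0 :> rat by rewrite intr_eq0 gt_eqF // G_gt0.
have outE : output n c = vec A U.
  apply/colP => i; rewrite mxE -mul2n; have [-> ->] := mem i (ltn_ord i).
  have [-> _] := UE i (ltn_ord i); rewrite intrD rawE.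
  have -> : (Tz n e num den i)%:~R = (Gz n e den)%:~R * t i ord0 :> rat.
    by rewrite /Tz entryE; [rewrite nth_t|rewrite ltn_add2l].
  by rewrite -mulrDr subrK mulrC mulKf.
rewrite outE; split; first by exists (\col_i U i).
exists (vec A us); first exact: (closest_min n0 e0 min).
apply: (ratio_bound (dist_inf_ge0 _ _) ee).
have gp : (2 ^ e * dU U <= (2 ^ e + 1) * dU us)%N.
  by apply: (search_gap n0 e0 lo3) => i il; have [<- ] := UE i il.
have Gp : 0 < (Gz n e den)%:~R :> rat by rewrite ltr0z G_gt0.
rewrite -(ler_pM2l Gp) mulrCA [leRHS]mulrCA.
apply: (@le_trans _ _ (2 ^+ e * (dU U)%:R)); first by rewrite ler_wpM2l ?exprn_ge0 // dist_le_dU.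
apply: (@le_trans _ _ ((2 ^+ e + 1) * (dU us)%:R)).
  by rewrite -natrX -[1]/(1%:R) -natrD -!natrM ler_nat.
by rewrite ler_wpM2l ?addr_ge0 ?exprn_ge0 // dU_dist.
Qed.

Lemma program_correct :
  runs_in_time P (instance_code A t) T /\
  1 - powR 2 (- (1 * n%:R)) <= coin_prob R (fun coins : T.-tuple bool =>
     approx_closest eps A t (output n (run P (instance_code A t) coins))).
Proof.
have [us min] := exists_min e A t.
have [j0 jl M] := @run_main n e num den (instance_code A t) n0 e0 den1 erefl (input_code A t) (code_le A t n0 e0).
split=> [coins|]; first by have [] := M coins.
have ub i : (i < n)%N -> `|raw us (-1) i| <= (dU us)%:Z.
  move=> il; rewrite -abszE lez_nat; exact: (leq_bigmax (Ordinal il)).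
have UL := @card_unlucky n e num den n0 e0 den1 (dU us) us (min_lt n0 e0 min) ub j0 jl.
rewrite /coin_prob; set E := [pred coins : T.-tuple bool | _].
set G := [pred coins : T.-tuple bool | _] in UL.
have sub : (#|predC G| <= #|E|)%N.
  apply: subset_leq_card; apply/fintype.subsetP => c; rewrite !inE negbK => /asboolP good.
  apply/asboolP; have [_ _ [lo [v [l1 l2 l3]]]] := M c.
  by try apply/asboolP; exact: (success min good l1 l2 l3).
have cT : (#|G| + #|predC G| = 2 ^ T)%N by rewrite cardC card_tuple card_bool.
have p0 : 0 < 2 ^+ T :> R by rewrite exprn_gt0.
have n2 : 0 < 2 ^+ n :> R by rewrite exprn_gt0.
rewrite mul1r powRN powR_mulrn // ler_pdivlMr // mulrBl mul1r lerBlDr.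
have e1 : (2 ^+ T : R) = #|G|%:R + #|predC G|%:R by rewrite -natrD cT natrX.
rewrite {1}e1 addrC; apply: lerD; first by rewrite ler_nat.
rewrite mulrC ler_pdivlMr // mulrC -!natrX -natrM ler_nat; exact: UL.
Qed.

End Final.

Theorem theorem3p1 (R : realType) :
  exists (C : nat) (c : R), 0 < c /\
  forall eps : R, 0 < eps < 1 ->
  exists P : program,
  forall (n : nat) (A : 'M[rat]_n) (t : 'cV[rat]_n), (0 < n)%N ->
  exists T : nat,
  [/\ T%:R <= 2 ^+ (C * n) * Num.max 1 (log2 eps^-1) ^+ (C * n)
              * (encoding_length A t)%:R ^+ C,
      runs_in_time P (instance_code A t) T
    & 1 - powR 2 (- (c * n%:R)) <=
      coin_prob R (fun coins : T.-tuple bool => approx_closest eps A t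
                       (output n (run P (instance_code A t) coins)))].
Proof.
(* The 24 is 22 from [qbase_le] plus 2 from the factor 2 in e <= 2 max(1, log 1/eps), which is
   raised to the power 2 n. *)
have [k kP] := T_total_bound; exists (24 * k)%N, 1; split=> // eps eb.
have [e [e0 ee eL]] := exists_exponent eb.
exists (compile (cvp_program e) 0) => n A t n0.
exists (T_total n e (wdz n e (numer A t) (denom A t))).
have [run prob] := program_correct A t n0 e0 ee; split=> //.
set L := Num.max 1 _ in eL *; have L1 : 1 <= L by rewrite /L le_max lexx.
have L0 : 0 <= L := le_trans ler01 L1.
set b := encoding_length A t.
have b1 : 1 <= b%:R :> R by have /andP[h1 h2] := n_le_b A t n0; rewrite ler1n (leq_trans h1 h2).
have q1 : (qbase e A t)%:R <= 2 ^+ (24 * n) * (b%:R * L ^+ (2 * n)) :> R.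
  apply: (@le_trans _ _ (2 ^ (22 * n) * (b * e ^ (2 * n)))%N%:R); first by rewrite ler_nat qbase_le.
  rewrite !natrM !natrX; have h : e%:R ^+ (2 * n) <= 2 ^+ (2 * n) * L ^+ (2 * n) :> R.
    by rewrite -exprMn; apply: lerXn2r; rewrite ?nnegrE // mulr_ge0.
  rewrite (_ : 24 * n = 22 * n + 2 * n)%N; last by rewrite -mulnDl.
  rewrite exprD -mulrA; apply: ler_wpM2l; first by rewrite exprn_ge0.
  by rewrite mulrCA; apply: ler_wpM2l.
apply: (@le_trans _ _ ((qbase e A t)%:R ^+ k)).
  by rewrite -natrX ler_nat T_le_qbase.
apply: (@le_trans _ _ ((2 ^+ (24 * n) * (b%:R * L ^+ (2 * n))) ^+ k)).
  by apply: lerXn2r; rewrite ?nnegrE // !mulr_ge0 ?exprn_ge0.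
rewrite !exprMn -!exprM -[leRHS]mulrA (_ : 24 * n * k = 24 * k * n)%N; last by ring.
apply: ler_pM.
- by rewrite exprn_ge0.
- by rewrite mulr_ge0 ?exprn_ge0.
- by [].
rewrite mulrC; apply: ler_pM.
- by rewrite exprn_ge0.
- by rewrite exprn_ge0.
- rewrite ler_weXn2l //; have h (x y : nat) : (2 * x * y <= 24 * y * x)%N by clear; nia.
  exact: h.
- by rewrite ler_weXn2l // leq_pmull.
Qed.
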